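(* Let $n>2$, $1\le k<n$, $X\in\mathfrak{X}_0$, $(R,r)$ a hypothesis, let $(\kappa,M,p)$ satisfy Assumption (A), and let the covariance model $\mathfrak{C}$ satisfy $\mathfrak{C}_{AR(1)}\subseteq\mathfrak{C}$. Let $T$ be the test statistic based on $\hat\Omega=\hat\Omega_{\kappa,M,p,X}$, $0<C<\infty$, and $W(C)=\{y\in\mathbb{R}^n:T(y)\ge C\}$. Then: 1. Suppose that for $e=e_+$ or for $e=e_-$ we have $e\notin N^*(\hat\Omega)$ and $T(e+\mu_0^* )>C$ for some $\mu_0^*\in\mathfrak{M}_0$. Then this holds for all $\mu_0^*\in\mathfrak{M}_0$, and $\sup_{\Sigma\in\mathfrak{C}}P_{\mu_0,\sigma^2\Sigma}(W(C))=1$ for every $\mu_0\in\mathfrak{M}_0$ and every $0<\sigma^2<\infty$; in particular the size of the test is $1$. 2. Suppose that for $e=e_+$ or for $e=e_-$ we have $e\notin N^*(\hat\Omega)$ and $T(e+\mu_0^* )<C$ for some $\mu_0^*\in\mathfrak{M}_0$ (then for all $\mu_0^*\in\mathfrak{M}_0$). Then $\inf_{\Sigma\in\mathfrak{C}}P_{\mu_0,\sigma^2\Sigma}(W(C))=0$ for every $\mu_0\in\mathfrak{M}_0$ and $0<\sigma^2<\infty$; $\inf_{\mu_1\in\mathfrak{M}_1}\inf_{\Sigma\in\mathfrak{C}}P_{\mu_1,\sigma^2\Sigma}(W(C))=0$ for every $0<\sigma^2<\infty$; the test is biased; and for every $\mu_1\in\mathfrak{M}_1$, $\inf_{0<\sigma^2<\infty}\inf_{\Sigma\in\mathfrak{C}}P_{\mu_1,\sigma^2\Sigma}(W(C))=0$,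 in particular the infimal power is $0$. 3. Suppose that for $e=e_+$ or for $e=e_-$ we have $e\notin N^*(\hat\Omega)$, $T(e+\mu_0^* )=C$, and $T$ is differentiable at $e+\mu_0^*$, for some $\mu_0^*\in\mathfrak{M}_0$ (then for all $\mu_0^*\in\mathfrak{M}_0$). Then $\sup_{\Sigma\in\mathfrak{C}}P_{\mu_0,\sigma^2\Sigma}(W(C))\ge1/2$ for every $\mu_0\in\mathfrak{M}_0$ and $0<\sigma^2<\infty$; in particular the size is at least $1/2$. 4. Suppose $N^*(\hat\Omega)\neq\mathbb{R}^n$, and that either $e_+\in\mathfrak{M}$ and $R\hat\beta_X(e_+)\neq0$, or $e_-\in\mathfrak{M}$ and $R\hat\beta_X(e_-)\neq0$. Then $\sup_{\Sigma\in\mathfrak{C}}P_{\mu_0,\sigma^2\Sigma}(W(C))=1$ for every $\mu_0\in\mathfrak{M}_0$ and $0<\sigma^2<\infty$; in particular the size is $1$.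
   Context: Let $n>2$, $1\le k<n$, $\mathfrak{X}_0=\{X\in\mathbb{R}^{n\times k}:\operatorname{rank}X=k\}$; $\hat\beta_X(y)=(X'X)^{-1}X'y$, $\hat u_X(y)=y-X\hat\beta_X(y)$, $\mathfrak{M}=\operatorname{span}(X)$. Hypothesis $(R,r)$: $R\in\mathbb{R}^{q\times k}$, $\operatorname{rank}R=q\ge1$, $r\in\mathbb{R}^q$; $\mathfrak{M}_0=\{X\beta:R\beta=r\}$, $\mathfrak{M}_1=\mathfrak{M}\setminus\mathfrak{M}_0$. $e_+=(1,\dots,1)'$, $e_-=(-1,1,-1,\dots,(-1)^n)'\in\mathbb{R}^n$. $P_{\mu,\sigma^2\Sigma}$ is the Gaussian distribution on $\mathbb{R}^n$ with mean $\mu$ and covariance $\sigma^2\Sigma$. The covariance model $\mathfrak{C}$ is a nonempty set of symmetric positive definite $n\times n$ matrices such that $\sigma^2$ and $\Sigma$ are uniquely determined by $\sigma^2\Sigma$. $\Lambda(\rho)_{ij}=\rho^{|i-j|}$, $\mathfrak{C}_{AR(1)}=\{\Lambda(\rho):\rho\in(-1,1)\}$. The size of a rejection region $W$ is $\sup_{\mu_0\in\mathfrak{M}_0}\sup_{0<\sigma^2<\infty}\sup_{\Sigma\in\mathfrak{C}}P_{\mu_0,\sigma^2\Sigma}(W)$; the test is biased if $\inf_{\mu_1\in\mathfrak{M}_1,\sigma^2,\Sigma}P_{\mu_1,\sigma^2\Sigma}(W)<\sup_{\mu_0\in\mathfrak{M}_0,\sigma^2,\Sigma}P_{\mu_0,\sigma^2\Sigma}(W)$.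 Estimator $\hat\Omega_{\kappa,M,p,X}$ at $y$: $\hat V=X'\operatorname{diag}(\hat u_X(y))\in\mathbb{R}^{k\times n}$ with columns $\hat V_{\cdot j}$; $\hat V_p=(\hat V_{\cdot(p+1)},\dots,\hat V_{\cdot n})$; $\hat V_1\in\mathbb{R}^{kp\times(n-p)}$ with $j$-th column $(\hat V_{\cdot(j+p-1)}',\dots,\hat V_{\cdot j}')'$. If $\hat V_1\hat V_1'$ is invertible: $\hat A^{(p)}=(\hat A_1,\dots,\hat A_p)=\hat V_p\hat V_1'(\hat V_1\hat V_1')^{-1}$, $\hat Z=\hat V_p-\hat A^{(p)}\hat V_1$; $\check\Gamma_i=(n-p)^{-1}\sum_{j=i+1}^{n-p}\hat Z_{\cdot j}\hat Z_{\cdot(j-i)}'$ ($0\le i\le n-p-1$), $\check\Gamma_{-i}=\check\Gamma_i'$; $\check\Psi=\sum_{|i|\le n-p-1}\kappa(i/M(y))\check\Gamma_i$ (if $M(y)=0$: weight $1$ at $i=0$, else $0$). If $I_k-\sum_l\hat A_l$ is invertible with inverse $F$: $\hat\Omega_{\kappa,M,p,X}(y)=nR(X'X)^{-1}F\check\Psi F'(X'X)^{-1}R'$. Undefined if $\hat V_1\hat V_1'$ or $I_k-\sum_l\hat A_l$ singular or $M(y)$ undefined. $N^*(\hat\Omega)$: set of $y$ where $\hat\Omega(y)$ is undefined or singular. $T(y)=(R\hat\beta_X(y)-r)'\hat\Omega(y)^{-1}(R\hat\beta_X(y)-r)$ if $y\notin N^*(\hat\Omega)$ and $T(y)=0$ otherwise.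 Bandwidths (undefined if $\hat Z(y)$ undefined or a denominator vanishes; tuning constants independent of $y,X$; weights vector $\omega\in\mathbb{R}^k\setminus\{0\}$, entries $\ge0$). $\mathbb{M}_{AM}$: $\hat\rho_i=\sum_{j=2}^{n-p}\hat Z_{ij}\hat Z_{i(j-1)}/\sum_{j=1}^{n-p-1}\hat Z_{ij}^2$, $\hat\sigma_i^2=(n-p-1)^{-1}\sum_{j=2}^{n-p}(\hat Z_{ij}-\hat\rho_i\hat Z_{i(j-1)})^2$, $\hat\alpha_1=\sum_i\omega_i\frac{4\hat\rho_i^2\hat\sigma_i^4}{(1-\hat\rho_i)^6(1+\hat\rho_i)^2}/\sum_i\omega_i\frac{\hat\sigma_i^4}{(1-\hat\rho_i)^4}$, $\hat\alpha_2=\sum_i\omega_i\frac{4\hat\rho_i^2\hat\sigma_i^4}{(1-\hat\rho_i)^8}/\sum_i\omega_i\frac{\hat\sigma_i^4}{(1-\hat\rho_i)^4}$, $M=c_1(\hat\alpha_jn)^{c_2}$, $c_1,c_2>0$, $j\in\{1,2\}$. $\mathbb{M}_{NW}$: $w(i)\ge0$, $w(0)=1$, $\bar\sigma_i=\omega'\check\Gamma_{|i|}\omega$, $M=\bar c_2([\sum_i|i|^{\bar c_1}w(i)\bar\sigma_i/\sum_iw(i)\bar\sigma_i]^2n)^{\bar c_3}$, $\bar c_1\in\mathbb{N}$, $\bar c_2,\bar c_3>0$. $\mathbb{M}_{KV}$: constants $M>0$. Assumption (A): (i) $\kappa$ even, continuous, $\kappa(0)=1$, $\kappa(x)\to0$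 as $x\to\infty$, $(\kappa((i-j)/s))_{i,j=1}^J$ positive definite for all $s>0$, $J\in\mathbb{N}$; (ii) $M\in\mathbb{M}_{AM}\cup\mathbb{M}_{NW}\cup\mathbb{M}_{KV}$; (iii) $p\in\mathbb{Z}$, $1\le p\le n/(k+1)$. Differentiability of $T$ means Fréchet differentiability of $T:\mathbb{R}^n\to\mathbb{R}$ (existence of the gradient). *)

(* Defs.v *)
From HB Require Import structures.
From mathcomp Require Import all_boot all_order all_algebra.
From mathcomp Require Import all_classical all_reals all_analysis.
Set Implicit Arguments.
Unset Strict Implicit.
Unset Printing Implicit Defensive.
Import Order.TTheory GRing.Theory Num.Theory.
Import numFieldNormedType.Exports.
Local Open Scope classical_set_scope.
Local Open Scope ring_scope.

Section Defs.
Context {R : realType}.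

Definition getm {m n : nat} (A : 'M[R]_(m, n)) (i j : nat) : R :=
  match @insub _ (fun x => x < m)%N _ i, @insub _ (fun x => x < n)%N _ j with
  | Some i', Some j' => A i' j'
  | _, _ => 0
  end.

Definition beta_hat {n k} (X : 'M[R]_(n, k)) (y : 'cV[R]_n) : 'cV[R]_k :=
  invmx (X^T *m X) *m X^T *m y.
Definition u_hat {n k} (X : 'M[R]_(n, k)) (y : 'cV[R]_n) : 'cV[R]_n :=
  y - X *m beta_hat X y.

Definition Mspan {n k} (X : 'M[R]_(n, k)) : set 'cV[R]_n :=
  [set mu | exists b : 'cV[R]_k, mu = X *m b].
Definition M0 {n k q} (X : 'M[R]_(n, k)) (Rm : 'M[R]_(q, k)) (r : 'cV[R]_q)
  : set 'cV[R]_n := [set mu | exists b : 'cV[R]_k, Rm *m b = r /\ mu = X *m b].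
Definition M1 {n k q} (X : 'M[R]_(n, k)) (Rm : 'M[R]_(q, k)) (r : 'cV[R]_q)
  : set 'cV[R]_n := Mspan X `\` M0 X Rm r.

(* e_+ = (1,...,1)', e_- = (-1,1,-1,...,(-1)^n)' ; 0-based index i holds (-1)^(i+1) *)
Definition e_plus {n} : 'cV[R]_n := \col_(i < n) 1.
Definition e_minus {n} : 'cV[R]_n := \col_(i < n) (-1) ^+ (i.+1).

Definition Lambda {n} (rho : R) : 'M[R]_n :=
  \matrix_(i < n, j < n) rho ^+ `|(i : int) - (j : int)|%N.

Definition posdef {m} (A : 'M[R]_m) : Prop :=
  forall v : 'cV[R]_m, v != 0 -> 0 < (v^T *m A *m v) 0 0.
Definition symmetric {m} (A : 'M[R]_m) : Prop := A^T = A.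

Definition covariance_model {n} (Cm : set 'M[R]_n) : Prop :=
  Cm !=set0 /\
  (forall S, Cm S -> symmetric S /\ posdef S) /\
  (forall s1 s2 S1 S2, 0 < s1 -> 0 < s2 -> Cm S1 -> Cm S2 ->
      s1 *: S1 = s2 *: S2 -> s1 = s2 /\ S1 = S2).

Fixpoint iint (m : nat) : ('cV[R]_m -> \bar R) -> \bar R :=
  match m return ('cV[R]_m -> \bar R) -> \bar R with
  | 0 => fun f => f 0
  | m'.+1 => fun f =>
      (\int[@lebesgue_measure R]_x iint (fun v : 'cV[R]_m' =>
          f (col_mx (x%:M : 'M[R]_1) v)))%E
  end.

Definition gauss_density {n} (mu : 'cV[R]_n) (S : 'M[R]_n) (y : 'cV[R]_n) : R :=
  (Num.sqrt ((pi *+ 2) ^+ n * \det S))^-1 *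
  expR (- ((y - mu)^T *m invmx S *m (y - mu)) 0 0 / 2).

Definition gauss_prob {n} (mu : 'cV[R]_n) (S : 'M[R]_n) (W : set 'cV[R]_n) : \bar R :=
  iint (fun y => (\1_W y * gauss_density mu S y)%:E).

Inductive bandwidth (k : nat) :=
| BW_AM of 'cV[R]_k (* omega *) & R (* c1 *) & R (* c2 *) & bool (* true: alpha_1, false: alpha_2 *)
| BW_NW of (int -> R) (* w *) & 'cV[R]_k (* omega *) & nat (* cbar1 *) & R (* cbar2 *) & R (* cbar3 *)
| BW_KV of R (* constant M *).

Definition weights_ok {k} (om : 'cV[R]_k) : Prop :=
  om != 0 /\ forall i, 0 <= om i 0.

Definition bandwidth_ok {k} (bw : bandwidth k) : Prop :=
  match bw with
  | BW_AM om c1 c2 _ => weights_ok om /\ 0 < c1 /\ 0 < c2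
  | BW_NW w om cb1 cb2 cb3 =>
      (forall i, 0 <= w i) /\ w 0 = 1 /\ weights_ok om /\
      (0 < cb1)%N /\ 0 < cb2 /\ 0 < cb3
  | BW_KV M => 0 < M
  end.

(* Gamma-check_i built from Zhat (k x m matrix, m = n - p), 0 <= i *)
Definition Gamma_check {k m} (Z : 'M[R]_(k, m)) (i : nat) : 'M[R]_k :=
  (m%:R)^-1 *: \matrix_(a < k, b < k)
     \sum_(i <= j < m) getm Z a j * getm Z b (j - i).

Definition symsum (m : nat) (f : int -> R) : R :=
  \sum_(j < (m.-1).*2.+1) f (j%:Z - (m.-1)%:Z).

Definition bandwidth_val {k m} (n : nat) (bw : bandwidth k) (Z : 'M[R]_(k, m))
  : option R :=
  match bw with
  | BW_AM om c1 c2 j1 =>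
      let rden i := \sum_(0 <= j < m.-1) getm Z i j ^+ 2 in
      let rho i := (\sum_(1 <= j < m) getm Z i j * getm Z i (j.-1)) / rden i in
      let sig2 i := (m.-1%:R)^-1 *
          \sum_(1 <= j < m) (getm Z i j - rho i * getm Z i (j.-1)) ^+ 2 in
      let den := \sum_(i < k) om i 0 * (sig2 i ^+ 2 / (1 - rho i) ^+ 4) in
      let num1 := \sum_(i < k) om i 0 *
          (4 * rho i ^+ 2 * sig2 i ^+ 2 / ((1 - rho i) ^+ 6 * (1 + rho i) ^+ 2)) in
      let num2 := \sum_(i < k) om i 0 *
          (4 * rho i ^+ 2 * sig2 i ^+ 2 / (1 - rho i) ^+ 8) in
      if [forall i : 'I_k, (rden i != 0) && (1 - rho i != 0) &&
                            (j1 ==> (1 + rho i != 0))] && (den != 0)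
      then Some (c1 * powR ((if j1 then num1 / den else num2 / den) * n%:R) c2)
      else None
  | BW_NW w om cb1 cb2 cb3 =>
      let sbar (i : int) := (om^T *m Gamma_check Z `|i|%N *m om) 0 0 in
      let den := symsum m (fun i => w i * sbar i) in
      let num := symsum m (fun i => (`|i|%N)%:R ^+ cb1 * w i * sbar i) in
      if den != 0 then Some (cb2 * powR ((num / den) ^+ 2 * n%:R) cb3)
      else None
  | BW_KV M => Some M
  end.

Definition Omega_hat {n k q} (kappa : R -> R) (bw : bandwidth k) (p : nat)
  (X : 'M[R]_(n, k)) (Rm : 'M[R]_(q, k)) (y : 'cV[R]_n) : option 'M[R]_q :=
  let V : 'M[R]_(k, n) := X^T *m diag_mx (u_hat X y)^T in
  let Vp : 'M[R]_(k, n - p) := \matrix_(i < k, j < n - p) getm V i (j + p) in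
  let V1 : 'M[R]_(k * p, n - p) :=
      \matrix_(a < k * p, j < n - p) getm V (a %% k) (j + p - 1 - a %/ k) in
  if V1 *m V1^T \in unitmx then
    let A : 'M[R]_(k, k * p) := Vp *m V1^T *m invmx (V1 *m V1^T) in
    let SumA : 'M[R]_k := \matrix_(i < k, j < k) \sum_(l < p) getm A i (l * k + j) in
    let Z : 'M[R]_(k, n - p) := Vp - A *m V1 in
    match bandwidth_val n bw Z with
    | None => None
    | Some M =>
      let wt (x : R) := if M == 0 then (if x == 0 then 1 else 0) else kappa (x / M) in
      let Psi : 'M[R]_k :=
          \sum_(0 <= i < n - p) wt i%:R *: Gamma_check Z i +
          \sum_(1 <= i < n - p) wt (- i%:R) *: (Gamma_check Z i)^T in
      if 1%:M - SumA \in unitmx then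
        let F := invmx (1%:M - SumA) in
        Some (n%:R *: (Rm *m invmx (X^T *m X) *m F *m Psi *m F^T
                        *m invmx (X^T *m X) *m Rm^T))
      else None
    end
  else None.

Definition Nstar {n q} (Om : 'cV[R]_n -> option 'M[R]_q) : set 'cV[R]_n :=
  [set y | match Om y with Some Oy => Oy \notin unitmx | None => true end].

Definition Tstat {n k q} (Om : 'cV[R]_n -> option 'M[R]_q) (X : 'M[R]_(n, k))
  (Rm : 'M[R]_(q, k)) (r : 'cV[R]_q) (y : 'cV[R]_n) : R :=
  let d := Rm *m beta_hat X y - r in
  match Om y with
  | Some Oy => if Oy \in unitmx then (d^T *m invmx Oy *m d) 0 0 else 0
  | None => 0
  end.

Definition kernel_ok (kappa : R -> R) : Prop :=
  (forall x, kappa (- x) = kappa x) /\ continuous kappa /\ kappa 0 = 1 /\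
  (kappa x @[x --> +oo] --> 0) /\
  (forall (s : R) (J : nat), 0 < s ->
     posdef (\matrix_(i < J, j < J) kappa (((i : int) - (j : int))%:~R / s))).

Definition assumption_A {n k} (kappa : R -> R) (bw : bandwidth k) (p : nat) : Prop :=
  kernel_ok kappa /\ bandwidth_ok bw /\ (1 <= p)%N /\ (p * (k + 1) <= n)%N.

Definition Wreg {n} (T : 'cV[R]_n -> R) (C : R) : set 'cV[R]_n := [set y | C <= T y].

Definition supSigma {n} (Cm : set 'M[R]_n) mu s2 W : \bar R :=
  ereal_sup [set gauss_prob mu (s2 *: S) W | S in Cm].
Definition infSigma {n} (Cm : set 'M[R]_n) mu s2 W : \bar R :=
  ereal_inf [set gauss_prob mu (s2 *: S) W | S in Cm].

Definition test_size {n} (M0s : set 'cV[R]_n) (Cm : set 'M[R]_n) W : \bar R :=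
  ereal_sup [set x | exists mu s2 S, M0s mu /\ 0 < s2 /\ Cm S /\
                                     x = gauss_prob mu (s2 *: S) W].
Definition infimal_power {n} (M1s : set 'cV[R]_n) (Cm : set 'M[R]_n) W : \bar R :=
  ereal_inf [set x | exists mu s2 S, M1s mu /\ 0 < s2 /\ Cm S /\
                                     x = gauss_prob mu (s2 *: S) W].
Definition biased {n} (M0s M1s : set 'cV[R]_n) (Cm : set 'M[R]_n) W : Prop :=
  (infimal_power M1s Cm W < test_size M0s Cm W)%E.

End Defs.

(* Main.v *)
(* Write a Gaussian vector with AR(1) correlation as mu + sigma L g, with g standard Gaussian and L
   the Cholesky factor of Lambda(rho).  As rho tends to s = 1 or s = -1, L g = g_0 v + eps w, where
   v = (s^i)_i is e_+ or -e_-, eps = sqrt(1 - rho^2) tends to 0, and w converges to a nondegenerate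
   linear image of (g_1, ..., g_(n-1)).  The statistic T is invariant under
   mu_0 + y -> mu_0' + a y for a <> 0, so T(mu_0 + sigma L g) = T(mu_0' + e + small), and T is
   continuous off N*, because kappa vanishes at infinity (this matters where the bandwidth tends to
   0).  Hence the rejection indicator converges almost surely to that of T(e + mu_0') > C, which gives
   parts 1 and 2.  When T(e + mu_0') = C, invariance makes the derivative of T vanish at e and equal
   2 C on some X b, so the first-order term is a nonzero polynomial in g that is odd in g_0, hence
   positive with probability 1/2.  In part 4, e lies in span(X), so Omega only sees eps w and scales
   as eps^2 while the numerator of T stays away from 0: T diverges as soon as w is off N*, and the
   complement of N* is the nonvanishing set of a polynomial.  *)

Require Import Defs.
From HB Require Import structures.
From mathcomp Require Import all_boot all_order all_algebra.
From mathcomp Require Import all_classical all_reals all_analysis.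
From mathcomp Require Import measurable_realfun ring lra zify.
Set Implicit Arguments.
Unset Strict Implicit.
Unset Printing Implicit Defensive.
Import Order.TTheory GRing.Theory Num.Theory.
Import numFieldNormedType.Exports.
Import HBNNSimple.
Local Open Scope classical_set_scope.
Local Open Scope ring_scope.

(** * Gaussian measures *)

(** [gauss_prob] is an iterated one-dimensional integral of a density, not a measure, so it has to
    be identified with an image of a genuine probability [Pn]. A triangular Cholesky factor makes
    this possible one coordinate at a time: each substitution is affine in a single variable. Almost
    sure convergence enters in one-sided form: if almost every g eventually lies in the rejection
    events, the supremum of their probabilities is 1. That the limit point is off N*, or that the
    first-order term is nonzero, holds for almost every g because a polynomial nonzero at one point
    vanishes on a null set. For N* this works because the estimator is a multiple of N K N' with K
    positive definite: its singularity depends on N only, hence not on the value of the bandwidth,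
    which is not polynomial in the data. The value 2 C comes from moving e to e + t X b with R b = R
    beta_hat(e): Omega is unchanged and R beta_hat is multiplied by 1 + t, so T goes from C to (1 +
    t)^2 C. In part 2 a fixed mean in M_1 is absorbed by letting sigma tend to infinity; for fixed
    sigma the mean is sent to M_0. *)

Section Measure.
Variable R : realType.
Local Notation leb := (@lebesgue_measure R).
Local Notation N01 := (@normal_prob R 0 1).

Lemma affine_preimage_itv (m a x y : R) : a != 0 ->
  lebesgue_measure ((fun t : R => m + a * t) @^-1` `]x, y]) =
  (`|a|^-1%:E * lebesgue_measure (`]x, y]%classic : set R))%E.
Proof.
move=> a0; case: (ltP x y) => xy; last first.
  rewrite set_itv_ge ?bnd_simp -?leNgt// preimage_set0 measure0 mule0//.
rewrite lebesgue_measure_itv/= lte_fin xy.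
have [ap|an|/eqP] := ltgtP a 0; last by rewrite (negbTE a0).
- have -> : (fun t : R => m + a * t) @^-1` `]x, y] = `[(y - m) / a, (x - m) / a[%classic.
    apply/seteqP; split=> t /=; rewrite !in_itv/= => /andP[h1 h2]; apply/andP; split.
    + by rewrite ler_ndivrMr//; lra.
    + by rewrite ltr_ndivlMr//; lra.
    + by move: h2; rewrite ltr_ndivlMr//; lra.
    + by move: h1; rewrite ler_ndivrMr//; lra.
  rewrite lebesgue_measure_itv/= lte_fin ltr_nM2r ?invr_lt0// ltrD2r xy.
  by rewrite ltr0_norm// -!EFinD -EFinM; congr EFin; field.
- have -> : (fun t : R => m + a * t) @^-1` `]x, y] = `](x - m) / a, (y - m) / a]%classic.
    apply/seteqP; split=> t /=; rewrite !in_itv/= => /andP[h1 h2]; apply/andP; split.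
    + by rewrite ltr_pdivrMr//; lra.
    + by rewrite ler_pdivlMr//; lra.
    + by move: h1; rewrite ltr_pdivrMr//; lra.
    + by move: h2; rewrite ler_pdivlMr//; lra.
  rewrite lebesgue_measure_itv/= lte_fin ltr_pM2r ?invr_gt0// ltrD2r xy.
  by rewrite gtr0_norm// -!EFinD -EFinM; congr EFin; field.
Qed.

(** The image of Lebesgue measure under t -> m + a t, multiplied by |a|, agrees with Lebesgue
    measure on half-open intervals, hence on all Borel sets. Negative a is included, so that
    reflections are covered too. *)
Lemma integral_affine (f : measurableTypeR R -> \bar R) (m a : R) : a != 0 ->
  measurable_fun setT f -> (forall x, 0 <= f x)%E ->
  (\int[leb]_x f x = `|a|%:E * \int[leb]_t f (m + a * t)%R)%E.
Proof.
move=> a0 mf f0.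
pose phi : measurableTypeR R -> measurableTypeR R := fun t => m + a * t.
have mphi : measurable_fun setT phi.
  by apply: measurable_funD => //; apply: measurable_funM => //.
pose mu : {measure set (measurableTypeR R) -> \bar R} := mscale (NngNum (normr_ge0 a)) (measure_function_pushforward__canonical__measure_function_Measure leb mphi).
have key : forall A, measurable A -> leb A = mu A.
  move=> A mA; apply: (@lebesgue_measure_unique R mu) => //.
  move=> _ [[x y] _ <-].
  change (leb `]x, y] = (`|a|%:E * leb ((fun t : R => (m + a * t)%R) @^-1` `]x, y]))%E).
  rewrite affine_preimage_itv// muleA -EFinM.
  by rewrite divff ?normr_eq0// mul1e.
rewrite (eq_measure_integral mu); last by move=> A mA _; exact: key.
by rewrite ge0_integral_mscale//= ge0_integral_pushforward.
Qed.

(** Both sides agree on indicators by the definition of [normal_prob], hence on simple functions,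
    and monotone convergence passes to f. *)
Lemma integral_normal (f : measurableTypeR R -> \bar R) :
  measurable_fun setT f -> (forall x, 0 <= f x)%E ->
  (\int[N01]_x f x = \int[leb]_x (f x * (normal_pdf 0 1 x)%:E))%E.
Proof.
move=> mf f0.
have mp : measurable_fun [set: measurableTypeR R] (fun x => (normal_pdf (0:R) 1 x)%:E).
  by apply/measurable_EFinP; exact: measurable_normal_pdf.
have p0 x : (0 <= (normal_pdf (0:R) 1 x)%:E)%E by rewrite lee_fin normal_pdf_ge0.
pose f_ := nnsfun_approx measurableT mf.
transitivity (limn (fun n => \int[N01]_x (f_ n x)%:E)%E).
  rewrite -monotone_convergence//.
  - by apply: eq_integral => y _; apply/esym/cvg_lim => //; apply: cvg_nnsfun_approx.
  - by move=> n; exact/measurable_EFinP/measurable_funP.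
  - by move=> n y _; rewrite lee_fin.
  - by move=> y _ i j ij; rewrite lee_fin; exact/lefP/nd_nnsfun_approx.
transitivity (limn (fun n => \int[leb]_x ((f_ n x)%:E * (normal_pdf 0 1 x)%:E))%E); last first.
  rewrite -monotone_convergence//.
  - apply: eq_integral => y _; apply/cvg_lim => //; apply: cvgeZr => //.
    by apply: cvg_nnsfun_approx.
  - by move=> n; apply: emeasurable_funM => //; exact/measurable_EFinP/measurable_funP.
  - by move=> n y _; rewrite mule_ge0// lee_fin.
  - move=> y _ i j ij; rewrite lee_wpmul2r// lee_fin; exact/lefP/nd_nnsfun_approx.
congr (limn _); apply/funext => n.
under eq_integral do rewrite fimfunE -fsumEFin//.
rewrite ge0_integral_fsum//; last 2 first.
  - by move=> y; exact/measurable_EFinP/measurable_funM.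
  - by move=> y x _; rewrite nnfun_muleindic_ge0.
under [RHS]eq_integral => x _.
  rewrite fimfunE -fsumEFin// ge0_mule_fsuml; last first.
    by move=> r; rewrite EFinM nnfun_muleindic_ge0.
  over.
rewrite [RHS]ge0_integral_fsum//; last 2 first.
  - move=> r; apply: emeasurable_funM => //; exact/measurable_EFinP/measurable_funM.
  - by move=> y x _; rewrite mule_ge0// nnfun_muleindic_ge0.
apply: eq_fsbigr => r rf.
rewrite integralZl_indic_nnsfun// integral_indic//= setIT.
under [RHS]eq_integral do rewrite EFinM -muleA.
rewrite /normal_prob; have r0 : (0 <= r%:E)%E.
  by rewrite inE in rf; case: rf => t _ <-; rewrite lee_fin.
rewrite ge0_integralZl//; last 2 first.
  - by apply: emeasurable_funM => //; exact/measurable_EFinP.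
  - by move=> x _; rewrite mule_ge0// lee_fin.
congr (_ * _)%E; rewrite [LHS]integral_mkcond; apply: eq_integral => x _.
rewrite patchE indicE; case: ifP => _; by rewrite ?mul1e ?mul0e.
Qed.

(** * Column vectors as a Borel space, and the standard Gaussian law on them *)

Definition bvec n : Type := g_sigma_algebraType (@open 'cV[R]_n).
HB.instance Definition _ n := Measurable.on (bvec n).

Definition consv n (xv : measurableTypeR R * bvec n) : bvec n.+1 :=
  col_mx (xv.1%:M : 'M[R]_1) (xv.2 : 'cV[R]_n).

Lemma open_meas n (U : set 'cV[R]_n) : open U -> measurable (U : set (bvec n)).
Proof. by move=> oU; apply: sub_sigma_algebra. Qed.


(** Second countability, by rational centres and radii 1 / (k + 1). Balls are cubes here, so each of
    them pulls back to a measurable rectangle under [consv]. *)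
Lemma open_bigcup_ball n (U : set 'cV[R]_n) : open U ->
  U = \bigcup_(ck : 'cV[rat]_n * nat)
        (if `[< ball (map_mx ratr ck.1 : 'cV[R]_n) (ck.2.+1%:R^-1 : R) `<=` U >]
         then ball (map_mx ratr ck.1 : 'cV[R]_n) (ck.2.+1%:R^-1 : R) else set0).
Proof.
move=> oU; apply/seteqP; split=> [y Uy|y [[c k] _ /=]]; last first.
  by case: ifPn => // /asboolP cU yc; exact: cU.
have /nbhs_ballP[e /= e0 yeU] : nbhs y U by exact: open_nbhs_nbhs.
have e20 : 0 < e / 2 by rewrite divr_gt0.
have [k ke] : exists k, k.+1%:R^-1 < e / 2 :> R.
  by have [k _ /(_ k (leqnn _))] := near_infty_natSinv_lt (PosNum e20); exists k.
have kp : 0 < k.+1%:R^-1 :> R by rewrite invr_gt0 ltr0n.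
have /choice[c hc] : forall i : 'I_n, exists q : rat, `|ratr q - y i 0| < k.+1%:R^-1.
  move=> i; move: (k.+1%:R^-1) kp => d dp.
  have : y i 0 - d < y i 0 + d by lra.
  by move=> /rat_in_itvoo[q]; rewrite in_itv/= => /andP[h1 h2]; exists q; rewrite ltr_norml; apply/andP; split; lra.
exists (\col_i c i, k) => //=.
have yb : ball (map_mx ratr (\col_i c i) : 'cV[R]_n) (k.+1%:R^-1 : R) y.
  split => // i j; rewrite !mxE ord1 /ball /=; exact: hc.
case: ifPn => // /asboolP; case=> z zb; apply: yeU.
apply: (@le_ball _ _ y (k.+1%:R^-1 + k.+1%:R^-1)).
  by move: (k.+1%:R^-1) ke => d; lra.
by apply: ball_triangle zb; apply: ball_sym.
Qed.

Lemma ball_consv n (c : 'cV[R]_(1 + n)) (e : R) (xv : measurableTypeR R * bvec n) : 0 < e ->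
  ball c e (consv xv : 'cV[R]_(1 + n)) <->
  ball (c 0 0) e (xv.1 : R) /\ ball (dsubmx c) e (xv.2 : 'cV[R]_n).
Proof.
move=> e0; split=> [[_ h]|[h1 [_ h2]]].
  split; last first.
    split=> // i j; rewrite mxE; have := h (rshift 1 i) j.
    by rewrite /consv col_mxEd.
  have := h (lshift n 0) 0; rewrite /consv col_mxEu mxE mulr1n.
  by congr (ball (c _ _) _ _); apply/val_inj.
split=> // i j; rewrite /consv -[i]splitK; case: (fintype.split i) => k /=; rewrite ?col_mxEu ?col_mxEd.
  rewrite !ord1 mxE mulr1n; move: h1; by congr (ball (c _ _) _ _); apply/val_inj.
by have := h2 k j; rewrite mxE.
Qed.

Lemma measurable_consv n : measurable_fun setT (@consv n).
Proof.
apply: (@measurability _ _ _ _ _ _ (@open 'cV[R]_n.+1 : set (set (bvec n.+1)))) => // _ [U oU <-].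
rewrite setTI (open_bigcup_ball oU) preimage_bigcup.
apply: countable_bigcupT_measurable => [|[c k]]; first exact: countableP.
case: ifPn => _; last by rewrite preimage_set0.
set e := (_^-1 : R); have e0 : 0 < e by rewrite invr_gt0 ltr0n.
rewrite (_ : _ @^-1` _ = ball ((map_mx ratr c : 'cV[R]_(1 + n)) 0 0) e `*`
   ball (dsubmx (map_mx ratr c : 'cV[R]_(1 + n))) e).
  apply: measurableX; first by apply: open_measurable; exact: ball_open.
  by apply: open_meas; exact: ball_open.
by apply/seteqP; split => xv /= => /(ball_consv _ _ e0).
Qed.

HB.instance Definition _ n := isMeasurableFun.Build _ _ _ _ (@consv n) (@measurable_consv n).

(** The standard Gaussian law, built by adding one coordinate at the front so that its recursion
    mirrors that of [iint]. *)
Fixpoint Pn n : probability (bvec n) R :=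
  match n with
  | 0 => dirac (0 : bvec 0)
  | n'.+1 => distribution (product_measure1 N01 (Pn n')) (@consv n')
  end.

Lemma meas_comp_consv n (f : bvec n.+1 -> \bar R) : measurable_fun setT f ->
  measurable_fun setT (f \o @consv n).
Proof. by move=> mf; apply: measurableT_comp => //; exact: measurable_consv. Qed.

Lemma meas_section n (F : measurableTypeR R * bvec n -> \bar R) x :
  measurable_fun setT F -> measurable_fun setT (fun v => F (x, v)).
Proof. by move=> mF; apply: measurableT_comp => //; exact: measurable_pair1. Qed.

Definition psi n (y : bvec n) : R := \prod_i normal_pdf 0 1 ((y : 'cV[R]_n) i 0).

Lemma consv0 n x (v : bvec n) : (consv (x, v) : 'cV[R]_n.+1) ord0 0 = x.
Proof.
transitivity ((col_mx (x%:M) v : 'cV[R]_(1 + n)) (lshift n 0) 0).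
  by congr (fun_of_matrix _ _ _); apply/val_inj.
by rewrite col_mxEu mxE.
Qed.

Lemma consvS n x (v : bvec n) (i : 'I_n) :
  (consv (x, v) : 'cV[R]_n.+1) (lift ord0 i) 0 = (v : 'cV[R]_n) i 0.
Proof.
transitivity ((col_mx (x%:M) v : 'cV[R]_(1 + n)) (rshift 1 i) 0).
  by congr (fun_of_matrix _ _ _); apply/val_inj.
by rewrite col_mxEd.
Qed.

Lemma psi_consv n x (v : bvec n) : psi (consv (x, v)) = normal_pdf 0 1 x * psi v.
Proof.
rewrite /psi big_ord_recl consv0; congr (_ * _).
by apply: eq_bigr => i _; rewrite consvS.
Qed.

Lemma npdf_gt0 x : 0 < normal_pdf (0:R) 1 x.
Proof. by rewrite normal_pdfE ?oner_neq0// mulr_gt0 ?normal_peak_gt0 ?oner_neq0// expR_gt0. Qed.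

Lemma psi_gt0 n (v : bvec n) : 0 < psi v.
Proof. by rewrite /psi prodr_gt0// => i _; exact: npdf_gt0. Qed.

(** Tonelli, one coordinate at a time; the density [psi] splits off the factor of the first
    coordinate. *)
Lemma iint_psi n (f : bvec n -> \bar R) : measurable_fun setT f -> (forall y, 0 <= f y)%E ->
  iint (fun y => f y * (psi y)%:E)%E = (\int[Pn n]_y f y)%E.
Proof.
elim: n f => [f mf f0|n IH f mf f0] /=.
  by rewrite /psi big_ord0 mule1 integral_dirac// diracT mul1e.
rewrite ge0_integral_distribution//.
have mfc := meas_comp_consv mf.
have gf0 x : (0 <= (f \o @consv n) x)%E by exact: f0.
rewrite (fubini_tonelli1 _ mfc)// integral_normal//; last 2 first.
- exact: measurable_fun_fubini_tonelli_F.
- by move=> x; apply: integral_ge0.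
apply: eq_integral => x _.
transitivity (iint (fun v : 'cV[R]_n => (f (consv (x, v)) * (normal_pdf 0 1 x)%:E) * (psi (v : bvec n))%:E)%E).
  congr iint; apply/funext => v.
  by rewrite -muleA -EFinM -psi_consv.
rewrite IH.
- rewrite /fubini_F ge0_integralZr//=.
  + exact: (meas_section x mfc).
  + by rewrite lee_fin normal_pdf_ge0.
- apply: emeasurable_funM => //; exact: (meas_section x mfc).
- by move=> y; rewrite mule_ge0// lee_fin normal_pdf_ge0.
Qed.

Lemma continuous_measurable_bvec n (f : 'cV[R]_n -> R) : continuous f ->
  measurable_fun setT (f : bvec n -> R).
Proof.
move=> cf; apply: (measurability _ (RGenOpens.measurableE R)).
move=> _ [_ [a [b ->] <-]]; rewrite setTI; apply: open_meas.
by move/continuousP: cf; apply; exact: interval_open.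
Qed.

Lemma continuous_measurable_map m n (f : 'cV[R]_m -> 'cV[R]_n) : continuous f ->
  measurable_fun setT (f : bvec m -> bvec n).
Proof.
move=> cf; apply: (@measurability _ _ _ _ _ _ (@open 'cV[R]_n : set (set (bvec n)))) => // _ [U oU <-].
by rewrite setTI; apply: open_meas; move/continuousP: cf; apply.
Qed.

Lemma psi_neq0 n (v : 'cV[R]_n) : psi (v : bvec n) != 0.
Proof. by apply: lt0r_neq0; exact: psi_gt0. Qed.

Lemma cvg_sumr (I T : Type) (F : set_system T) (FF : Filter F) (r : seq I) (f : I -> T -> R) (l : I -> R) :
  (forall i, f i x @[x --> F] --> l i) ->
  (\sum_(i <- r) f i x) @[x --> F] --> \sum_(i <- r) l i.
Proof.
move=> fl; elim: r => [|i r IH].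
  by rewrite big_nil; under eq_fun do rewrite big_nil; exact: cvg_cst.
by rewrite big_cons; under eq_fun do rewrite big_cons; exact: cvgD.
Qed.

Lemma cvg_mx (T : Type) (F : set_system T) (FF : Filter F) m n (f : T -> 'M[R]_(m, n)) (l : 'M[R]_(m, n)) :
  (forall i j, f x i j @[x --> F] --> l i j) -> f x @[x --> F] --> l.
Proof.
move=> fl U [P lP PU].
have h : \forall x \near F, forall ij : 'I_m * 'I_n, P ij.1 ij.2 (f x ij.1 ij.2).
  by apply: filter_forall => ij; exact: (fl ij.1 ij.2 _ (lP ij.1 ij.2)).
by apply: filterS h => x hx; apply: PU => i j; exact: (hx (i, j)).
Qed.

Lemma cvg_prodr (I T : Type) (F : set_system T) (FF : Filter F) (r : seq I) (f : I -> T -> R) (l : I -> R) :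
  (forall i, f i x @[x --> F] --> l i) ->
  (\prod_(i <- r) f i x) @[x --> F] --> \prod_(i <- r) l i.
Proof.
move=> fl; elim: r => [|i r IH].
  by rewrite big_nil; under eq_fun do rewrite big_nil; exact: cvg_cst.
by rewrite big_cons; under eq_fun do rewrite big_cons; exact: cvgM.
Qed.

Lemma psi_continuous n : continuous (@psi n : 'cV[R]_n -> R).
Proof.
move=> y; apply: (@cvg_prodr _ _ (nbhs y)) => i.
apply: (@cvg_comp _ _ _ (fun y : 'cV[R]_n => y i 0) (normal_pdf 0 1)); first exact: coord_continuous.
exact: continuous_normal_pdf.
Qed.

(** Since [psi] is positive, the iterated Lebesgue integral of F is the [Pn] integral of F / psi,
    whose dependence on the parameter is measurable by Tonelli. *)
Lemma iint_measurable n (F : measurableTypeR R * bvec n -> \bar R) :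
  measurable_fun setT F -> (forall y, 0 <= F y)%E ->
  measurable_fun [set: measurableTypeR R] (fun x => iint (fun v => F (x, v))).
Proof.
move=> mF F0.
have mpV : measurable_fun setT (fun v : bvec n => (psi v)^-1%:E).
  apply/measurable_EFinP; apply: (@continuous_measurable_bvec n (fun v => (psi (v : bvec n))^-1)).
  by move=> v; exact: (cvgV (psi_neq0 v) (@psi_continuous n v)).
rewrite (_ : (fun x => _) = fubini_F (Pn n) (fun xv => F xv * (psi xv.2)^-1%:E)%E).
  apply: measurable_fun_fubini_tonelli_F.
    apply: emeasurable_funM => //.
    by apply: (measurableT_comp mpV); exact: measurable_snd.
  by move=> xv; rewrite mule_ge0// lee_fin invr_ge0 ltW// psi_gt0.
apply/funext => x; rewrite /fubini_F -iint_psi/=.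
- congr iint; apply/funext => v; rewrite -muleA -EFinM mulVf ?mule1//.
  by rewrite gt_eqF// psi_gt0.
- by apply: emeasurable_funM => //; exact: meas_section.
- by move=> v; rewrite mule_ge0// lee_fin invr_ge0 ltW// psi_gt0.
Qed.

Lemma affine_continuous m n (A : 'M[R]_(m, n)) (b : 'cV[R]_m) :
  continuous (fun g : 'cV[R]_n => b + A *m g).
Proof.
move=> g; apply: (@cvg_mx _ (nbhs g)) => i j; rewrite !mxE.
under eq_fun do rewrite !mxE.
apply: cvgD; first exact: cvg_cst.
apply: (@cvg_sumr _ _ (nbhs g)) => l; apply: cvgM; first exact: cvg_cst.
exact: coord_continuous.
Qed.

Lemma iint_ge0 n (f : 'cV[R]_n -> \bar R) : (forall y, 0 <= f y)%E -> (0 <= iint f)%E.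
Proof.
elim: n f => [|n IH] f f0 //=; apply: integral_ge0 => x _; apply: IH => v; exact: f0.
Qed.

Lemma consv_affine n (L : 'M[R]_(1 + n)) (m : 'cV[R]_(1 + n)) t (w : 'cV[R]_n) :
  is_trig_mx L ->
  m + L *m consv (t, w) =
   consv (m 0 0 + L 0 0 * t, (dsubmx m + t *: dlsubmx L) + drsubmx L *m w).
Proof.
move=> Lt.
have Lur : ursubmx L = 0.
  apply/matrixP => i j; rewrite !mxE; move/is_trig_mxP: Lt; apply.
  by rewrite ord1.
rewrite /consv /= -[m in LHS]vsubmxK -[L in LHS]submxK Lur mul_block_col mul0mx addr0 add_col_mx.
congr col_mx.
  apply/matrixP => i j; rewrite !mxE big_ord1 !mxE !ord1 !mulr1n.
  by congr (m _ _ + L _ _ * _); apply/val_inj.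
by rewrite mul_mx_scalar addrA.
Qed.

(** The first coordinate of m + L g involves g_0 only. Once it is substituted, the remaining
    coordinates form an affine triangular map with the smaller factor [drsubmx L'] and a mean
    shifted by g_0 times the first column. *)
Lemma iint_affine n (L : 'M[R]_n) (m : 'cV[R]_n) (f : bvec n -> \bar R) :
  is_trig_mx L -> (forall i, L i i != 0) ->
  measurable_fun setT f -> (forall y, 0 <= f y)%E ->
  (iint f = (\prod_i `|L i i|)%:E * iint (fun g => f ((m + L *m g)%R : bvec n)))%E.
Proof.
elim: n L m f => [|n IH] L m f Lt Ld mf f0.
  by rewrite big_ord0 mul1e /= [m]flatmx0 add0r [L]flatmx0 mul0mx.
have mfc := meas_comp_consv mf.
pose L' : 'M[R]_(1 + n) := L; pose m' : 'cV[R]_(1 + n) := m.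
rewrite /=.
rewrite (@integral_affine (fun x => iint (fun v => f (consv (x, v)))) (m 0 0) (L 0 0))//; last 2 first.
- by apply: (iint_measurable mfc) => y; exact: f0.
- by move=> x; apply: iint_ge0.
rewrite big_ord_recl EFinM -muleA; congr (_ * _)%E.
have step t : iint (fun v => f (consv (m 0 0 + L 0 0 * t, v))) =
  ((\prod_(i < n) `|L (lift ord0 i) (lift ord0 i)|)%:E *
   iint (fun v => f (m + L *m consv (t, v))%R))%E.
  rewrite (IH (drsubmx L') (dsubmx m' + t *: dlsubmx L')).
  - congr (_ * _)%E.
    + congr (EFin _); apply: eq_bigr => i _; rewrite mxE mxE.
      by congr (`|L _ _|); apply/val_inj.
    + by congr iint; apply/funext => w; rewrite -(consv_affine m').
  - apply/is_trig_mxP => i j ij; rewrite !mxE; move/is_trig_mxP: Lt; apply.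
    by rewrite /= ltn_add2l.
  - move=> i; rewrite !mxE.
    rewrite (_ : rshift 1 i = lift ord0 i)//; exact/val_inj.
  - by apply: (meas_section _ mfc).
  - by [].
rewrite -ge0_integralZl//; last 3 first.
- have ma := continuous_measurable_map (@affine_continuous _ _ L m).
  apply: (@iint_measurable n (f \o (fun g : bvec n.+1 => m + L *m (g : 'cV[R]_n.+1) : bvec n.+1) \o @consv n)) => [|y]; last exact: f0.
  by apply: meas_comp_consv; apply: measurableT_comp.
- by move=> x _; apply: iint_ge0.
- by rewrite lee_fin prodr_ge0.
by apply: eq_integral => t _; rewrite step.
Qed.

(** The quadratic form becomes g' g because L' (L L')^-1 L = I, and the determinant contributes the
    reciprocal of the Jacobian of g -> mu + L g. *)
Lemma gauss_density_chol n (L : 'M[R]_n) (mu g : 'cV[R]_n) :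
  is_trig_mx L -> (forall i, L i i != 0) ->
  gauss_density mu (L *m L^T) (mu + L *m g) = (\prod_i `|L i i|)^-1 * psi (g : bvec n).
Proof.
move=> Lt Ld; rewrite /gauss_density.
have detL : \det L = \prod_i L i i by exact: det_trig.
have detL0 : \det L != 0 by rewrite detL prodf_seq_neq0; apply/allP => i _; exact: Ld.
have LU : L \in unitmx by rewrite unitmxE unitfE.
have SU : L *m L^T \in unitmx by rewrite unitmx_mul unitmx_tr LU.
have -> : mu + L *m g - mu = L *m g by rewrite addrC addrA addNr add0r.
have key : L^T *m invmx (L *m L^T) *m L = 1%:M.
  by apply: mulmx1C; rewrite mulmxA mulmxV.
rewrite trmx_mul -!mulmxA (mulmxA L^T) (mulmxA (L^T *m _)) key mul1mx.
have sq (x : R) k : 0 <= x -> Num.sqrt (x ^+ k) = Num.sqrt x ^+ k.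
  by move=> x0; elim: k => [|k IHk]; rewrite ?expr0 ?sqrtr1// !exprS sqrtrM// IHk.
have pi2 : 0 <= pi *+ 2 :> R by rewrite mulrn_wge0// pi_ge0.
rewrite det_mulmx det_tr detL -expr2 sqrtrM ?exprn_ge0// sqrtr_sqr sq// normr_prod invfM.
rewrite mulrC mulrA [RHS]mulrC; congr (_ * _).
rewrite /psi /=.
under [RHS]eq_bigr do rewrite normal_pdfE ?oner_neq0//.
rewrite big_split/= prodr_const card_ord mulrC -exprVn.
rewrite /normal_peak expr1n mul1r; congr (_ * _).
rewrite /normal_fun -expR_sum; congr expR.
rewrite mxE mulNr mulr_suml -sumrN; apply: eq_bigr => i _.
by rewrite subr0 expr1n !mxE mulNr expr2.
Qed.

Lemma gauss_prob_chol n (L : 'M[R]_n) (mu : 'cV[R]_n) (W : set 'cV[R]_n) :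
  is_trig_mx L -> (forall i, L i i != 0) -> measurable (W : set (bvec n)) ->
  gauss_prob mu (L *m L^T) W = Pn n [set g | W (mu + L *m (g : 'cV[R]_n))].
Proof.
move=> Lt Ld mW; rewrite /gauss_prob.
pose A : set (bvec n) := [set g | W (mu + L *m (g : 'cV[R]_n))].
have ma := continuous_measurable_map (@affine_continuous _ _ L mu).
have mA : measurable A by rewrite -[A]setTI; exact: ma.
have D0 : 0 < \prod_i `|L i i| by apply: prodr_gt0 => i _; rewrite normr_gt0.
have SL : forall y, gauss_density mu (L *m L^T) y >= 0.
  by move=> y; rewrite mulr_ge0 ?invr_ge0 ?sqrtr_ge0 ?expR_ge0.
rewrite (@iint_affine n L mu)//; last 2 first.
- apply/measurable_EFinP; apply: measurable_funM; first exact: measurable_indic.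
  have LU : L \in unitmx.
    by rewrite unitmxE unitfE det_trig// prodf_seq_neq0; apply/allP => i _; exact: Ld.
  (* Measurability of the density: it is a constant times the continuous [psi] after the affine map
     inverse to g -> mu + L g. *)
  rewrite (_ : gauss_density _ _ = (fun y : 'cV[R]_n => (\prod_i `|L i i|)^-1 *
     psi (- (invmx L *m mu) + invmx L *m y : bvec n))).
    apply: continuous_measurable_bvec => y.
    have cp : psi (- (invmx L *m mu) + invmx L *m z : bvec n) @[z --> y] --> psi (- (invmx L *m mu) + invmx L *m y : bvec n).
      exact: (cvg_comp _ _ (@affine_continuous _ _ (invmx L) (- (invmx L *m mu)) y) (@psi_continuous n _)).
    exact: (cvgM (cvg_cst _) cp).
  apply/funext => y; rewrite -(@gauss_density_chol n L mu)//; congr gauss_density.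
  by rewrite mulmxDr mulmxN !mulKVmx// addKr addrC || rewrite mulmxDr mulmxN !mulKVmx// addrA subrr add0r.
- by move=> y; rewrite lee_fin mulr_ge0.
transitivity ((\prod_i `|L i i|)%:E * \int[Pn n]_g ((\prod_i `|L i i|)^-1%:E * (\1_A g)%:E))%E.
  rewrite -iint_psi//.
  - congr (_ * _)%E; congr iint; apply/funext => g.
    rewrite gauss_density_chol// -!EFinM; congr EFin.
    by rewrite [RHS]mulrAC mulrC.
  - by apply: measurable_funeM; exact/measurable_EFinP/measurable_indic.
  - by move=> y; rewrite mule_ge0// lee_fin invr_ge0 ltW.
rewrite ge0_integralZl//; last 2 first.
- exact/measurable_EFinP/measurable_indic.
- by rewrite lee_fin invr_ge0 ltW.
by rewrite integral_indic// setIT muleA -EFinM divff ?mul1e// gt_eqF.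
Qed.

(* negative diagonal entries allowed: this yields the reflection symmetries of the Gaussian *)
Lemma Pn_sign n (L : 'M[R]_n) (W : set 'cV[R]_n) :
  is_trig_mx L -> (forall i, L i i != 0) -> L *m L^T = 1%:M -> measurable (W : set (bvec n)) ->
  Pn n [set g | W (L *m (g : 'cV[R]_n))] = Pn n W.
Proof.
move=> Lt Ld LL mW.
have := @gauss_prob_chol n L 0 W Lt Ld mW.
have := @gauss_prob_chol n 1%:M 0 W (scalar_mx_is_trig n 1) _ mW.
rewrite LL trmx1 mulmx1 => ->; last by move=> i; rewrite mxE eqxx oner_neq0.
move=> e; transitivity (Pn n [set g | W (0 + L *m (g : 'cV[R]_n))]).
  by congr (Pn n _); apply/seteqP; split => g /=; rewrite add0r.
by rewrite -e; congr (Pn n _); apply/seteqP; split => g /=; rewrite add0r mul1mx.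
Qed.

Lemma N01_ball_gt0 (x e : R) : 0 < e -> (0 < N01 (ball x e))%E.
Proof.
(* The value of the density at |x| + e, which bounds |y| on the ball. *)
move=> e0; pose c := normal_peak (1 : R) * expR (- (`|x| + e) ^+ 2 / (1 ^+ 2 *+ 2)).
have c0 : 0 < c by rewrite mulr_gt0 ?expR_gt0// normal_peak_gt0 ?oner_neq0.
have mb : measurable (ball x e : set R) by apply: open_measurable; exact: ball_open.
apply: (@lt_le_trans _ _ (\int[leb]_(y in ball x e) c%:E)%E).
  rewrite integral_cst//.
  have h : leb (ball x e) = (e *+ 2)%:E by apply: lebesgue_measure_ball; exact: ltW.
  suff : (0 < c%:E * leb (ball x e))%E by [].
  by rewrite h mule_gt0 ?lte_fin// pmulrn_lgt0.
rewrite /normal_prob; apply: ge0_le_integral => //=.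
- by move=> y _; rewrite lee_fin ltW.
- by apply/measurable_EFinP; apply: measurable_funTS; exact: measurable_normal_pdf.
- move=> y; rewrite /ball/= => xy; rewrite lee_fin normal_pdfE ?oner_neq0//.
  rewrite ler_pM2l ?normal_peak_gt0 ?oner_neq0// ler_expR !mulNr lerN2 ler_pM2r; last first.
    by rewrite invr_gt0 expr1n.
  rewrite subr0 -[y ^+ 2]real_normK ?num_real// ler_pXn2r ?nnegrE ?addr_ge0 ?(ltW e0)//; apply: ltW.
  have := ler_normB x (x - y); rewrite opprB addrC subrK => /le_lt_trans; apply.
  by rewrite ltrD2l.
Qed.

Lemma PnSE n (A : set (bvec n.+1)) :
  Pn n.+1 A = product_measure1 N01 (Pn n) (@consv n @^-1` A).
Proof. by []. Qed.

Lemma consv_vsub n (y : 'cV[R]_n.+1) : consv (y 0 0, dsubmx (y : 'cV[R]_(1 + n))) = y.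
Proof.
apply/matrixP => i j; rewrite ord1; case: (unliftP ord0 i) => [k ->|->].
  by rewrite consvS mxE; congr (y _ _); apply/val_inj.
by rewrite consv0.
Qed.

Lemma Pn_open_gt0 n (U : set 'cV[R]_n) : open U -> U !=set0 -> (0 < Pn n U)%E.
Proof.
elim: n U => [|n IH] U oU [y Uy].
  rewrite /= diracE (_ : _ \in U) ?lte_fin//.
  by rewrite inE; rewrite [y]flatmx0 in Uy.
rewrite PnSE.
have /nbhs_ballP[e /= e0 yeU] : nbhs y U by exact: open_nbhs_nbhs.
pose B1 : set R := ball (y 0 0) e.
pose B2 : set 'cV[R]_n := ball (dsubmx (y : 'cV[R]_(1 + n))) e.
have oB2 : open B2 by exact: ball_open.
have mB1 : measurable B1 by apply: open_measurable; exact: ball_open.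
have mB2 : measurable (B2 : set (bvec n)) by exact: open_meas.
apply: (@lt_le_trans _ _ (product_measure1 N01 (Pn n) (B1 `*` (B2 : set (bvec n))))).
  rewrite product_measure1E// mule_gt0// ?N01_ball_gt0//.
  by apply: IH => //; exists (dsubmx (y : 'cV[R]_(1 + n))); exact: ballxx.
apply: le_measure; rewrite ?inE.
- exact: measurableX.
- by rewrite -[X in measurable X]setTI; apply: measurable_consv => //; exact: open_meas.
- move=> xv h; apply: yeU; exact/(@ball_consv n (y : 'cV[R]_(1 + n)) e xv e0).
Qed.

(** A substitute for multivariate polynomials: being polynomial along every line passes to slices
    and is closed under sums and products, and it is all that [Pn_null] consumes. *)
Definition linepoly n (f : 'cV[R]_n -> R) :=
  forall a b, exists p : {poly R}, forall t, f (a + t *: b) = p.[t].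

Lemma finite_roots (p : {poly R}) : p != 0 -> finite_set [set x | root p x].
Proof.
move=> p0; apply: contrapT => /(infinite_set_fset (size p))[B BS sB].
have := @max_poly_roots _ p (finmap.enum_fset B) p0 _ (finmap.fset_uniq B).
rewrite ltnNge sB => h; suff : false by []; apply: h.
by apply/allP => x xB; exact: (BS x xB).
Qed.

Lemma N01_finite (S : set R) : finite_set S -> measurable S /\ N01 S = 0%E.
Proof.
move=> fS; have mS : measurable S.
  by apply: countable_measurable; [exact: measurable_set1|exact: finite_set_countable].
split=> //; have /null_content_dominatesP := @normal_prob_dominates R 0 1; apply => //.
by apply: countable_lebesgue_measure0; exact: finite_set_countable.
Qed.

Lemma measurable_zeros n (f : 'cV[R]_n -> R) : continuous f ->
  measurable ([set y | f y = 0] : set (bvec n)).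
Proof.
move=> cf; rewrite -[X in measurable X]setTI.
exact: (continuous_measurable_bvec cf measurableT (measurable_set1 0)).
Qed.

Lemma consv_line n (x z : R) (a b : 'cV[R]_n) t :
  consv (x + t * z, a + t *: b) = (consv (x, a) : 'cV[R]_n.+1) + t *: (consv (z, b) : 'cV[R]_n.+1).
Proof.
have E (A B : 'cV[R]_n.+1) l : (A + t *: B) l 0 = A l 0 + t * B l 0 by rewrite !mxE.
apply/matrixP => i j; rewrite ord1; case: (unliftP ord0 i) => [k ->|->].
  by rewrite E (@consvS n x a k) (@consvS n z b k) (@consvS n (x + t * z) (a + t *: b) k) !mxE.
by rewrite E (@consv0 n x a) (@consv0 n z b) (@consv0 n (x + t * z) (a + t *: b)).
Qed.

(** Induction with Tonelli. For a first coordinate x outside a finite set, the slice of f at x is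
    nonzero at a fixed tail, so its zero set is null by induction; at the finitely many exceptional
    x the section has measure at most 1, and those x are null. *)
Lemma Pn_null n (f : 'cV[R]_n -> R) : continuous f -> linepoly f ->
  (exists y, f y != 0) -> Pn n [set y | f y = 0] = 0%E.
Proof.
elim: n f => [|n IH] f cf lf [y fy].
  rewrite /= diracE (_ : _ \in _ = false)//.
  by apply/negP; rewrite inE/= => f0; rewrite [y]flatmx0 f0 eqxx in fy.
rewrite PnSE /product_measure1.
set B := _ @^-1` _.
have mB : measurable B.
  by rewrite /B -[X in measurable X]setTI; apply: measurable_consv => //; exact: measurable_zeros.
pose v0 : 'cV[R]_n := dsubmx (y : 'cV[R]_(1 + n)).
(* The line in the first coordinate through the tail of y; p is nonzero since f y is one of its
   values. *)
have [p hp] := lf (consv (0, v0)) (consv (1, 0)).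
have pE x : f (consv (x, v0)) = p.[x].
  by rewrite -hp -consv_line scaler0 addr0 add0r mulr1.
have p0 : p != 0.
  apply: contraNneq fy => p0; have := pE (y 0 0); rewrite consv_vsub => ->.
  by rewrite p0 horner0.
have [mS N0] := N01_finite (finite_roots p0).
apply/eqP; rewrite eq_le; apply/andP; split; last by apply: integral_ge0.
rewrite -N0 -[X in N01 X]setIT -integral_indic//.
apply: ge0_le_integral => //.
- exact: measurable_fun_xsection.
- by apply/measurable_EFinP; exact: measurable_indic.
move=> x _ /=; rewrite indicE; case: (boolP (x \in _)) => [_|xS].
  apply: probability_le1; exact: measurable_xsection.
have {}xS : p.[x] != 0 by move: xS; rewrite notin_setE /= => /negP; rewrite rootE.
rewrite (_ : xsection B x = [set v | f (consv (x, v)) = 0]); last first.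
  by apply/seteqP; split => v; rewrite /xsection /= inE.
rewrite (IH (fun v => f (consv (x, v)))) ?lexx//.
- move=> v; apply: (@cvg_comp _ _ _ (fun v : 'cV[R]_n => consv (x, v) : 'cV[R]_n.+1) f) (cf _).
  apply: (@cvg_mx _ (nbhs v)) => i j; rewrite ord1; case: (unliftP ord0 i) => [k ->|->].
    by under eq_fun do rewrite consvS; rewrite consvS; exact: coord_continuous.
  by under eq_fun do rewrite consv0; rewrite consv0; exact: cvg_cst.
- move=> a b; have [q hq] := lf (consv (x, a)) (consv (0, b)).
  by exists q => t; rewrite -hq -consv_line mulr0 addr0.
- by exists v0; rewrite pE.
Qed.

(** Fatou for events: A is the increasing union of its parts lying in every E j with j >= N, and
    each such part is contained in E N. *)
Lemma le_measure_eventually d (T : measurableType d) (P : {measure set T -> \bar R}) (E : nat -> set T) (A : set T) (s : \bar R) :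
  (forall j, measurable (E j)) -> measurable A ->
  (forall g, A g -> \forall j \near \oo, E j g) ->
  (forall j, P (E j) <= s)%E -> (P A <= s)%E.
Proof.
move=> mE mA AE Es.
pose F N := A `&` \bigcap_(j in [set j | (N <= j)%N]) E j.
have mF N : measurable (F N) by apply: measurableI => //; apply: bigcap_measurable => //; exists N => /=.
have FA : \bigcup_N F N = A.
  apply/seteqP; split=> [g [N _ []]//|g Ag].
  by have [N _ h] := AE g Ag; exists N => //; split => // j /= Nj; exact: h.
have ndF : nondecreasing_seq F.
  move=> i j ij; apply/subsetPset => g [Ag h]; split=> // m /= jm; apply: h => /=.
  exact: leq_trans jm.
have := @nondecreasing_cvg_mu _ _ _ P F mF; rewrite FA => /(_ mA ndF) cF.
rewrite -(cvg_lim _ cF)//; apply: lime_le; first by apply/cvg_ex; eexists; exact: cF.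
near=> N; apply: le_trans (Es N); apply: le_measure; rewrite ?inE//.
by move=> g [_]; apply => /=.
Unshelve. all: by end_near. Qed.

(** L preserves [Pn] and exchanges the events f > 0 and f < 0; together they have probability 1. *)
Lemma Pn_half n (L : 'M[R]_n) (f : 'cV[R]_n -> R) :
  is_trig_mx L -> (forall i, L i i != 0) -> L *m L^T = 1%:M ->
  continuous f -> (forall g, f (L *m g) = - f g) -> Pn n [set g | f g = 0] = 0%E ->
  Pn n [set g | 0 < f g] = (1 / 2)%:E.
Proof.
move=> Lt Ld LL cf fL f0.
have mf := continuous_measurable_bvec cf.
have mp : measurable ([set g | 0 < f g] : set (bvec n)).
  rewrite -[X in measurable X]setTI (_ : [set g | _] = f @^-1` `]0, +oo[%classic).
    by apply: mf => //.
  by apply/seteqP; split => g /=; rewrite in_itv/= andbT.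
have mn : measurable ([set g | f g < 0] : set (bvec n)).
  rewrite -[X in measurable X]setTI (_ : [set g | _] = f @^-1` `]-oo, 0[%classic).
    by apply: mf => //.
  by apply/seteqP; split => g /=; rewrite in_itv/=.
have e1 : Pn n [set g | f g < 0] = Pn n [set g | 0 < f g].
  rewrite -(Pn_sign Lt Ld LL mp); congr (Pn n _); apply/seteqP; split=> g /=.
    by rewrite fL oppr_gt0.
  by rewrite fL oppr_gt0.
have e2 : Pn n [set: bvec n] = (Pn n [set g | (f g < 0)%R] + Pn n [set g | (0 < f g)%R] + Pn n [set g | f g = 0%R])%E.
  rewrite -!measureU//=.
  - congr (Pn n _); apply/seteqP; split=> // g _ /=; have := ltgtP (f g) 0.
    by case; [left; left|left; right|right].
  - exact: measurableU.
  - exact: measurable_zeros.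
  - by apply/seteqP; split=> // g /= [[h1|h1] h2]; rewrite h2 ltxx in h1.
  - by apply/seteqP; split=> // g /= [h1 h2]; move: (lt_trans h1 h2); rewrite ltxx.
move: e2; rewrite probability_setT f0 adde0 e1.
have := fin_num_measure (Pn n) _ mp; move/fineK => <-.
rewrite -EFinD => -[] h; congr EFin; lra.
Qed.
End Measure.

(** * Cholesky factors and the AR(1) model *)

Section Alg.
Variable R : realType.

Lemma posdef_scale n (S : 'M[R]_n) s : 0 < s -> posdef S -> posdef (s *: S).
Proof.
move=> s0 pS v v0; rewrite -scalemxAr -scalemxAl mxE mulr_gt0//; exact: pS.
Qed.

Lemma posdef1 n : posdef (1%:M : 'M[R]_n).
Proof.
move=> v v0; rewrite mulmx1 mxE.
have h i : 0 <= v^T 0 i * v i 0 by rewrite mxE -expr2 sqr_ge0.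
rewrite lt_neqAle sumr_ge0 ?andbT//; apply: contra v0 => /eqP/esym s0.
apply/eqP/matrixP => i j; rewrite ord1 mxE.
move/psumr_eq0P: s0 => /(_ (fun i _ => h i)) s0; have := s0 i isT.
by rewrite mxE -expr2 => /eqP; rewrite sqrf_eq0 => /eqP.
Qed.

(** Elimination with the pivot a: the factor of the Schur complement [D'] is bordered by the column
    (sqrt a, b / sqrt a). *)
Lemma cholesky n (S : 'M[R]_n) : S^T = S -> posdef S ->
  exists L : 'M[R]_n, [/\ is_trig_mx L, forall i, L i i != 0 & S = L *m L^T].
Proof.
elim: n S => [|n IH] S sS pS.
  exists 0; split; [by apply/is_trig_mxP => -[]|by case|by rewrite [S]flatmx0 mul0mx].
pose S' : 'M[R]_(1 + n) := S.
pose a := S 0 0; pose b := dlsubmx S'; pose D := drsubmx S'.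
have SE : S' = block_mx (a%:M) b^T b D.
  rewrite -[LHS]submxK; congr block_mx.
    apply/matrixP => i j; rewrite !ord1 !mxE mulr1n; congr (S _ _); exact/val_inj.
  rewrite /b trmx_dlsub; congr (ursubmx _); exact/esym.
have a0 : 0 < a.
  have := pS (delta_mx 0 0); rewrite -colE trmx_delta -rowE !mxE; apply.
  by apply/eqP => /matrixP/(_ 0 0)/eqP; rewrite !mxE !eqxx oner_eq0.
pose D' := D - a^-1 *: (b *m b^T).
have [L' [Lt Ld LE]] : exists L : 'M[R]_n, [/\ is_trig_mx L, forall i, L i i != 0 & D' = L *m L^T].
  apply: IH.
    rewrite /D' linearB /= linearZ /= trmx_mul trmxK; congr (_ - _).
    by rewrite /D trmx_drsub; congr (drsubmx _).
  (* This x minimizes the quadratic form of S over the first coordinate, and the minimum is the form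
     of [D'] at v. *)
  move=> v v0; pose x : 'M[R]_1 := - a^-1 *: (b^T *m v).
  have := pS (col_mx x v : 'cV[R]_(1 + n)).
  have -> : ((col_mx x v)^T *m S' *m col_mx x v) = v^T *m D' *m v.
    rewrite -mulmxA SE mul_block_col tr_col_mx mul_row_col.
    rewrite mul_scalar_mx /x !scalerA mulrN divff ?gt_eqF// scaleN1r addNr mulmx0 add0r.
    rewrite -mulmxA; congr (_ *m _).
    by rewrite /D' mulmxBl addrC -scalemxAr scaleNr -scalemxAl mulmxA.
  apply; apply: contra v0 => /eqP h; rewrite -[v](col_mxKd x) h; apply/eqP/matrixP => i j.
  by rewrite !mxE.
pose L : 'M[R]_(1 + n) := block_mx (Num.sqrt a)%:M 0 ((Num.sqrt a)^-1 *: b) L'.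
have sa : Num.sqrt a != 0 by rewrite sqrtr_eq0 -ltNge.
exists L; split.
- rewrite /L (@is_trig_block_mx _ 1 n 1 n)// eqxx Lt andbT/=.
  by apply/is_trig_mxP => i j; rewrite !ord1.
- move=> i; case: (unliftP ord0 i) => [j ->|->].
    have -> : lift ord0 j = rshift 1 (j : 'I_n) by exact/val_inj.
    have -> : L (rshift 1 j) (rshift 1 j) = L' j j by exact: block_mxEdr.
    exact: Ld.
  have -> : ord0 = lshift n (0 : 'I_1) by exact/val_inj.
  have -> : L (lshift n 0) (lshift n 0) = (Num.sqrt a)%:M 0 (0 : 'I_1) by exact: block_mxEul.
  by rewrite mxE mulr1n.
- suff : S' = L *m L^T by [].
  rewrite SE /L (@tr_block_mx _ 1 n 1 n) mulmx_block trmx0 !mulmx0 !mul0mx !addr0 tr_scalar_mx.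
  congr block_mx.
  + by rewrite -scalar_mxM -expr2 sqr_sqrtr// ltW.
  + by rewrite linearZ/= -scalemxAr mul_scalar_mx scalerA mulVf// scale1r.
  + by rewrite mul_mx_scalar scalerA divff// scale1r.
  + rewrite linearZ/= -scalemxAl -scalemxAr scalerA -expr2 exprVn sqr_sqrtr ?(ltW a0)//.
    by rewrite -LE /D' addrC subrK.
Qed.

Lemma gauss_prob_ge0 n (mu : 'cV[R]_n) S W : (0 <= gauss_prob mu S W)%E.
Proof.
by apply: iint_ge0 => y; rewrite lee_fin mulr_ge0 // mulr_ge0 ?invr_ge0 ?sqrtr_ge0 ?expR_ge0.
Qed.

(** The covariance model may contain matrices outside AR(1), so the bound goes through the Cholesky
    factor of an arbitrary S. *)
Lemma gauss_prob_le1 n (mu : 'cV[R]_n) S W : S^T = S -> posdef S ->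
  measurable (W : set (bvec R n)) -> (gauss_prob mu S W <= 1)%E.
Proof.
move=> sS pS mW; have [L [Lt Ld ->]] := cholesky sS pS.
rewrite gauss_prob_chol//; apply: probability_le1.
rewrite -[X in measurable X]setTI.
exact: (continuous_measurable_map (@affine_continuous _ _ _ L mu)).
Qed.

(* Cholesky factor of the AR(1) correlation matrix when eps^2 = 1 - rho^2. *)
Definition ar_coef (rho eps : R) (i j : nat) : R :=
  if j == 0%N then rho ^+ i else if (j <= i)%N then eps * rho ^+ (i - j) else 0.

Lemma ar_coefS (rho eps : R) i j d : (j <= i)%N ->
  ar_coef rho eps (i + d) j = rho ^+ d * ar_coef rho eps i j.
Proof.
rewrite /ar_coef => ji; case: eqP => _; first by rewrite exprD mulrC.
rewrite ji (leq_trans ji (leq_addr _ _)) -addnBAC// exprD; ring.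
Qed.

(** Stationarity: the next row is rho times the present one followed by eps, so its square sum is
    rho^2 + eps^2. *)
Lemma ar_coef_sum (rho eps : R) i : eps ^+ 2 = 1 - rho ^+ 2 ->
  \sum_(0 <= j < i.+1) ar_coef rho eps i j ^+ 2 = 1.
Proof.
move=> e2; elim: i => [|i IH].
  by rewrite big_nat1 /ar_coef eqxx expr0 expr1n.
rewrite big_nat_recr//= [in X in _ + X]/ar_coef /= leqnn subnn expr0 mulr1.
rewrite (eq_big_nat _ _ (F2 := fun j => rho ^+ 2 * ar_coef rho eps i j ^+ 2)); last first.
  by move=> j /andP[_ ji]; rewrite -addn1 ar_coefS// expr1 exprMn.
by rewrite -big_distrr/= IH mulr1 e2 addrC subrK.
Qed.

(** Columns beyond i do not contribute, and on the others row i + d is rho^d times row i, which has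
    unit norm. *)
Lemma ar_coef_corr (rho eps : R) i d N : eps ^+ 2 = 1 - rho ^+ 2 -> (i < N)%N ->
  \sum_(0 <= j < N) ar_coef rho eps i j * ar_coef rho eps (i + d) j = rho ^+ d.
Proof.
move=> e2 iN; rewrite (big_cat_nat _ (n := i.+1))//=.
rewrite [X in _ + X]big_nat_cond [X in _ + X]big1 ?addr0; last first.
  move=> j /andP[/andP[ij _] _]; rewrite /ar_coef.
  by rewrite (gtn_eqF (leq_ltn_trans _ ij))// leqNgt ij mul0r.
rewrite (eq_big_nat _ _ (F2 := fun j => rho ^+ d * ar_coef rho eps i j ^+ 2)).
  by rewrite -big_distrr/= ar_coef_sum ?mulr1.
by move=> j /andP[_ ji]; rewrite ar_coefS//; ring.
Qed.

Definition ar_chol n (rho eps : R) : 'M[R]_n := \matrix_(i, j) ar_coef rho eps i j.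

Lemma ar_chol_trig n (rho eps : R) : is_trig_mx (ar_chol n rho eps).
Proof.
apply/is_trig_mxP => i j ij; rewrite mxE /ar_coef.
by rewrite (gtn_eqF (leq_ltn_trans _ ij))// leqNgt ij.
Qed.

Lemma ar_chol_diag n (rho eps : R) i : eps != 0 -> ar_chol n rho eps i i != 0.
Proof.
move=> e0; rewrite mxE /ar_coef; have [->|h] := eqVneq (i : nat) 0%N; first by rewrite expr0 oner_eq0.
by rewrite leqnn subnn expr0 mulr1.
Qed.

Lemma ar_chol_mul n (rho eps : R) : eps ^+ 2 = 1 - rho ^+ 2 ->
  ar_chol n rho eps *m (ar_chol n rho eps)^T = Lambda rho.
Proof.
move=> e2; apply/matrixP => i l; rewrite !mxE.
under eq_bigr do rewrite !mxE.
rewrite -(big_mkord predT (fun j => ar_coef rho eps i j * ar_coef rho eps l j)).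
have [il|/ltnW li] := leqP i l.
  have := @ar_coef_corr rho eps i (l - i) n e2 (ltn_ord i).
  rewrite subnKC// => ->; congr (_ ^+ _); lia.
under eq_bigr do rewrite mulrC.
have := @ar_coef_corr rho eps l (i - l) n e2 (ltn_ord l).
rewrite subnKC// => ->; congr (_ ^+ _); lia.
Qed.

Lemma gauss_prob_ar n (mu : 'cV[R]_n) (s2 rho eps : R) W : 0 < s2 -> eps != 0 ->
  eps ^+ 2 = 1 - rho ^+ 2 -> measurable (W : set (bvec R n)) ->
  gauss_prob mu (s2 *: Lambda rho) W =
  Pn R n [set g | W (mu + Num.sqrt s2 *: (ar_chol n rho eps *m (g : 'cV[R]_n)))].
Proof.
move=> s20 e0 e2 mW.
have s0 : Num.sqrt s2 != 0 by rewrite sqrtr_eq0 -ltNge.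
pose L := Num.sqrt s2 *: ar_chol n rho eps.
have -> : s2 *: Lambda rho = L *m L^T.
  rewrite /L linearZ/= -scalemxAl -scalemxAr scalerA -expr2 sqr_sqrtr ?ltW//.
  by rewrite ar_chol_mul.
rewrite gauss_prob_chol//.
- by congr (Pn _ _ _); apply/seteqP; split=> g /=; rewrite /L -scalemxAl.
- apply/is_trig_mxP => i j ij; rewrite mxE.
  by move/is_trig_mxP: (ar_chol_trig n rho eps) => -> //; rewrite mulr0.
- by move=> i; rewrite mxE mulf_neq0// ar_chol_diag.
Qed.

Lemma cvg_exprn T (F : set_system T) (FF : Filter F) (f : T -> R) (l : R) i :
  f x @[x --> F] --> l -> (f x ^+ i) @[x --> F] --> l ^+ i.
Proof.
move=> fl; elim: i => [|i IH]; first by under eq_fun do rewrite expr0; exact: cvg_cst.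
by under eq_fun do rewrite exprS; rewrite exprS; exact: cvgM.
Qed.

(** * First-order expansion of the AR(1) factor as rho tends to s *)

Section ARlimit.
Variable s : R.
Hypothesis s1 : s ^+ 2 = 1.

(* Rational parametrization of rho^2 + eps^2 = 1: rho tends to s, and eps tends to 0 without vanishing. *)
Definition ar_t (j : nat) : R := j.+1%:R^-1.
Definition ar_rho j : R := s * ((1 - ar_t j ^+ 2) / (1 + ar_t j ^+ 2)).
Definition ar_eps j : R := 2 * ar_t j / (1 + ar_t j ^+ 2).

Lemma ar_t_gt0 j : 0 < ar_t j. Proof. by rewrite invr_gt0 ltr0n. Qed.

Lemma ar_den_neq0 j : 1 + ar_t j ^+ 2 != 0.
Proof. by rewrite gt_eqF// ltr_pwDl// sqr_ge0. Qed.

Lemma ar_eps_neq0 j : ar_eps j != 0.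
Proof.
by rewrite !mulf_neq0// ?invr_eq0 ?ar_den_neq0 ?pnatr_eq0// gt_eqF// ar_t_gt0.
Qed.

Lemma ar_eps2 j : ar_eps j ^+ 2 = 1 - ar_rho j ^+ 2.
Proof.
rewrite /ar_eps /ar_rho [in RHS]exprMn s1 mul1r; have := ar_den_neq0 j; move: (ar_t j) => t d0.
by field.
Qed.

Lemma ar_rho_lt1 j : -1 < ar_rho j < 1.
Proof.
rewrite -ltr_norml -(@ltr_pXn2r _ 2)// ?nnegrE// expr1n real_normK ?num_real//.
have : 0 < ar_eps j ^+ 2 by rewrite exprn_even_gt0//= ar_eps_neq0.
by rewrite ar_eps2 subr_gt0.
Qed.

Lemma ar_t_cvg : ar_t j @[j --> \oo] --> (0 : R).
Proof. exact: cvg_harmonic. Qed.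

Lemma ar_den_cvg : (1 + ar_t j ^+ 2) @[j --> \oo] --> (1 : R).
Proof.
have h : (1 + ar_t j * ar_t j) @[j --> \oo] --> (1 + 0 * 0 : R).
  by apply: cvgD; [exact: cvg_cst|exact: (cvgM ar_t_cvg ar_t_cvg)].
by rewrite mulr0 addr0 in h.
Qed.

Lemma ar_eps_cvg : ar_eps j @[j --> \oo] --> (0 : R).
Proof.
have h : (2 * ar_t j / (1 + ar_t j ^+ 2)) @[j --> \oo] --> (2 * 0 / 1 : R).
  apply: cvgM; first by apply: cvgM; [exact: cvg_cst|exact: ar_t_cvg].
  by apply: cvgV; [exact: oner_neq0|exact: ar_den_cvg].
by rewrite mulr0 mul0r in h.
Qed.

Lemma ar_rho_cvg : ar_rho j @[j --> \oo] --> s.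
Proof.
have h : (s * ((1 - ar_t j * ar_t j) / (1 + ar_t j ^+ 2))) @[j --> \oo] --> (s * ((1 - 0 * 0) / 1) : R).
  apply: cvgM; first exact: cvg_cst.
  apply: cvgM; last by apply: cvgV; [exact: oner_neq0|exact: ar_den_cvg].
  by apply: cvgB; [exact: cvg_cst|exact: (cvgM ar_t_cvg ar_t_cvg)].
by rewrite mulr0 subr0 divr1 mulr1 in h.
Qed.

Definition pow_vec n : 'cV[R]_n := \col_i s ^+ i.
(* Limit of [ar_rem]; its first column is 0 because [rho - s] is of order [eps^2]. *)
Definition ar_lim n : 'M[R]_n :=
  \matrix_(i, j) (if j == 0%N :> nat then 0 else if (j <= i)%N then s ^+ (i - j) else 0).
Definition ar_rem n (j : nat) : 'M[R]_n :=
  \matrix_(i, l) (if l == 0%N :> nat then (ar_rho j ^+ i - s ^+ i) / ar_eps j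
                  else if (l <= i)%N then ar_rho j ^+ (i - l) else 0).

Lemma ar_chol_rem n j (g : 'cV[R]_n.+1) :
  ar_chol n.+1 (ar_rho j) (ar_eps j) *m g = g 0 0 *: pow_vec n.+1 + ar_eps j *: (ar_rem n.+1 j *m g).
Proof.
apply/matrixP => i l; rewrite ord1 !mxE.
rewrite !big_ord_recl !mxE/=.
rewrite [in RHS]mulrDr [in RHS]mulr_sumr.
have e0 := ar_eps_neq0 j.
rewrite /ar_coef eqxx addrA; congr (_ + _); first by field.
apply: eq_bigr => a _; rewrite !mxE /ar_coef /=.
by case: ifP => _; rewrite ?mul0r ?mulr0// mulrA.
Qed.

Lemma ar_rem_cvg n : ar_rem n j @[j --> \oo] --> ar_lim n.
Proof.
apply: cvg_mx => i l; rewrite mxE; under eq_fun do rewrite mxE.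
case: ifP => _; last first.
  have h := @cvg_exprn _ _ _ _ _ (i - l)%N ar_rho_cvg.
  by case: ifP => _; [exact: h|exact: cvg_cst].
under eq_fun do rewrite subrXX.
(* In the rational parametrization (rho - s) / eps = - s t, so the first column tends to 0. *)
have E j : (ar_rho j - s) * (\sum_(a < i) ar_rho j ^+ (i.-1 - a) * s ^+ a) / ar_eps j =
   - s * ar_t j * (\sum_(a < i) ar_rho j ^+ (i.-1 - a) * s ^+ a).
  rewrite mulrAC; congr (_ * _); rewrite /ar_rho /ar_eps.
  have := ar_den_neq0 j; have : ar_t j != 0 by rewrite gt_eqF// ar_t_gt0.
  move: (ar_t j) => t t0 d0; field; by rewrite t0 d0.
under eq_fun do rewrite E.
have h : (- s * ar_t j * (\sum_(a < i) ar_rho j ^+ (i.-1 - a) * s ^+ a)) @[j --> \oo] -->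
   (- s * 0 * (\sum_(a < i) s ^+ (i.-1 - a) * s ^+ a) : R).
  apply: cvgM; first by apply: cvgM; [exact: cvg_cst|exact: ar_t_cvg].
  apply: cvg_sumr => a; apply: cvgM; last exact: cvg_cst.
  exact: (@cvg_exprn _ _ _ _ _ (i.-1 - a)%N ar_rho_cvg).
by rewrite mulr0 mul0r in h.
Qed.

(** The preimage is g_i = y_i - s y_(i-1). The coordinate g_0 meets the zero column and is free; the
    value 1 keeps it nonzero for the polynomials that carry the factor g_0. *)
Lemma ar_lim_surj n (y : 'cV[R]_n.+1) : y 0 0 = 0 ->
  exists2 g : 'cV[R]_n.+1, g 0 0 = 1 & ar_lim n.+1 *m g = y.
Proof.
move=> y0; pose yn i : R := if (i : nat) is i'.+1 then (if insub i is Some k then y k 0 else 0) else 0.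
pose gf i := if (i : nat) is i'.+1 then yn i - s * yn i' else 1.
exists (\col_i gf i); first by rewrite mxE.
have key i : \sum_(1 <= j < i.+1) s ^+ (i - j) * gf j = yn i.
  elim: i => [|i IH]; first by rewrite big_geq.
  rewrite big_nat_recr//= subnn expr0 mul1r.
  rewrite (eq_big_nat _ _ (F2 := fun j => s * (s ^+ (i - j) * gf j))); last first.
    by move=> j /andP[_ ji]; rewrite subSn// exprS mulrA.
  by rewrite -big_distrr/= IH addrC subrK.
apply/matrixP => i j; rewrite ord1 !mxE.
have -> : y i 0 = yn i.
  case: (unliftP ord0 i) => [k ->|->] //=.
  by rewrite (_ : insub _ = Some (lift ord0 k)) //; exact: (valK (lift ord0 k)).
rewrite -key.
under eq_bigr do rewrite !mxE.
rewrite -(big_mkord predT (fun j => (if j == 0%N then 0 else if (j <= i)%N then s ^+ (i - j) else 0) * gf j)).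
rewrite big_ltn//= mul0r add0r.
rewrite (big_cat_nat _ (n := i.+1))//= [X in _ + X]big_nat_cond [X in _ + X]big1 ?addr0; last first.
  move=> a /andP[/andP[ia _] _]; rewrite leqNgt ia/=; case: eqP; by rewrite mul0r.
apply: eq_big_nat => a /andP[a1 ai].
by rewrite (gtn_eqF a1) -ltnS ai.
Qed.

End ARlimit.
End Alg.

(** * The covariance estimator *)

Section Omega.
Variable R : realType.

(** Whether indices are out of range does not depend on the matrix, so every property of [getm]
    reduces to that of an entry or of the constant 0. *)
Lemma getmP m n (i j : nat) :
  (exists i' : 'I_m, exists j' : 'I_n, forall A : 'M[R]_(m, n), getm A i j = A i' j') \/
  (forall A : 'M[R]_(m, n), getm A i j = 0).
Proof.
rewrite /getm; case: insubP => [i' _ _|_]; last by right.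
by case: insubP => [j' _ _|_]; [left; exists i', j'|right].
Qed.

Lemma getmE m n (A : 'M[R]_(m, n)) (i : 'I_m) (j : 'I_n) : getm A i j = A i j.
Proof. by rewrite /getm (valK i) (valK j). Qed.

Lemma getmZ m n (a : R) (A : 'M[R]_(m, n)) i j : getm (a *: A) i j = a * getm A i j.
Proof.
have [[i' [j' h]]|h] := @getmP m n i j; rewrite !h ?mulr0//.
by rewrite mxE.
Qed.

Lemma unitmx_ker0 n (A : 'M[R]_n) : (forall v : 'rV_n, v *m A = 0 -> v = 0) -> A \in unitmx.
Proof.
move=> h; rewrite -row_free_unit -kermx_eq0; apply/eqP/row_matrixP => i.
by rewrite row0; apply: h; rewrite -row_mul mulmx_ker row0.
Qed.

Lemma row_free_ker0 m n (A : 'M[R]_(m, n)) : (forall v : 'rV_m, v *m A = 0 -> v = 0) -> row_free A.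
Proof.
move=> h; rewrite -kermx_eq0; apply/eqP/row_matrixP => i.
by rewrite row0; apply: h; rewrite -row_mul mulmx_ker row0.
Qed.

Lemma posdef_sandwich m n (K : 'M[R]_n) (N : 'M[R]_(m, n)) : posdef K ->
  (N *m K *m N^T \in unitmx) = row_free N.
Proof.
move=> pK; apply/idP/idP => [u|fN].
  apply: row_free_ker0 => v vN.
  have : v *m (N *m K *m N^T) = 0 by rewrite !mulmxA vN !mul0mx.
  by move/(congr1 (mulmx^~ (invmx (N *m K *m N^T)))); rewrite mulmxK// mul0mx.
apply: unitmx_ker0 => v h.
have : v *m N *m K *m (v *m N)^T = 0.
  by rewrite trmx_mul mulmxA -(mulmxA v N K) -(mulmxA v (N *m K)) h mul0mx.
have [vN0 _|vN0 e] := eqVneq (v *m N)^T 0.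
  by apply: (row_free_inj fN); rewrite mul0mx -[LHS]trmxK vN0 trmx0.
have := pK _ vN0; rewrite trmxK e mxE ltxx; by [].
Qed.

Lemma posdef_sandwich_pos m n (K : 'M[R]_n) (N : 'M[R]_(m, n)) : posdef K -> row_free N ->
  posdef (N *m K *m N^T).
Proof.
move=> pK fN v v0; have := pK (N^T *m v); rewrite trmx_mul trmxK !mulmxA; apply.
apply: contra v0 => /eqP h; apply/eqP.
have : v^T *m N = 0 by rewrite -[LHS]trmxK trmx_mul trmxK h trmx0.
rewrite -[RHS](mul0mx _ N) => /(row_free_inj fN) h'.
by rewrite -[v]trmxK h' trmx0.
Qed.

Lemma posdef_unit n (A : 'M[R]_n) : posdef A -> A \in unitmx.
Proof.
move=> pA; apply: unitmx_ker0 => v vA.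
have [//|v0] := eqVneq v 0.
have vT0 : v^T != 0 by apply: contra v0 => /eqP h; rewrite -[v]trmxK h trmx0.
by have := pA _ vT0; rewrite trmxK vA mul0mx mxE ltxx.
Qed.

Lemma posdef_inv n (A : 'M[R]_n) : A^T = A -> posdef A -> posdef (invmx A).
Proof.
move=> sA pA v v0; have uA := posdef_unit pA.
have := pA (invmx A *m v); rewrite trmx_mul trmx_inv sA !mulmxA mulmxKV//; apply.
by apply: contra v0 => /eqP h; rewrite -[v](mulKVmx uA) h mulmx0.
Qed.

Section Estimator.
Variables (k n p q : nat).
Variable (kappa : R -> R).

Definition lag0 (V : 'M[R]_(k, n)) : 'M[R]_(k, n - p) := \matrix_(i < k, j < n - p) getm V i (j + p).
Definition lags (V : 'M[R]_(k, n)) : 'M[R]_(k * p, n - p) :=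
  \matrix_(a < k * p, j < n - p) getm V (a %% k) (j + p - 1 - a %/ k).
Definition lag_sum (A : 'M[R]_(k, k * p)) : 'M[R]_k :=
  \matrix_(i < k, j < k) \sum_(l < p) getm A i (l * k + j).
Definition var_coef V : 'M[R]_(k, k * p) := lag0 V *m (lags V)^T *m invmx (lags V *m (lags V)^T).
Definition var_res V : 'M[R]_(k, n - p) := lag0 V - var_coef V *m lags V.

Definition kweight (M x : R) : R := if M == 0 then (if x == 0 then 1 else 0) else kappa (x / M).
Definition psi_hat m (M : R) (Z : 'M[R]_(k, m)) : 'M[R]_k :=
  \sum_(0 <= i < m) kweight M i%:R *: Gamma_check Z i +
  \sum_(1 <= i < m) kweight M (- i%:R) *: (Gamma_check Z i)^T.
Definition omega_val (B : 'M[R]_(q, k)) (B' : 'M[R]_(k, q)) V M : 'M[R]_q :=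
  let F := invmx (1%:M - lag_sum (var_coef V)) in
  n%:R *: (B *m F *m psi_hat M (var_res V) *m F^T *m B').
Definition omega_of (bw : bandwidth k) (B : 'M[R]_(q, k)) (B' : 'M[R]_(k, q)) V : option 'M[R]_q :=
  if lags V *m (lags V)^T \in unitmx then
    match bandwidth_val n bw (var_res V) with
    | None => None
    | Some M => if 1%:M - lag_sum (var_coef V) \in unitmx then Some (omega_val B B' V M) else None
    end
  else None.
End Estimator.

Definition score n k (X : 'M[R]_(n, k)) y : 'M[R]_(k, n) := X^T *m diag_mx (u_hat X y)^T.

(** The data enter only through the matrix V = [score X y], which is linear in y and blind to shifts
    in span(X). *)
Lemma Omega_hatE n k q kappa (bw : bandwidth k) p (X : 'M[R]_(n, k)) (Rm : 'M[R]_(q, k)) y :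
  Omega_hat kappa bw p X Rm y =
  omega_of p kappa bw (Rm *m invmx (X^T *m X)) (invmx (X^T *m X) *m Rm^T) (score X y).
Proof.
rewrite /Omega_hat /omega_of -/(score X y) -/(lags p _) -/(lag0 p _) -/(var_coef p _) -/(var_res p _).
case: ifP => // _; case: (bandwidth_val _ _ _) => // M.
rewrite -/(lag_sum _); case: ifP => // _; congr Some.
by rewrite /omega_val -/(psi_hat _ _ _) !mulmxA.
Qed.

Lemma trmxZ m n (a : R) (A : 'M[R]_(m, n)) : (a *: A)^T = a *: A^T.
Proof. by rewrite linearZ. Qed.

Lemma rank_gram n k (X : 'M[R]_(n, k)) : \rank X = k -> X^T *m X \in unitmx.
Proof.
move=> rX; have fX : row_free X^T by rewrite /row_free mxrank_tr rX.
by have := posdef_sandwich X^T (@posdef1 R n); rewrite mulmx1 trmxK fX => ->.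
Qed.

Lemma beta_hat_lin n k (X : 'M[R]_(n, k)) a y b : \rank X = k ->
  beta_hat X (a *: y + X *m b) = a *: beta_hat X y + b.
Proof.
move=> rX; rewrite /beta_hat mulmxDr scalemxAr; congr (_ + _).
by rewrite -mulmxA (mulmxA X^T) mulKmx// rank_gram.
Qed.

Lemma u_hat_lin n k (X : 'M[R]_(n, k)) a y b : \rank X = k ->
  u_hat X (a *: y + X *m b) = a *: u_hat X y.
Proof.
move=> rX; rewrite /u_hat beta_hat_lin// mulmxDr opprD addrACA subrr addr0.
by rewrite -scalemxAr scalerBr.
Qed.

Lemma score_lin n k (X : 'M[R]_(n, k)) a y b : \rank X = k ->
  score X (a *: y + X *m b) = a *: score X y.
Proof. by move=> rX; rewrite /score u_hat_lin// linearZ/= linearZ/= -scalemxAr. Qed.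

(** * Homogeneity of the estimator in the score matrix *)

Section Scale.
Variables (k n p q : nat) (kappa : R -> R) (a : R).
Hypothesis a0 : a != 0.
Implicit Types V : 'M[R]_(k, n).

Lemma lag0Z V : lag0 p (a *: V) = a *: lag0 p V.
Proof. by apply/matrixP => i j; rewrite !mxE getmZ. Qed.
Lemma lagsZ V : lags p (a *: V) = a *: lags p V.
Proof. by apply/matrixP => i j; rewrite !mxE getmZ. Qed.

Lemma unitmxZ_ne m (A : 'M[R]_m) c : c != 0 -> (c *: A \in unitmx) = (A \in unitmx).
Proof. by move=> c0; rewrite unitmxZ// unitfE. Qed.

Lemma mulmxZZ m1 m2 m3 (A : 'M[R]_(m1, m2)) (B : 'M[R]_(m2, m3)) :
  (a *: A) *m (a *: B) = a ^+ 2 *: (A *m B).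
Proof. by rewrite -scalemxAl -scalemxAr scalerA. Qed.

Lemma var_coefZ V : lags p V *m (lags p V)^T \in unitmx -> var_coef p (a *: V) = var_coef p V.
Proof.
move=> u; rewrite /var_coef lag0Z lagsZ trmxZ !mulmxZZ invmxZ ?unitmxZ_ne ?expf_neq0//.
by rewrite -scalemxAr -scalemxAl scalerA mulVf ?scale1r ?expf_neq0.
Qed.

Lemma var_resZ V : lags p V *m (lags p V)^T \in unitmx -> var_res p (a *: V) = a *: var_res p V.
Proof. by move=> u; rewrite /var_res var_coefZ// lag0Z lagsZ -scalemxAr scalerBr. Qed.

Lemma Gamma_checkZ m (Z : 'M[R]_(k, m)) i : Gamma_check (a *: Z) i = a ^+ 2 *: Gamma_check Z i.
Proof.
rewrite /Gamma_check scalerA mulrC -scalerA; congr (_ *: _).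
apply/matrixP => x y; rewrite !mxE big_distrr/=; apply: eq_bigr => j _.
by rewrite !getmZ; ring.
Qed.

Lemma psi_hatZ m M (Z : 'M[R]_(k, m)) : psi_hat kappa M (a *: Z) = a ^+ 2 *: psi_hat kappa M Z.
Proof.
rewrite /psi_hat scalerDr !scaler_sumr; congr (_ + _); apply: eq_bigr => i _.
  by rewrite Gamma_checkZ !scalerA; congr (_ *: _); ring.
by rewrite Gamma_checkZ trmxZ !scalerA; congr (_ *: _); ring.
Qed.

(** Each automatic bandwidth is a function of quotients of forms of equal degree in Z: degree 4 for
    Andrews-Monahan, where rho has degree 0 and sigma^2 degree 2, and degree 2 for Newey-West. *)
Lemma bandwidth_valZ (bw : bandwidth k) m (Z : 'M[R]_(k, m)) :
  bandwidth_val n bw (a *: Z) = bandwidth_val n bw Z.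
Proof.
have a20 : a ^+ 2 != 0 by rewrite expf_neq0.
case: bw => [om c1 c2 j1|w om cb1 cb2 cb3|//] /=.
  have rdenZ (i : 'I_k) : \sum_(0 <= j < m.-1) getm (a *: Z) i j ^+ 2 = a ^+ 2 * \sum_(0 <= j < m.-1) getm Z i j ^+ 2.
    by rewrite big_distrr/=; apply: eq_bigr => j _; rewrite getmZ exprMn.
  have rhoZ (i : 'I_k) : (\sum_(1 <= j < m) getm (a *: Z) i j * getm (a *: Z) i j.-1) /
      (\sum_(0 <= j < m.-1) getm (a *: Z) i j ^+ 2) =
      (\sum_(1 <= j < m) getm Z i j * getm Z i j.-1) / (\sum_(0 <= j < m.-1) getm Z i j ^+ 2).
    rewrite rdenZ invfM mulrA; congr (_ / _).
    rewrite (eq_bigr (fun j => a ^+ 2 * (getm Z i j * getm Z i j.-1))) -?big_distrr/=.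
      by rewrite mulrAC divff ?mul1r.
    by move=> j _; rewrite !getmZ; ring.
  have sigZ (i : 'I_k) (r : R) : m.-1%:R^-1 * (\sum_(1 <= j < m) (getm (a *: Z) i j - r * getm (a *: Z) i j.-1) ^+ 2)
     = a ^+ 2 * (m.-1%:R^-1 * (\sum_(1 <= j < m) (getm Z i j - r * getm Z i j.-1) ^+ 2)).
    rewrite mulrCA; congr (_ * _); rewrite big_distrr/=; apply: eq_bigr => j _.
    by rewrite !getmZ; ring.
  under eq_forallb do rewrite rhoZ rdenZ mulf_eq0 (negbTE a20)/=.
  under eq_bigr do rewrite rhoZ sigZ exprMn -mulrA mulrCA.
  rewrite -big_distrr/= mulf_eq0 expf_eq0/= (negbTE a20)/=.
  case: ifP => // _; congr (Some (c1 * _ `^ c2)); congr (_ * _).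
  have a40 : a ^+ 2 ^+ 2 != 0 by rewrite expf_neq0.
  case: j1.
    rewrite (eq_bigr (fun i : 'I_k => a ^+ 2 ^+ 2 * (om i 0 * (4 * ((\sum_(1 <= j < m) getm Z i j * getm Z i j.-1) / (\sum_(0 <= j < m.-1) getm Z i j ^+ 2)) ^+ 2 * (m.-1%:R^-1 * (\sum_(1 <= j < m) (getm Z i j - ((\sum_(1 <= j < m) getm Z i j * getm Z i j.-1) / (\sum_(0 <= j < m.-1) getm Z i j ^+ 2)) * getm Z i j.-1) ^+ 2)) ^+ 2 / ((1 - ((\sum_(1 <= j < m) getm Z i j * getm Z i j.-1) / (\sum_(0 <= j < m.-1) getm Z i j ^+ 2))) ^+ 6 * (1 + ((\sum_(1 <= j < m) getm Z i j * getm Z i j.-1) / (\sum_(0 <= j < m.-1) getm Z i j ^+ 2))) ^+ 2))))).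
      by rewrite -big_distrr/= invfM mulrA; congr (_ / _); rewrite mulrAC divff ?mul1r.
    by move=> i _; rewrite rhoZ sigZ exprMn; ring.
  rewrite (eq_bigr (fun i : 'I_k => a ^+ 2 ^+ 2 * (om i 0 * (4 * ((\sum_(1 <= j < m) getm Z i j * getm Z i j.-1) / (\sum_(0 <= j < m.-1) getm Z i j ^+ 2)) ^+ 2 * (m.-1%:R^-1 * (\sum_(1 <= j < m) (getm Z i j - ((\sum_(1 <= j < m) getm Z i j * getm Z i j.-1) / (\sum_(0 <= j < m.-1) getm Z i j ^+ 2)) * getm Z i j.-1) ^+ 2)) ^+ 2 / ((1 - ((\sum_(1 <= j < m) getm Z i j * getm Z i j.-1) / (\sum_(0 <= j < m.-1) getm Z i j ^+ 2))) ^+ 8))))).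
    by rewrite -big_distrr/= invfM mulrA; congr (_ / _); rewrite mulrAC divff ?mul1r.
  by move=> i _; rewrite rhoZ sigZ exprMn; ring.
have sbarZ i : (om^T *m Gamma_check (a *: Z) i *m om) 0 0 = a ^+ 2 * (om^T *m Gamma_check Z i *m om) 0 0.
  by rewrite Gamma_checkZ -scalemxAr -scalemxAl mxE.
have ssZ (f g : int -> R) : (forall i, f i = a ^+ 2 * g i) -> symsum m f = a ^+ 2 * symsum m g.
  by move=> fg; rewrite /symsum big_distrr/=; apply: eq_bigr => j _; rewrite fg.
rewrite (ssZ (fun i => w i * (om^T *m Gamma_check (a *: Z) `|i|%N *m om) 0 0) (fun i => w i * (om^T *m Gamma_check Z `|i|%N *m om) 0 0)); last first.
  by move=> i; rewrite sbarZ; ring.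
rewrite (ssZ (fun i => (`|i|%N)%:R ^+ cb1 * w i * (om^T *m Gamma_check (a *: Z) `|i|%N *m om) 0 0) (fun i => (`|i|%N)%:R ^+ cb1 * w i * (om^T *m Gamma_check Z `|i|%N *m om) 0 0)); last first.
  by move=> i; rewrite sbarZ; ring.
rewrite mulf_eq0 (negbTE a20)/=; case: ifP => // _.
congr (Some (_ * (_ ^+ 2 * _) `^ _)); rewrite invfM mulrA; congr (_ / _).
by rewrite mulrAC divff ?mul1r.
Qed.

Lemma omega_ofZ (bw : bandwidth k) (B : 'M[R]_(q, k)) B' V :
  omega_of p kappa bw B B' (a *: V) = omap ( *:%R (a ^+ 2)) (omega_of p kappa bw B B' V).
Proof.
rewrite /omega_of lagsZ trmxZ mulmxZZ unitmxZ_ne ?expf_neq0//.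
have [u|_] := boolP (lags p V *m (lags p V)^T \in unitmx); last exact: erefl.
rewrite (var_resZ u) (var_coefZ u) bandwidth_valZ.
case: (bandwidth_val n bw (var_res p V)) => [M|]; last exact: erefl.
have [_|_] := boolP (1%:M - lag_sum (var_coef p V) \in unitmx); last exact: erefl.
apply: (congr1 Some); rewrite /omega_val (var_coefZ u) (var_resZ u) psi_hatZ.
by rewrite -scalemxAr -!scalemxAl !scalerA mulrC.
Qed.
End Scale.

(** Pairs (j, l) grouped by lag: the first sum has j - l = i >= 0, the second l - j = i >= 1. The
    induction adds the last row and the last column of the square. *)
Lemma double_sum_lag m (G : nat -> nat -> R) :
  \sum_(0 <= i < m) \sum_(i <= j < m) G j (j - i)%N +
  \sum_(1 <= i < m) \sum_(i <= j < m) G (j - i)%N j =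
  \sum_(0 <= j < m) \sum_(0 <= l < m) G j l.
Proof.
elim: m => [|m IH]; first by rewrite !big_geq// addr0.
have s1 (H : nat -> nat -> R) a : (a <= m)%N ->
    \sum_(a <= i < m.+1) \sum_(i <= j < m.+1) H j (j - i)%N =
    \sum_(a <= i < m) \sum_(i <= j < m) H j (j - i)%N + \sum_(a <= i < m.+1) H m (m - i)%N.
  move=> am; rewrite big_nat_recr//= [X in _ = _ + X]big_nat_recr//= big_nat1 addrA.
  congr (_ + _); rewrite -big_split/=; apply: eq_big_nat => i /andP[_ im].
  by rewrite big_nat_recr// ltnW.
have rv N (f : nat -> R) : \sum_(0 <= i < N.+1) f (N - i)%N = \sum_(0 <= i < N.+1) f i.
  rewrite !big_mkord (reindex_inj rev_ord_inj)/=; apply: eq_bigr => i _.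
  by congr f; have := ltn_ord i; lia.
case: m => [|m] in IH s1 rv *.
  by rewrite [X in _ + X]big_geq// !big_nat1 addr0.
rewrite (s1 G) // (s1 (fun x y => G y x))// addrACA IH.
transitivity (\sum_(0 <= j < m.+1) (\sum_(0 <= l < m.+1) G j l + G j m.+1) + \sum_(0 <= l < m.+2) G m.+1 l); last first.
  rewrite [RHS]big_nat_recr//=; congr (_ + _).
  by apply: eq_bigr => j _; rewrite [RHS]big_nat_recr.
rewrite big_split/= -!addrA; congr (_ + _); rewrite (rv _ (G m.+1)) addrC; congr (_ + _).
rewrite big_add1/= -(rv m (fun j => G j m.+1)).
by apply: eq_bigr => i _; rewrite subSS.
Qed.

Definition kmx kappa m (M : R) : 'M[R]_m := \matrix_(i, j) kweight kappa M (((i : int) - (j : int))%:~R).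

(** The weighted sum of autocovariances is a quadratic form in the Toeplitz matrix of the weights,
    the form to which positive definiteness of the kernel applies. *)
Lemma psi_hatE k kappa m M (Z : 'M[R]_(k, m)) :
  psi_hat kappa M Z = m%:R^-1 *: (Z *m kmx kappa m M *m Z^T).
Proof.
apply/matrixP => a b; rewrite /psi_hat.
pose G (j l : nat) := m%:R^-1 * (getm Z a j * kweight kappa M (((j : int) - (l : int))%:~R) * getm Z b l).
rewrite [RHS]mxE mxE !summxE.
transitivity (\sum_(0 <= j < m) \sum_(0 <= l < m) G j l); last first.
  rewrite big_mkord exchange_big/= big_mkord mxE big_distrr/=; apply: eq_bigr => l _.
  rewrite !mxE mulr_suml big_distrr/=; apply: eq_bigr => j _.
  by rewrite /G !mxE !getmE.
rewrite -double_sum_lag; congr (_ + _); apply: eq_big_nat => i /andP[i0 im].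
  rewrite !mxE big_distrr/= big_distrr/=; apply: eq_big_nat => j /andP[ij jm].
  rewrite /G; have -> : ((j : int) - ((j - i)%N : int))%:~R = i%:R :> R.
    by rewrite -subzn// opprB addrC subrK.
  ring.
rewrite !mxE big_distrr/= big_distrr/=; apply: eq_big_nat => j /andP[ij jm].
rewrite /G; have -> : (((j - i)%N : int) - (j : int))%:~R = - i%:R :> R.
  by rewrite -subzn// addrAC subrr add0r mulrNz.
ring.
Qed.

Lemma kmx_posdef kappa m M : kernel_ok kappa -> 0 <= M -> posdef (kmx kappa m M).
Proof.
move=> [ke [_ [k0 [_ kp]]]] M0; have [->|Mn0] := eqVneq M 0.
  (* At bandwidth 0 the default weights are 1 on the diagonal and 0 off it. *)
  rewrite (_ : kmx _ _ _ = 1%:M); first exact: posdef1.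
  apply/matrixP => i j; rewrite !mxE /kweight eqxx intr_eq0 subr_eq0.
  by have [->|ij] := eqVneq i j; rewrite ?eqxx// eqz_nat (negbTE (ij : (i : nat) != j)).
rewrite (_ : kmx _ _ _ = \matrix_(i < m, j < m) kappa (((i : int) - (j : int))%:~R / M)).
  by apply: kp; rewrite lt_neqAle eq_sym Mn0.
by apply/matrixP => i j; rewrite !mxE /kweight (negbTE Mn0).
Qed.
End Omega.

(** * Names for the pieces of the bandwidth formulas *)

Section AndrewsMonahan.
Variables (R : realType) (k m : nat) (om : 'cV[R]_k) (b : bool) (Z : 'M[R]_(k, m)).
Definition am_rden (i : nat) := \sum_(0 <= j < m.-1) getm Z i j ^+ 2.
Definition am_rnum (i : nat) := \sum_(1 <= j < m) getm Z i j * getm Z i j.-1.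
Definition am_rho i := am_rnum i / am_rden i.
Definition am_sig2 (i : nat) := m.-1%:R^-1 * \sum_(1 <= j < m) (getm Z i j - am_rho i * getm Z i j.-1) ^+ 2.
Definition am_den := \sum_(i < k) om i 0 * (am_sig2 i ^+ 2 / (1 - am_rho i) ^+ 4).
Definition am_num1 := \sum_(i < k) om i 0 *
  (4 * am_rho i ^+ 2 * am_sig2 i ^+ 2 / ((1 - am_rho i) ^+ 6 * (1 + am_rho i) ^+ 2)).
Definition am_num2 := \sum_(i < k) om i 0 *
  (4 * am_rho i ^+ 2 * am_sig2 i ^+ 2 / (1 - am_rho i) ^+ 8).
Definition am_alpha := if b then am_num1 / am_den else am_num2 / am_den.
Definition am_cond := [forall i : 'I_k, (am_rden i != 0) && (1 - am_rho i != 0) &&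
  (b ==> (1 + am_rho i != 0))] && (am_den != 0).

Lemma bandwidth_amE n c1 c2 : bandwidth_val n (BW_AM om c1 c2 b) Z =
  if am_cond then Some (c1 * powR (am_alpha * n%:R) c2) else None.
Proof. by []. Qed.

Hypothesis om0 : forall i, 0 <= om i 0.

Lemma am_alpha_ge0 : 0 <= am_alpha.
Proof.
have e4 (x : R) a : ~~ odd a -> 0 <= x ^+ a by move=> oa; rewrite exprn_even_ge0.
have nn i : 0 <= 4 * am_rho i ^+ 2 * am_sig2 i ^+ 2 by rewrite -mulrA -exprMn; apply: mulr_ge0 => //; exact: e4.
have dd i : 0 <= (1 - am_rho i) ^+ 6 * (1 + am_rho i) ^+ 2 by apply: mulr_ge0; exact: e4.
have d0 : 0 <= am_den.
  by apply: sumr_ge0 => i _; apply: mulr_ge0 => //; apply: divr_ge0; exact: e4.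
rewrite /am_alpha; case: b; apply: divr_ge0 => //; apply: sumr_ge0 => i _;
  apply: mulr_ge0 => //; apply: divr_ge0 => //; exact: e4.
Qed.
End AndrewsMonahan.

Section NeweyWest.
Variables (R : realType) (k m : nat) (om : 'cV[R]_k) (w : int -> R) (Z : 'M[R]_(k, m)).
Definition nw_sbar (i : int) := (om^T *m Gamma_check Z `|i|%N *m om) 0 0.
Definition nw_den := symsum m (fun i => w i * nw_sbar i).
Definition nw_num cb := symsum m (fun i => (`|i|%N)%:R ^+ cb * w i * nw_sbar i).

Lemma bandwidth_nwE n cb1 c2 c3 : bandwidth_val n (BW_NW w om cb1 c2 c3) Z =
  if nw_den != 0 then Some (c2 * powR ((nw_num cb1 / nw_den) ^+ 2 * n%:R) c3) else None.
Proof. by []. Qed.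
End NeweyWest.

(** * Continuity of the estimator *)

Section Cvg.
Variable R : realType.
Variables (T : Type) (F : set_system T).
Context {FF : Filter F}.

Lemma cvg_mxE m n (f : T -> 'M[R]_(m, n)) (l : 'M[R]_(m, n)) i j :
  f x @[x --> F] --> l -> f x i j @[x --> F] --> l i j.
Proof. by move=> fl; exact: (cvg_comp _ _ fl (@coord_continuous R m n i j l)). Qed.

Lemma cvg_mulmx m n p (f : T -> 'M[R]_(m, n)) (g : T -> 'M[R]_(n, p)) (a : 'M[R]_(m, n)) (b : 'M[R]_(n, p)) :
  f x @[x --> F] --> a -> g x @[x --> F] --> b -> (f x *m g x) @[x --> F] --> a *m b.
Proof.
move=> fa gb; apply: cvg_mx => i j; rewrite mxE; under eq_fun do rewrite mxE.
by apply: cvg_sumr => l; apply: cvgM; exact: cvg_mxE.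
Qed.

Lemma cvg_trmx m n (f : T -> 'M[R]_(m, n)) (a : 'M[R]_(m, n)) :
  f x @[x --> F] --> a -> (f x)^T @[x --> F] --> a^T.
Proof.
move=> fa; apply: cvg_mx => i j; rewrite mxE; under eq_fun do rewrite mxE.
exact: cvg_mxE.
Qed.

Lemma cvg_mxZ m n (c : T -> R) (f : T -> 'M[R]_(m, n)) (c0 : R) (a : 'M[R]_(m, n)) :
  c x @[x --> F] --> c0 -> f x @[x --> F] --> a -> (c x *: f x) @[x --> F] --> c0 *: a.
Proof.
move=> cc fa; apply: cvg_mx => i j; rewrite mxE; under eq_fun do rewrite mxE.
by apply: cvgM => //; exact: cvg_mxE.
Qed.

Lemma cvg_mxD m n (f g : T -> 'M[R]_(m, n)) (a b : 'M[R]_(m, n)) :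
  f x @[x --> F] --> a -> g x @[x --> F] --> b -> (f x + g x) @[x --> F] --> a + b.
Proof.
move=> fa gb; apply: cvg_mx => i j; rewrite mxE; under eq_fun do rewrite mxE.
by apply: cvgD; exact: cvg_mxE.
Qed.

Lemma cvg_mxN m n (f : T -> 'M[R]_(m, n)) (a : 'M[R]_(m, n)) :
  f x @[x --> F] --> a -> (- f x) @[x --> F] --> - a.
Proof.
move=> fa; apply: cvg_mx => i j; rewrite mxE; under eq_fun do rewrite mxE.
by apply: cvgN; exact: cvg_mxE.
Qed.

Lemma cvg_det n (f : T -> 'M[R]_n) (a : 'M[R]_n) :
  f x @[x --> F] --> a -> \det (f x) @[x --> F] --> \det a.
Proof.
move=> fa; apply: cvg_sumr => s; apply: cvgM; first exact: cvg_cst.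
by apply: cvg_prodr => i; exact: cvg_mxE.
Qed.

Lemma cvg_adj n (f : T -> 'M[R]_n) (a : 'M[R]_n) :
  f x @[x --> F] --> a -> \adj (f x) @[x --> F] --> \adj a.
Proof.
move=> fa; apply: cvg_mx => i j; rewrite mxE; under eq_fun do rewrite mxE.
apply: cvgM; first exact: cvg_cst.
apply: cvg_det; apply: cvg_mx => u v; rewrite !mxE; under eq_fun do rewrite !mxE.
exact: cvg_mxE.
Qed.

Lemma near_neq0 (f : T -> R) (l : R) : f x @[x --> F] --> l -> l != 0 -> \forall x \near F, f x != 0.
Proof.
by move=> fl l0; exact: (cvgr_neq0 l).
Qed.

Lemma near_unitmx n (f : T -> 'M[R]_n) (a : 'M[R]_n) :
  f x @[x --> F] --> a -> a \in unitmx -> \forall x \near F, f x \in unitmx.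
Proof.
move=> fa; rewrite unitmxE unitfE => a0.
by apply: filterS (near_neq0 (cvg_det fa) a0) => x; rewrite unitmxE unitfE.
Qed.

Lemma cvg_invmx n (f : T -> 'M[R]_n) (a : 'M[R]_n) :
  f x @[x --> F] --> a -> a \in unitmx -> invmx (f x) @[x --> F] --> invmx a.
Proof.
move=> fa ua; have nu := near_unitmx fa ua.
have E : {near F, (fun x => (\det (f x))^-1 *: \adj (f x)) =1 (fun x => invmx (f x))}.
  by apply: filterS nu => x ux; rewrite /invmx ux.
apply: cvg_trans (near_eq_cvg E) _.
rewrite /invmx ua; apply: cvg_mxZ; last exact: cvg_adj.
by apply: cvgV; [move: ua; rewrite unitmxE unitfE|exact: cvg_det].
Qed.

Lemma cvg_getm m n (f : T -> 'M[R]_(m, n)) (a : 'M[R]_(m, n)) i j :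
  f x @[x --> F] --> a -> getm (f x) i j @[x --> F] --> getm a i j.
Proof.
have [[i' [j' h]]|h] := @getmP R m n i j => fa; rewrite h; under eq_fun do rewrite h.
  exact: cvg_mxE.
exact: cvg_cst.
Qed.

(** Away from 0 this is exp (c ln x). At l = 0 the logarithm is lost and the bound x < e^(1/c) is
    used directly; the limit 0 does occur, as a bandwidth may vanish. *)
Lemma cvg_powR (f : T -> R) (l c : R) : f x @[x --> F] --> l -> 0 <= l -> 0 < c ->
  (\forall x \near F, 0 <= f x) -> powR (f x) c @[x --> F] --> powR l c.
Proof.
move=> fl; rewrite le_eqVlt => /predU1P[l00|l0] c0 nf.
  rewrite -l00.
  rewrite powR0 ?gt_eqF//; apply/cvgrPdist_lt => e e0.
  have d0 : 0 < powR e c^-1 by rewrite powR_gt0.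
  have fl0 : \forall x \near F, `|l - f x| < powR e c^-1 by apply: cvgr_dist_lt.
  rewrite -l00 in fl0; apply: filterS2 nf fl0 => x f0; rewrite !sub0r !normrN (ger0_norm f0) (ger0_norm (powR_ge0 _ _)) => fe.
  have := @gt0_ltr_powR _ _ c0 _ _ _ _ fe; rewrite -powRrM mulVf ?gt_eqF// powRr1 ?ltW//.
  by apply; rewrite nnegrE ?powR_ge0.
have E : {near F, (fun x => expR (c * ln (f x))) =1 (fun x => powR (f x) c)}.
  have fgt : \forall x \near F, 0 < f x by apply: (cvgr_gt l).
  by apply: filterS fgt => x fx; rewrite /powR gt_eqF.
apply: cvg_trans (near_eq_cvg E) _.
rewrite /powR gt_eqF//.
have h : (c * ln (f x)) @[x --> F] --> c * ln l.
  apply: cvgM; first exact: cvg_cst.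
  exact: (cvg_comp _ _ fl (continuous_ln l0)).
exact: (cvg_comp _ _ h (@continuous_expR R _)).
Qed.

Section Est.
Variables (k n p q : nat) (kappa : R -> R).
Hypothesis kok : kernel_ok kappa.
Variables (V : T -> 'M[R]_(k, n)) (V0 : 'M[R]_(k, n)).
Hypothesis VV0 : V x @[x --> F] --> V0.

Lemma lag0_cvg : lag0 p (V x) @[x --> F] --> lag0 p V0.
Proof.
apply: cvg_mx => i j; rewrite !mxE; under eq_fun do rewrite !mxE.
exact: cvg_getm.
Qed.

Lemma lags_cvg : lags p (V x) @[x --> F] --> lags p V0.
Proof.
apply: cvg_mx => i j; rewrite !mxE; under eq_fun do rewrite !mxE.
exact: cvg_getm.
Qed.

Lemma gram_lags_cvg : (lags p (V x) *m (lags p (V x))^T) @[x --> F] --> lags p V0 *m (lags p V0)^T.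
Proof. by apply: cvg_mulmx; [|apply: cvg_trmx]; exact: lags_cvg. Qed.

Hypothesis u1 : lags p V0 *m (lags p V0)^T \in unitmx.

Lemma var_coef_cvg : var_coef p (V x) @[x --> F] --> var_coef p V0.
Proof.
apply: cvg_mulmx; last exact: cvg_invmx gram_lags_cvg u1.
by apply: cvg_mulmx; [exact: lag0_cvg|apply: cvg_trmx; exact: lags_cvg].
Qed.

Lemma lag_sum_cvg : (1%:M - lag_sum (var_coef p (V x))) @[x --> F] --> 1%:M - lag_sum (var_coef p V0).
Proof.
apply: cvg_mxD; first exact: cvg_cst.
apply: cvg_mxN; apply: cvg_mx => i j; rewrite !mxE; under eq_fun do rewrite !mxE.
by apply: cvg_sumr => l; apply: cvg_getm; exact: var_coef_cvg.
Qed.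

Lemma var_res_cvg : var_res p (V x) @[x --> F] --> var_res p V0.
Proof.
apply: cvg_mxD; first exact: lag0_cvg.
by apply: cvg_mxN; apply: cvg_mulmx; [exact: var_coef_cvg|exact: lags_cvg].
Qed.
End Est.

Section Band.
Variables (k m n : nat) (Z : T -> 'M[R]_(k, m)) (Z0 : 'M[R]_(k, m)).
Hypothesis ZZ0 : Z x @[x --> F] --> Z0.

Lemma Gamma_cvg i : Gamma_check (Z x) i @[x --> F] --> Gamma_check Z0 i.
Proof.
apply: cvg_mxZ; first exact: cvg_cst.
apply: cvg_mx => a b; rewrite !mxE; under eq_fun do rewrite !mxE.
by apply: cvg_sumr => j; apply: cvgM; exact: cvg_getm.
Qed.

Lemma nw_sbar_cvg om i : nw_sbar om (Z x) i @[x --> F] --> nw_sbar om Z0 i.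
Proof.
apply: cvg_mxE; apply: cvg_mulmx; last exact: cvg_cst.
by apply: cvg_mulmx; [exact: cvg_cst|exact: Gamma_cvg].
Qed.

Section AMcvg.
Variables (om : 'cV[R]_k) (b : bool).
Hypothesis cond : am_cond om b Z0.

Let rden0 (i : 'I_k) : am_rden Z0 i != 0.
Proof. by move: cond => /andP[/forallP/(_ i)/andP[/andP[]]]. Qed.
Let omr0 (i : 'I_k) : 1 - am_rho Z0 i != 0.
Proof. by move: cond => /andP[/forallP/(_ i)/andP[/andP[]]]. Qed.
Let opr0 (i : 'I_k) : b -> 1 + am_rho Z0 i != 0.
Proof. by move: cond => /andP[/forallP/(_ i)/andP[_] /implyP]. Qed.
Let den0 : am_den om Z0 != 0.
Proof. by move: cond => /andP[]. Qed.

Lemma am_rden_cvg i : am_rden (Z x) i @[x --> F] --> am_rden Z0 i.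
Proof. by apply: cvg_sumr => j; apply: cvg_exprn; exact: cvg_getm. Qed.

Lemma am_rho_cvg (i : 'I_k) : am_rho (Z x) i @[x --> F] --> am_rho Z0 i.
Proof.
apply: cvgM; last by apply: cvgV; [exact: rden0|exact: am_rden_cvg].
by apply: cvg_sumr => j; apply: cvgM; exact: cvg_getm.
Qed.

Lemma am_sig2_cvg (i : 'I_k) : am_sig2 (Z x) i @[x --> F] --> am_sig2 Z0 i.
Proof.
apply: cvgM; first exact: cvg_cst.
apply: cvg_sumr => j; apply: cvg_exprn; apply: cvgB; first exact: cvg_getm.
by apply: cvgM; [exact: am_rho_cvg|exact: cvg_getm].
Qed.

Lemma am_omr_cvg (i : 'I_k) : (1 - am_rho (Z x) i) @[x --> F] --> 1 - am_rho Z0 i.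
Proof. by apply: cvgB; [exact: cvg_cst|exact: am_rho_cvg]. Qed.

Lemma am_opr_cvg (i : 'I_k) : (1 + am_rho (Z x) i) @[x --> F] --> 1 + am_rho Z0 i.
Proof. by apply: cvgD; [exact: cvg_cst|exact: am_rho_cvg]. Qed.

Lemma am_den_cvg : am_den om (Z x) @[x --> F] --> am_den om Z0.
Proof.
apply: cvg_sumr => i; apply: cvgM; first exact: cvg_cst.
apply: cvgM; first by apply: cvg_exprn; exact: am_sig2_cvg.
by apply: cvgV; [rewrite expf_neq0// omr0|apply: cvg_exprn; exact: am_omr_cvg].
Qed.

Lemma am_alpha_cvg : am_alpha om b (Z x) @[x --> F] --> am_alpha om b Z0.
Proof.
have rs (i : 'I_k) : (4 * am_rho (Z x) i ^+ 2 * am_sig2 (Z x) i ^+ 2) @[x --> F] -->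
    4 * am_rho Z0 i ^+ 2 * am_sig2 Z0 i ^+ 2.
  apply: cvgM; last by apply: cvg_exprn; exact: am_sig2_cvg.
  by apply: cvgM; [exact: cvg_cst|apply: cvg_exprn; exact: am_rho_cvg].
rewrite /am_alpha; case: (boolP b) => [bt|_]; (apply: cvgM; last by apply: cvgV; [exact: den0|exact: am_den_cvg]);
  apply: cvg_sumr => i; (apply: cvgM; first exact: cvg_cst); (apply: cvgM; first exact: rs).
  apply: cvgV; first by rewrite mulf_neq0// expf_neq0// ?omr0// opr0.
  by apply: cvgM; apply: cvg_exprn; [exact: am_omr_cvg|exact: am_opr_cvg].
by apply: cvgV; [rewrite expf_neq0// omr0|apply: cvg_exprn; exact: am_omr_cvg].
Qed.

Lemma am_cond_near : \forall x \near F, am_cond om b (Z x).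
Proof.
have h1 : \forall x \near F, forall i : 'I_k, (am_rden (Z x) i != 0) && (1 - am_rho (Z x) i != 0) &&
    (b ==> (1 + am_rho (Z x) i != 0)).
  apply: filter_forall => i.
  have n1 := near_neq0 (@am_rden_cvg i) (rden0 i).
  have n2 := near_neq0 (@am_omr_cvg i) (omr0 i).
  have n3 : \forall x \near F, b ==> (1 + am_rho (Z x) i != 0).
    case: (boolP b) => [bt|_]; last exact: nearW.
    exact: (near_neq0 (@am_opr_cvg i) (opr0 i bt)).
  by apply: filterS3 n1 n2 n3 => x -> -> ->.
have h2 := near_neq0 am_den_cvg den0.
by apply: filterS2 h1 h2 => x h1 h2; rewrite /am_cond h2 andbT; apply/forallP.
Qed.
End AMcvg.

(** Definedness means that certain denominators, continuous in Z, do not vanish; it therefore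
    persists near Z0, and convergence of the option is stated through an eventual [Some]. *)
Lemma bandwidth_cvg (bw : bandwidth k) M0 : bandwidth_ok bw ->
  bandwidth_val n bw Z0 = Some M0 ->
  exists M : T -> R, (\forall x \near F, bandwidth_val n bw (Z x) = Some (M x)) /\
     M x @[x --> F] --> M0.
Proof.
case: bw => [om c1 c2 b|w om cb1 cb2 cb3|M].
- move=> [[_ om0] [c10 c20]]; rewrite bandwidth_amE.
  case c: (am_cond om b Z0); last discriminate.
  case=> <-; exists (fun x => c1 * powR (am_alpha om b (Z x) * n%:R) c2); split.
    by apply: filterS (am_cond_near c) => x cx; rewrite bandwidth_amE cx.
  apply: cvgM; first exact: cvg_cst.
  apply: cvg_powR => //.
  + by apply: cvgM; [exact: am_alpha_cvg|exact: cvg_cst].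
  + by rewrite mulr_ge0 ?am_alpha_ge0.
  + by apply: nearW => x; rewrite mulr_ge0 ?am_alpha_ge0.
- move=> [_ [_ [_ [_ [cb20 cb30]]]]]; rewrite bandwidth_nwE.
  case c: (nw_den om w Z0 != 0); last discriminate.
  case=> <-; exists (fun x => cb2 * powR ((nw_num om w (Z x) cb1 / nw_den om w (Z x)) ^+ 2 * n%:R) cb3).
  have denc : nw_den om w (Z x) @[x --> F] --> nw_den om w Z0.
    by apply: cvg_sumr => i; apply: cvgM; [exact: cvg_cst|exact: nw_sbar_cvg].
  have numc : nw_num om w (Z x) cb1 @[x --> F] --> nw_num om w Z0 cb1.
    by apply: cvg_sumr => i; apply: cvgM; [exact: cvg_cst|exact: nw_sbar_cvg].
  split; first by apply: filterS (near_neq0 denc c) => x cx; rewrite bandwidth_nwE cx.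
  apply: cvgM; first exact: cvg_cst.
  apply: cvg_powR => //.
  + apply: cvgM; last exact: cvg_cst.
    by apply: cvg_exprn; apply: cvgM => //; exact: cvgV.
  + by rewrite mulr_ge0 ?sqr_ge0.
  + by apply: nearW => x; rewrite mulr_ge0 ?sqr_ge0.
- by move=> /= _ [<-]; exists (fun=> M); split; [exact: nearW|exact: cvg_cst].
Qed.
End Band.

Lemma bandwidth_ge0 k m n (bw : bandwidth k) (Z : 'M[R]_(k, m)) M : bandwidth_ok bw ->
  bandwidth_val n bw Z = Some M -> 0 <= M.
Proof.
case: bw => [om c1 c2 j1|w om cb1 cb2 cb3|M'] /=.
- move=> [_ [c10 _]]; case: ifP => // _ [<-].
  by rewrite mulr_ge0 ?powR_ge0// ltW.
- move=> [_ [_ [_ [_ [c0 _]]]]]; case: ifP => // _ [<-].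
  by rewrite mulr_ge0 ?powR_ge0// ltW.
- by move=> M0 [<-]; exact: ltW.
Qed.

Lemma kweight_cvg kappa (M : T -> R) (M0 y : R) : kernel_ok kappa ->
  M x @[x --> F] --> M0 -> 0 <= M0 -> (\forall x \near F, 0 <= M x) ->
  kweight kappa (M x) y @[x --> F] --> kweight kappa M0 y.
Proof.
move=> [ke [kc [k0 [kl _]]]] MM0; rewrite le_eqVlt => /predU1P[M00|M00] nM; last first.
  have E : {near F, (fun x => kappa (y / M x)) =1 (fun x => kweight kappa (M x) y)}.
    have := near_neq0 MM0; rewrite gt_eqF// => /(_ isT); apply: filterS => x Mx.
    by rewrite /kweight (negbTE Mx).
  apply: cvg_trans (near_eq_cvg E) _; rewrite /kweight gt_eqF//.
  have h : (y / M x) @[x --> F] --> y / M0.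
    apply: cvgM; first exact: cvg_cst.
    by apply: cvgV => //; rewrite gt_eqF.
  exact: (cvg_comp _ _ h (kc _)).
(* At lag 0 both branches of the weight give 1; at any other lag |y| / M tends to infinity and the
   kernel value to the default 0. *)
rewrite -M00 /kweight eqxx; have [->|y0] := eqVneq y 0.
  rewrite (_ : (fun x => _) = cst 1); first exact: cvg_cst.
  by apply/funext => x; rewrite mul0r k0; case: ifP.
apply/cvgrPdist_lt => e e0.
have [A [Ar hA]] : \forall x \near +oo, `|0 - kappa x| < e by move/cvgrPdist_lt : kl; exact.
(* A positive threshold, so that |y| / A' is a positive bound for M. *)
pose A' := Num.max A 1.
have A'0 : 0 < A' by rewrite lt_max ltr01 orbT.
have d0 : 0 < `|y| / A' by rewrite divr_gt0// normr_gt0.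
have nd : \forall x \near F, `|M0 - M x| < `|y| / A' by move/cvgrPdist_lt : MM0; exact.
apply: filterS2 nM nd => x Mx; rewrite -M00 sub0r normrN ger0_norm// => My.
case: ifPn => Mn0; first by rewrite subrr normr0.
have Mp : 0 < M x by rewrite lt_neqAle eq_sym Mn0.
have -> : kappa (y / M x) = kappa (`|y| / M x).
  by have [//|_] := ger0P y; rewrite mulNr ke.
apply: hA; apply: (@le_lt_trans _ _ A'); first by rewrite le_max lexx.
by rewrite ltr_pdivlMr// mulrC -ltr_pdivlMr.
Qed.

Lemma omega_of_cvg k n p q kappa (bw : bandwidth k) (B : 'M[R]_(q, k)) B'
    (V : T -> 'M[R]_(k, n)) (V0 : 'M[R]_(k, n)) (O0 : 'M[R]_q) :
  kernel_ok kappa -> bandwidth_ok bw -> V x @[x --> F] --> V0 ->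
  omega_of p kappa bw B B' V0 = Some O0 ->
  exists O : T -> 'M[R]_q, (\forall x \near F, omega_of p kappa bw B B' (V x) = Some (O x)) /\
     O x @[x --> F] --> O0.
Proof.
move=> kok bok VV0; rewrite {1}/omega_of.
have [u1|//] := boolP (lags p V0 *m (lags p V0)^T \in unitmx).
case E: (bandwidth_val n bw (var_res p V0)) => [M0|//].
have [u2|//] := boolP (1%:M - lag_sum (var_coef p V0) \in unitmx) => -[<-].
have Zc := var_res_cvg VV0 u1.
have [M [nM Mc]] := bandwidth_cvg Zc bok E.
have M0ge := bandwidth_ge0 bok E.
have Mge : \forall x \near F, 0 <= M x.
  by apply: filterS nM => x; exact: bandwidth_ge0.
exists (fun x => omega_val p kappa B B' (V x) (M x)); split.
  have n1 := near_unitmx (gram_lags_cvg VV0) u1.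
  have n2 := near_unitmx (lag_sum_cvg VV0 u1) u2.
  by apply: filterS3 n1 n2 nM => x h1 h2 h3; rewrite /omega_of h1 h3 h2.
have Fc := cvg_invmx (lag_sum_cvg VV0 u1) u2.
apply: cvg_mxZ; first exact: cvg_cst.
apply: cvg_mulmx; last exact: cvg_cst.
apply: cvg_mulmx; last exact: cvg_trmx.
apply: cvg_mulmx; first by apply: cvg_mulmx => //; exact: cvg_cst.
rewrite /psi_hat.
have kw y : kweight kappa (M x) y @[x --> F] --> kweight kappa M0 y by exact: kweight_cvg.
apply: cvg_mxD; apply: cvg_mx => a b; rewrite !summxE; under eq_fun do rewrite !summxE.
  apply: cvg_sumr => i; apply: cvg_mxE; apply: cvg_mxZ => //; exact: Gamma_cvg.
by apply: cvg_sumr => i; apply: cvg_mxE; apply: cvg_mxZ => //; apply: cvg_trmx; exact: Gamma_cvg.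
Qed.
End Cvg.

(** * Polynomial description of the nonsingularity set *)

Section Poly.
Variables (R : realType) (N : nat).
Implicit Types f g : 'cV[R]_N -> R.

(** Exactly the two regularity hypotheses of [Pn_null], bundled so that they propagate together. *)
Definition polyf f := continuous f /\ linepoly f.

Lemma polyf_cst c : polyf (fun=> c).
Proof.
split; first exact: cst_continuous.
by move=> a b; exists c%:P => t; rewrite hornerC.
Qed.

Lemma polyf_coord i : polyf (fun y => y i 0).
Proof.
split; first exact: coord_continuous.
by move=> a b; exists ((a i 0)%:P + b i 0 *: 'X) => t; rewrite !hornerE !mxE mulrC.
Qed.

Lemma polyfD f g : polyf f -> polyf g -> polyf (fun y => f y + g y).
Proof.
move=> [cf lf] [cg lg]; split; first by move=> y; exact: (cvgD (cf y) (cg y)).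
by move=> a b; have [p hp] := lf a b; have [r hr] := lg a b; exists (p + r) => t; rewrite hornerD hp hr.
Qed.

Lemma polyfM f g : polyf f -> polyf g -> polyf (fun y => f y * g y).
Proof.
move=> [cf lf] [cg lg]; split; first by move=> y; exact: (cvgM (cf y) (cg y)).
by move=> a b; have [p hp] := lf a b; have [r hr] := lg a b; exists (p * r) => t; rewrite hornerM hp hr.
Qed.

Lemma polyfN f : polyf f -> polyf (fun y => - f y).
Proof.
move=> [cf lf]; split; first by move=> y; exact: (cvgN (cf y)).
by move=> a b; have [p hp] := lf a b; exists (- p) => t; rewrite hornerN hp.
Qed.

Lemma polyfB f g : polyf f -> polyf g -> polyf (fun y => f y - g y).
Proof. by move=> pf pg; apply: polyfD => //; exact: polyfN. Qed.

Lemma polyf_sum (I : Type) (r : seq I) (F : I -> 'cV[R]_N -> R) :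
  (forall i, polyf (F i)) -> polyf (fun y => \sum_(i <- r) F i y).
Proof.
move=> pF; elim: r => [|i r IH].
  by under eq_fun do rewrite big_nil; exact: polyf_cst.
by under eq_fun do rewrite big_cons; exact: polyfD.
Qed.

Lemma polyf_prod (I : Type) (r : seq I) (F : I -> 'cV[R]_N -> R) :
  (forall i, polyf (F i)) -> polyf (fun y => \prod_(i <- r) F i y).
Proof.
move=> pF; elim: r => [|i r IH].
  by under eq_fun do rewrite big_nil; exact: polyf_cst.
by under eq_fun do rewrite big_cons; exact: polyfM.
Qed.

Lemma polyfX f i : polyf f -> polyf (fun y => f y ^+ i).
Proof.
move=> pf; elim: i => [|i IH]; first by under eq_fun do rewrite expr0; exact: polyf_cst.
by under eq_fun do rewrite exprS; exact: polyfM.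
Qed.

Definition polymx m n (F : 'cV[R]_N -> 'M[R]_(m, n)) := forall i j, polyf (fun y => F y i j).

Lemma polymx_cst m n (A : 'M[R]_(m, n)) : polymx (fun=> A).
Proof. by move=> i j; exact: polyf_cst. Qed.

Lemma polymx_id : polymx (fun y : 'cV[R]_N => y).
Proof. by move=> i j; rewrite ord1; exact: polyf_coord. Qed.

Lemma polymxD m n (F G : 'cV[R]_N -> 'M[R]_(m, n)) : polymx F -> polymx G -> polymx (fun y => F y + G y).
Proof. by move=> pF pG i j; under eq_fun do rewrite mxE; exact: polyfD. Qed.

Lemma polymxN m n (F : 'cV[R]_N -> 'M[R]_(m, n)) : polymx F -> polymx (fun y => - F y).
Proof. by move=> pF i j; under eq_fun do rewrite mxE; exact: polyfN. Qed.

Lemma polymxM m n p (F : 'cV[R]_N -> 'M[R]_(m, n)) (G : 'cV[R]_N -> 'M[R]_(n, p)) :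
  polymx F -> polymx G -> polymx (fun y => F y *m G y).
Proof.
by move=> pF pG i j; under eq_fun do rewrite mxE; apply: polyf_sum => l; exact: polyfM.
Qed.

Lemma polymxZ m n f (F : 'cV[R]_N -> 'M[R]_(m, n)) : polyf f -> polymx F -> polymx (fun y => f y *: F y).
Proof. by move=> pf pF i j; under eq_fun do rewrite mxE; exact: polyfM. Qed.

Lemma polymxT m n (F : 'cV[R]_N -> 'M[R]_(m, n)) : polymx F -> polymx (fun y => (F y)^T).
Proof. by move=> pF i j; under eq_fun do rewrite mxE. Qed.

Lemma polyf_det m (F : 'cV[R]_N -> 'M[R]_m) : polymx F -> polyf (fun y => \det (F y)).
Proof.
move=> pF; apply: polyf_sum => s; apply: polyfM; first exact: polyf_cst.
by apply: polyf_prod => i.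
Qed.

Lemma polymx_adj m (F : 'cV[R]_N -> 'M[R]_m) : polymx F -> polymx (fun y => \adj (F y)).
Proof.
move=> pF i j; under eq_fun do rewrite mxE.
apply: polyfM; first exact: polyf_cst.
by apply: polyf_det => u v; under eq_fun do rewrite !mxE.
Qed.

Lemma polyf_getm m n (F : 'cV[R]_N -> 'M[R]_(m, n)) i j : polymx F -> polyf (fun y => getm (F y) i j).
Proof.
have [[i' [j' h]]|h] := @getmP R m n i j => pF; under eq_fun do rewrite h.
  exact: pF.
exact: polyf_cst.
Qed.

End Poly.

(** * Definedness of the bandwidth as nonvanishing of a polynomial *)

Section Bpoly.
Variables (R : realType) (k m : nat).

(** The residual sum of squares in [am_sig2], multiplied by [am_rden] squared to clear the
    denominator of rho. *)
Definition am_s (Z : 'M[R]_(k, m)) (i : nat) :=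
  \sum_(1 <= j < m) (am_rden Z i * getm Z i j - am_rnum Z i * getm Z i j.-1) ^+ 2.

(** For Andrews-Monahan the product encodes that [am_rden], 1 - rho and, when required, 1 + rho are
    nonzero. The final sum stands in for [am_den]: it is not proportional to it, but both have
    nonnegative terms that vanish together. *)
Definition bandwidth_poly (bw : bandwidth k) (Z : 'M[R]_(k, m)) : R :=
  match bw with
  | BW_AM om _ _ b =>
    (\prod_(i < k) (am_rden Z i * (am_rden Z i - am_rnum Z i) *
                    (if b then am_rden Z i + am_rnum Z i else 1))) *
    \sum_(i < k) om i 0 * am_s Z i ^+ 2
  | BW_NW w om _ _ _ => nw_den om w Z
  | BW_KV _ => 1
  end.

Lemma bandwidth_polyf N bw (Z : 'cV[R]_N -> 'M[R]_(k, m)) : polymx Z ->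
  polyf (fun y => bandwidth_poly bw (Z y)).
Proof.
move=> pZ; have pg i j : polyf (fun y => getm (Z y) i j) by exact: polyf_getm.
case: bw => [om c1 c2 b|w om cb1 cb2 cb3|M] /=; last exact: polyf_cst.
- have prd i : polyf (fun y => am_rden (Z y) i) by apply: polyf_sum => j; exact: polyfX.
  have prn i : polyf (fun y => am_rnum (Z y) i) by apply: polyf_sum => j; exact: polyfM.
  apply: polyfM.
    apply: polyf_prod => i; apply: polyfM; first by apply: polyfM => //; exact: polyfB.
    by case: b; [exact: polyfD|exact: polyf_cst].
  apply: polyf_sum => i; apply: polyfM; first exact: polyf_cst.
  apply: polyfX; apply: polyf_sum => j; apply: polyfX.
  by apply: polyfB; exact: polyfM.
- apply: polyf_sum => i; apply: polyfM; first exact: polyf_cst.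
  suff : polymx (fun y => om^T *m Gamma_check (Z y) `|i%:Z - (m.-1)%:Z|%N *m om) by apply.
  apply: polymxM; last exact: polymx_cst.
  apply: polymxM; first exact: polymx_cst.
  apply: polymxZ; first exact: polyf_cst.
  by move=> a b; under eq_fun do rewrite mxE; apply: polyf_sum => j; exact: polyfM.
Qed.

Lemma am_condE (om : 'cV[R]_k) b (Z : 'M[R]_(k, m)) : (forall i, 0 <= om i 0) ->
  am_cond om b Z = (bandwidth_poly (BW_AM om 0 0 b) Z != 0).
Proof.
move=> om0; rewrite /am_cond /= mulf_eq0 negb_or prodf_seq_neq0.
have -> : all (fun i : 'I_k => true ==> (am_rden Z i * (am_rden Z i - am_rnum Z i) *
     (if b then am_rden Z i + am_rnum Z i else 1) != 0)) (index_enum _) =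
   [forall i : 'I_k, (am_rden Z i != 0) && (1 - am_rho Z i != 0) && (b ==> (1 + am_rho Z i != 0))].
  apply/allP/forallP => h i.
    have := h i (mem_index_enum i); rewrite /= !mulf_eq0 !negb_or => /andP[/andP[d0 h1] h2].
    have -> : 1 - am_rho Z i = (am_rden Z i - am_rnum Z i) / am_rden Z i.
      by rewrite mulrBl divff.
    rewrite mulf_neq0 ?invr_eq0// d0/=; apply/implyP => bt; rewrite bt in h2.
    have -> : 1 + am_rho Z i = (am_rden Z i + am_rnum Z i) / am_rden Z i.
      by rewrite mulrDl divff.
    by rewrite mulf_neq0 ?invr_eq0.
  move=> _; have := h i => /andP[/andP[d0 h1] /implyP h2] /=.
  rewrite !mulf_neq0//.
    move: h1; rewrite (_ : 1 - am_rho Z i = (am_rden Z i - am_rnum Z i) / am_rden Z i).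
      by rewrite mulf_eq0 negb_or => /andP[].
    by rewrite mulrBl divff.
  case: (b) h2 => h2; last exact: oner_neq0.
  have := h2 isT; rewrite (_ : 1 + am_rho Z i = (am_rden Z i + am_rnum Z i) / am_rden Z i).
    by rewrite mulf_eq0 negb_or => /andP[].
  by rewrite mulrDl divff.
case: forallP => //= h; congr (~~ _).
(* The terms of the two sums differ by a nonzero square depending on i; nonnegativity of the weights
   then equates the vanishing of the sums. *)
have sE (i : 'I_k) : am_sig2 Z i ^+ 2 / (1 - am_rho Z i) ^+ 4 =
    ((m.-1%:R * am_rden Z i ^+ 2 * (1 - am_rho Z i) ^+ 2)^-1) ^+ 2 * am_s Z i ^+ 2.
  have /andP[/andP[d0 r0] _] := h i.
  have -> : am_s Z i = am_rden Z i ^+ 2 * \sum_(1 <= j < m) (getm Z i j - am_rho Z i * getm Z i j.-1) ^+ 2.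
    rewrite big_distrr/=; apply: eq_bigr => j _; rewrite -exprMn /am_rho; congr (_ ^+ 2).
    by field.
  (* Otherwise [am_rden] would be an empty sum. *)
  have m1 : m.-1%:R != 0 :> R.
    by rewrite pnatr_eq0; apply: contra d0 => /eqP mE; rewrite /am_rden mE big_geq.
  rewrite /am_sig2; move: (\sum_(1 <= j < m) _) (1 - am_rho Z i) r0 => S r r0.
  move: (m.-1%:R : R) m1 (am_rden Z i) d0 => x x0 D d0.
  by field; rewrite x0 d0 r0.
have cneq (i : 'I_k) : (m.-1%:R * am_rden Z i ^+ 2 * (1 - am_rho Z i) ^+ 2)^-1 != 0.
  have /andP[/andP[d0 h1] _] := h i.
  rewrite invr_eq0 !mulf_neq0 ?expf_neq0// pnatr_eq0; apply: contra d0 => /eqP m0.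
  by rewrite /am_rden m0 big_geq.
have nn1 (i : 'I_k) : 0 <= om i 0 * (am_sig2 Z i ^+ 2 / (1 - am_rho Z i) ^+ 4).
  by rewrite sE mulr_ge0// mulr_ge0// sqr_ge0.
have nn2 (i : 'I_k) : 0 <= om i 0 * am_s Z i ^+ 2 by rewrite mulr_ge0// sqr_ge0.
rewrite /am_den !psumr_eq0 //; apply: eq_all => i /=.
by rewrite sE mulrCA mulf_eq0 sqrf_eq0 (negbTE (cneq i)).
Qed.

Lemma bandwidth_polyP n bw (Z : 'M[R]_(k, m)) : bandwidth_ok bw ->
  (bandwidth_val n bw Z : bool) = (bandwidth_poly bw Z != 0).
Proof.
case: bw => [om c1 c2 b|w om cb1 cb2 cb3|M].
- move=> [[_ om0] _]; rewrite bandwidth_amE.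
  have := @am_condE om b Z om0; rewrite /= => <-; by case: (am_cond _ _ _).
- by move=> _; rewrite bandwidth_nwE /=; case: (_ != 0).
- by move=> _; rewrite /= oner_neq0.
Qed.
End Bpoly.

(** * Nonsingularity of the estimator as nonvanishing of a polynomial *)

Section Opoly.
Variables (R : realType) (k n p q : nat) (kappa : R -> R) (bw : @bandwidth R k).
Hypotheses (kok : kernel_ok kappa) (bok : bandwidth_ok bw).
Hypotheses (n0 : (0 < n)%N) (m0 : (0 < n - p)%N).
Variable B : 'M[R]_(q, k).

Implicit Types (V : 'M[R]_(k, n)) (M : R).

(** The matrix N for which the estimator is a positive multiple of N K N', with K the kernel weight
    matrix; it does not involve the bandwidth. *)
Definition omega_root (V : 'M[R]_(k, n)) : 'M[R]_(q, n - p) :=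
  B *m invmx (1%:M - lag_sum (var_coef p V)) *m var_res p V.

Lemma omega_valE V M : omega_val p kappa B B^T V M =
  (n%:R / (n - p)%:R) *: (omega_root V *m kmx kappa (n - p) M *m (omega_root V)^T).
Proof.
rewrite /omega_val psi_hatE -scalemxAr -!scalemxAl scalerA; congr (_ *: _).
by rewrite /omega_root !trmx_mul !mulmxA.
Qed.

Lemma omega_cst_gt0 : 0 < (n%:R / (n - p)%:R : R).
Proof. by rewrite divr_gt0 ?ltr0n. Qed.

Lemma omega_val_unit V M : 0 <= M ->
  (omega_val p kappa B B^T V M \in unitmx) = row_free (omega_root V).
Proof.
move=> M0; rewrite omega_valE unitmxZ_ne ?gt_eqF ?omega_cst_gt0//.
by apply: posdef_sandwich; exact: kmx_posdef.
Qed.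

Lemma omega_val_posdef V M : 0 <= M -> omega_val p kappa B B^T V M \in unitmx ->
  posdef (omega_val p kappa B B^T V M).
Proof.
move=> M0 u; rewrite omega_valE; apply: posdef_scale; first exact: omega_cst_gt0.
apply: posdef_sandwich_pos; first exact: kmx_posdef.
by rewrite -(omega_val_unit _ M0).
Qed.

Lemma kmx_sym m M : (kmx kappa m M)^T = kmx kappa m M.
Proof.
apply/matrixP => i j; rewrite !mxE -opprB mulrNz /kweight oppr_eq0.
case: kok => ke _; case: ifP => // _; by rewrite mulNr ke.
Qed.

Lemma omega_val_sym V M : (omega_val p kappa B B^T V M)^T = omega_val p kappa B B^T V M.
Proof. by rewrite omega_valE trmxZ trmx_mul trmxK (trmx_mul (omega_root V)) kmx_sym mulmxA. Qed.

Lemma omega_of_posdef V O : omega_of p kappa bw B B^T V = Some O -> O \in unitmx ->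
  posdef O /\ O^T = O.
Proof.
rewrite /omega_of; case: ifP => // _; case E: (bandwidth_val _ _ _) => [M|//].
case: ifP => // _ [<-] u; split; last exact: omega_val_sym.
by apply: omega_val_posdef => //; exact: bandwidth_ge0 E.
Qed.

(* Clearing denominators: D1 = det(V1 V1'), then det (D1 (I - sum A_l)), then a Gram determinant. *)
Definition pD (V : 'M[R]_(k, n)) : R := \det (lags p V *m (lags p V)^T).
Definition pA V : 'M[R]_(k, k * p) := lag0 p V *m (lags p V)^T *m \adj (lags p V *m (lags p V)^T).
Definition pZ V : 'M[R]_(k, n - p) := pD V *: lag0 p V - pA V *m lags p V.
Definition pS V : 'M[R]_k := pD V *: 1%:M - lag_sum (pA V).
Definition pN V : 'M[R]_(q, n - p) := B *m \adj (pS V) *m pZ V.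
Definition omega_poly V : R :=
  pD V * \det (pS V) * \det (pN V *m (pN V)^T) * bandwidth_poly bw (pZ V).

Lemma pA_E V : pD V != 0 -> pA V = pD V *: var_coef p V.
Proof.
move=> d0; rewrite /pA /var_coef /invmx unitmxE unitfE -/(pD V) d0 -scalemxAr scalerA divff//.
by rewrite scale1r.
Qed.

Lemma pZ_E V : pD V != 0 -> pZ V = pD V *: var_res p V.
Proof. by move=> d0; rewrite /pZ pA_E// -scalemxAl -scalerBr. Qed.

Lemma lag_sumZ (a : R) (A : 'M[R]_(k, k * p)) : lag_sum (a *: A) = a *: lag_sum A.
Proof.
apply/matrixP => i j; rewrite !mxE big_distrr/=; apply: eq_bigr => l _; exact: getmZ.
Qed.

Lemma pS_E V : pD V != 0 -> pS V = pD V *: (1%:M - lag_sum (var_coef p V)).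
Proof. by move=> d0; rewrite /pS pA_E// lag_sumZ -scalerBr. Qed.

(** The factor [pD] of [pZ] cancels the one in the inverse of [pS], leaving det([pS]) as the
    constant. *)
Lemma pN_E V : pD V != 0 -> 1%:M - lag_sum (var_coef p V) \in unitmx ->
  exists2 c, c != 0 & pN V = c *: omega_root V.
Proof.
move=> d0 u; have uS : pS V \in unitmx by rewrite pS_E// unitmxZ_ne.
have dS : \det (pS V) != 0 by move: uS; rewrite unitmxE unitfE.
have aS : \adj (pS V) = (\det (pS V) / pD V) *: invmx (1%:M - lag_sum (var_coef p V)).
  transitivity (\det (pS V) *: invmx (pS V)).
    by rewrite /invmx uS scalerA divff// scale1r.
  by rewrite [in invmx (pS V)]pS_E// invmxZ ?unitmxZ_ne// scalerA.
exists (\det (pS V)); first by [].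
by rewrite /pN aS pZ_E// -scalemxAr -[B *m _]scalemxAr -scalemxAl scalerA mulrC divfK.
Qed.

(** Scale invariance lets [pZ] replace the residuals in the bandwidth condition, and
    [posdef_sandwich] with K = I turns row freeness of [omega_root] into a Gram determinant. *)
Lemma omega_polyP V : (if omega_of p kappa bw B B^T V is Some Oy then Oy \in unitmx else false) =
  (omega_poly V != 0).
Proof.
rewrite /omega_of /omega_poly unitmxE unitfE -/(pD V) !mulf_eq0 !negb_or.
have [_|d0] := eqVneq (pD V) 0; first exact: erefl.
rewrite -(@bandwidth_polyP _ _ _ n) // pZ_E// bandwidth_valZ// andTb.
have -> : (\det (pS V) != 0) = (1%:M - lag_sum (var_coef p V) \in unitmx).
  by rewrite -unitfE -unitmxE pS_E// unitmxZ_ne.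
case E: (bandwidth_val n bw (var_res p V)) => [M|]; last by rewrite andbF.
rewrite andbT; case: ifP => [u|_]; last exact: erefl.
rewrite andTb omega_val_unit; last exact: bandwidth_ge0 E.
have [c c0 ->] := pN_E d0 u.
rewrite -unitfE -unitmxE trmxZ -scalemxAr -scalemxAl scalerA unitmxZ_ne ?mulf_neq0//.
by have := posdef_sandwich (omega_root V) (@posdef1 R (n - p)); rewrite mulmx1.
Qed.

Lemma omega_polyf N (V : 'cV[R]_N -> 'M[R]_(k, n)) : polymx V -> polyf (fun y => omega_poly (V y)).
Proof.
move=> pV.
have p0 : polymx (fun y => lag0 p (V y)).
  by move=> i j; under eq_fun do rewrite mxE; exact: polyf_getm.
have p1 : polymx (fun y => lags p (V y)).
  by move=> i j; under eq_fun do rewrite mxE; exact: polyf_getm.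
have pG : polymx (fun y => lags p (V y) *m (lags p (V y))^T) by apply: polymxM => //; exact: polymxT.
have pd : polyf (fun y => pD (V y)) by exact: polyf_det.
have pa : polymx (fun y => pA (V y)).
  by apply: polymxM; [apply: polymxM => //; exact: polymxT|exact: polymx_adj].
have pz : polymx (fun y => pZ (V y)).
  by apply: polymxD; [exact: polymxZ|apply: polymxN; exact: polymxM].
have ps : polymx (fun y => pS (V y)).
  apply: polymxD; first by apply: polymxZ => //; exact: polymx_cst.
  apply: polymxN => i j; under eq_fun do rewrite mxE.
  by apply: polyf_sum => l; exact: polyf_getm.
have pn : polymx (fun y => pN (V y)).
  by apply: polymxM => //; apply: polymxM; [exact: polymx_cst|exact: polymx_adj].
apply: polyfM; last exact: bandwidth_polyf.
apply: polyfM; first by apply: polyfM => //; exact: polyf_det.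
by apply: polyf_det; apply: polymxM => //; exact: polymxT.
Qed.
End Opoly.

(** * Invariance and regularity of the test statistic *)

Section Diff.
Variable R : realType.

Lemma near_gt U (F : set_system U) (FF : Filter F) (f : U -> R) (l c : R) :
  f x @[x --> F] --> l -> c < l -> \forall x \near F, c < f x.
Proof. by move=> fl cl; apply: (cvgr_gt l). Qed.

Lemma near_lt U (F : set_system U) (FF : Filter F) (f : U -> R) (l c : R) :
  f x @[x --> F] --> l -> l < c -> \forall x \near F, f x < c.
Proof. by move=> fl cl; apply: (cvgr_lt l). Qed.

(** The direction u j moves with j, so directional derivatives would not do: the Frechet remainder
    is o(|eps_j u_j|), and u j is bounded. *)
Lemma differentiable_seq n (T : 'cV[R]_n -> R) (a w : 'cV[R]_n) (eps : nat -> R) (u : nat -> 'cV[R]_n) :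
  differentiable T a -> eps j @[j --> \oo] --> (0 : R) -> (forall j, eps j != 0) ->
  u j @[j --> \oo] --> w ->
  ((T (a + eps j *: u j) - T a) / eps j) @[j --> \oo] --> ('d T a : 'cV[R]_n -> R) w.
Proof.
move=> dT e0 en0 uw.
have [cd dE] := (diff_locallyxP a T).1 dT.
pose k h := T (h + a) - T a - ('d T a : 'cV[R]_n -> R) h.
have kP : forall e, 0 < e -> \forall h \near (0 : 'cV[R]_n), `|k h| <= e * `|h|.
  move=> e ep; have := diff_locally dT; set ko := 'o _ => dE'.
  have koE h : k h = ko h.
    rewrite /k (_ : T (h + a) = T a + ('d T a : 'cV[R]_n -> R) h + ko h); last exact: (congr1 (@^~ h) dE').
    by move: (T a) (('d T a : 'cV[R]_n -> R) h) (ko h) => x y z; ring.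
  have := littleoP [littleo of ko] ep; apply: filterS => h.
  by rewrite koE.
have du : ('d T a : 'cV[R]_n -> R) (u j) @[j --> \oo] --> ('d T a : 'cV[R]_n -> R) w.
  exact: (cvg_comp _ _ uw (cd w)).
have eu0 : (eps j *: u j) @[j --> \oo] --> (0 : 'cV[R]_n).
  by rewrite -(scale0r w); apply: cvg_mxZ.
have kq : (k (eps j *: u j) / eps j) @[j --> \oo] --> (0 : R).
  apply/cvgrPdist_lt => e ep.
  have w1 : 0 < `|w| + 1 by rewrite ltr_wpDl.
  have ep' : 0 < e / 2 / (`|w| + 1) by rewrite !divr_gt0.
  have n1 : \forall j \near \oo, `|k (eps j *: u j)| <= e / 2 / (`|w| + 1) * `|eps j *: u j|.
    exact: (eu0 _ (kP _ ep')).
  have n2 : \forall j \near \oo, `|w - u j| < 1 by move/cvgrPdist_lt: uw; apply.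
  apply: filterS2 n1 n2 => j h1 h2; rewrite sub0r normrN normrM normfV.
  rewrite ltr_pdivrMr ?normr_gt0//; apply: (le_lt_trans h1).
  have uj : `|u j| <= `|w| + 1.
    have := ler_normB w (w - u j); rewrite opprB addrC subrK => /le_trans; apply.
    by rewrite lerD2l ltW.
  rewrite normrZ mulrCA mulrC ltr_pM2r ?normr_gt0//.
  apply: (@le_lt_trans _ _ (e / 2 / (`|w| + 1) * (`|w| + 1))).
    by rewrite ler_pM2l.
  by rewrite divfK ?gt_eqF//; lra.
have E j : (T (a + eps j *: u j) - T a) / eps j = ('d T a : 'cV[R]_n -> R) (u j) + k (eps j *: u j) / eps j.
  have dZ : ('d T a : 'cV[R]_n -> R) (eps j *: u j) = eps j * ('d T a : 'cV[R]_n -> R) (u j) by rewrite linearZ.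
  rewrite /k [eps j *: u j + a]addrC dZ; move: (en0 j) (T _) (T a) (('d T a : 'cV[R]_n -> R) (u j)) => e00 x y z.
  by field.
have h : (('d T a : 'cV[R]_n -> R) (u j) + k (eps j *: u j) / eps j) @[j --> \oo] -->
    ('d T a : 'cV[R]_n -> R) w + 0 by exact: cvgD.
by rewrite addr0 in h; under eq_fun do rewrite E.
Qed.
End Diff.

Section Stat.
Variables (R : realType) (k n q p : nat) (X : 'M[R]_(n, k)) (Rm : 'M[R]_(q, k)) (r : 'cV[R]_q).
Variables (kappa : R -> R) (bw : @bandwidth R k).
Hypotheses (rX : \rank X = k) (rR : \rank Rm = q).
Hypotheses (kok : kernel_ok kappa) (bok : bandwidth_ok bw).
Hypotheses (n0 : (0 < n)%N) (m0 : (0 < n - p)%N).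

Let Om := Omega_hat kappa bw p X Rm.
Let T := Tstat Om X Rm r.
Let B := Rm *m invmx (X^T *m X).

(** Estimator and vector are separate arguments because they scale and converge differently; in the
    span case d is not R beta_hat of the point at which the estimator is taken. *)
Definition qf (O : option 'M[R]_q) (d : 'cV[R]_q) : R :=
  match O with
  | Some Oy => if Oy \in unitmx then (d^T *m invmx Oy *m d) 0 0 else 0
  | None => 0
  end.

Lemma TE y : T y = qf (Om y) (Rm *m beta_hat X y - r). Proof. by []. Qed.

Lemma NstarE y : ~ Nstar Om y <-> exists2 S, Om y = Some S & S \in unitmx.
Proof.
rewrite /Nstar /=; case: (Om y) => [S|]; last first.
  by split => [h|[S]//]; exfalso; exact: h.
split => [/negP/negPn u|[S' [<-] u]]; first by exists S.
by rewrite u.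
Qed.

Lemma BT : B^T = invmx (X^T *m X) *m Rm^T.
Proof. by rewrite /B trmx_mul trmx_inv trmx_mul trmxK. Qed.

Lemma OmE y : Om y = omega_of p kappa bw B B^T (score X y).
Proof. by rewrite /Om Omega_hatE BT. Qed.

Lemma Om_lin a y b : a != 0 -> Om (a *: y + X *m b) = omap ( *:%R (a ^+ 2)) (Om y).
Proof. by move=> a0; rewrite !OmE score_lin// omega_ofZ. Qed.

Lemma Nstar_lin (a : R) y b : a != 0 -> Nstar Om (a *: y + X *m b) <-> Nstar Om y.
Proof.
move=> a0; rewrite /Nstar /= Om_lin//; case: (Om y) => [S|] //=.
by rewrite unitmxZ_ne ?expf_neq0.
Qed.

Lemma qf_scale (a : R) S d : a != 0 -> qf (omap ( *:%R (a ^+ 2)) S) d = (a ^+ 2)^-1 * qf S d.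
Proof.
move=> a0; have a20 : a ^+ 2 != 0 by rewrite expf_neq0.
case: S => [S|] /=; last by rewrite mulr0.
rewrite unitmxZ_ne//; case: ifP => u; last by rewrite mulr0.
by rewrite invmxZ ?unitmxZ_ne// -scalemxAr -scalemxAl mxE.
Qed.

Lemma qf_scaler (a : R) S d : qf S (a *: d) = a ^+ 2 * qf S d.
Proof.
case: S => [S|] /=; last by rewrite mulr0.
case: ifP => u; last by rewrite mulr0.
by rewrite trmxZ -!scalemxAl -scalemxAr !mxE mulrA expr2.
Qed.

Lemma qf_gt0 y d : ~ Nstar Om y -> d != 0 -> 0 < qf (Om y) d.
Proof.
move=> /NstarE[S Oy u] d0; rewrite Oy /= u.
rewrite OmE in Oy; have [pS sS] := omega_of_posdef kok bok n0 m0 Oy u.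
exact: posdef_inv.
Qed.

Lemma beta_hat_cvg U (F : set_system U) (FF : Filter F) (y : U -> 'cV[R]_n) (y0 : 'cV[R]_n) :
  y x @[x --> F] --> y0 -> beta_hat X (y x) @[x --> F] --> beta_hat X y0.
Proof. by move=> yc; apply: cvg_mulmx => //; exact: cvg_cst. Qed.

Lemma score_cvg U (F : set_system U) (FF : Filter F) (y : U -> 'cV[R]_n) (y0 : 'cV[R]_n) :
  y x @[x --> F] --> y0 -> score X (y x) @[x --> F] --> score X y0.
Proof.
move=> yc; apply: cvg_mx => i j; rewrite /score mul_mx_diag mxE.
under eq_fun do rewrite mul_mx_diag mxE.
apply: cvgM; first exact: cvg_cst.
apply: cvg_mxE; apply: cvg_trmx; apply: cvg_mxD => //; apply: cvg_mxN.
by apply: cvg_mulmx; [exact: cvg_cst|exact: beta_hat_cvg].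
Qed.

Lemma qf_cvg U (F : set_system U) (FF : Filter F) (y : U -> 'cV[R]_n) (y0 : 'cV[R]_n)
    (d : U -> 'cV[R]_q) (d0 : 'cV[R]_q) :
  ~ Nstar Om y0 -> y x @[x --> F] --> y0 -> d x @[x --> F] --> d0 ->
  qf (Om (y x)) (d x) @[x --> F] --> qf (Om y0) d0.
Proof.
move=> /NstarE[S Oy u] yc dc.
have [W [nW cW]] := omega_of_cvg kok bok (score_cvg FF yc) (etrans (esym (OmE y0)) Oy).
have uW := @near_unitmx _ _ _ FF _ _ _ cW u.
have E : {near F, (fun x => ((d x)^T *m invmx (W x) *m d x) 0 0) =1 (fun x => qf (Om (y x)) (d x))}.
  by apply: filterS2 nW uW => x h1 h2; rewrite OmE h1 /= h2.
apply: cvg_trans (near_eq_cvg E) _; rewrite Oy /= u.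
apply: cvg_mxE; apply: cvg_mulmx => //; apply: cvg_mulmx; first exact: cvg_trmx.
exact: cvg_invmx.
Qed.

Definition nonsing_poly (y : 'cV[R]_n) : R := omega_poly p bw B (score X y).

Lemma nonsing_polyE y : ~ Nstar Om y <-> nonsing_poly y != 0.
Proof.
rewrite /nonsing_poly -(omega_polyP kok bok n0 m0) NstarE OmE.
case: (omega_of _ _ _ _ _ _) => [S|]; last by split=> [[]|].
by split=> [[S' [<-]]//|u]; exists S.
Qed.

Lemma nonsing_poly_polyf N (y : 'cV[R]_N -> 'cV[R]_n) : polymx y -> polyf (fun g => nonsing_poly (y g)).
Proof.
move=> py; apply: omega_polyf => i j; under eq_fun do rewrite /score mul_mx_diag mxE.
apply: polyfM; first exact: polyf_cst.
apply: polymxT; apply: polymxD => //; apply: polymxN; apply: polymxM; first exact: polymx_cst.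
by apply: polymxM => //; exact: polymx_cst.
Qed.

Lemma open_NstarC : open [set y | ~ Nstar Om y].
Proof.
have [c _] := nonsing_poly_polyf (@polymx_id R n).
rewrite openE => y /nonsing_polyE h; rewrite /interior.
have nz : \forall z \near y, nonsing_poly z != 0 by exact: (@near_neq0 R _ (nbhs y) _ _ _ (c y) h).
by apply: filterS nz => z /nonsing_polyE.
Qed.

(* T through the score direction only: by invariance, T (mu0 + a v) does not depend on mu0 in M0 nor on a <> 0. *)
Definition T0 (v : 'cV[R]_n) : R := qf (Om v) (Rm *m beta_hat X v).

Lemma T0E mu0 (a : R) v : M0 X Rm r mu0 -> a != 0 -> T (mu0 + a *: v) = T0 v.
Proof.
move=> [b [Rb ->]] a0; rewrite TE addrC Om_lin// beta_hat_lin// mulmxDr Rb addrK.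
by rewrite -scalemxAr qf_scaler qf_scale// mulrA divff ?mul1r// expf_neq0.
Qed.

Lemma T01 mu0 v : M0 X Rm r mu0 -> T (v + mu0) = T0 v.
Proof. by move=> h; rewrite addrC -[v in LHS]scale1r T0E// oner_neq0. Qed.

Lemma Rm_surj (v : 'cV[R]_q) : exists b, Rm *m b = v.
Proof.
have fR : row_full Rm^T by rewrite /row_full mxrank_tr rR.
have /submxP[D hD] : (v^T <= Rm^T)%MS by apply: submx_full.
by exists D^T; rewrite -[v]trmxK hD trmx_mul trmxK.
Qed.

Lemma M0_neq0 : exists mu0, M0 X Rm r mu0.
Proof. by have [b hb] := Rm_surj r; exists (X *m b), b. Qed.

Lemma T0Z (a : R) v : a != 0 -> T0 (a *: v) = T0 v.
Proof.
have [mu0 h0] := M0_neq0 => a0.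
by rewrite -(T0E v h0 a0) -[a *: v in RHS]scale1r T0E// oner_neq0.
Qed.

Lemma NstarZ (a : R) v : a != 0 -> ~ Nstar Om v -> ~ Nstar Om (a *: v).
Proof. by move=> a0 nv; rewrite -[a *: v]addr0 -(mulmx0 _ X) Nstar_lin. Qed.

Lemma T0_cvg U (F : set_system U) (FF : Filter F) (y : U -> 'cV[R]_n) (y0 : 'cV[R]_n) :
  ~ Nstar Om y0 -> y x @[x --> F] --> y0 -> T0 (y x) @[x --> F] --> T0 y0.
Proof.
move=> h yc; apply: qf_cvg => //.
by apply: cvg_mulmx; [exact: cvg_cst|exact: beta_hat_cvg].
Qed.

Lemma T_cvg U (F : set_system U) (FF : Filter F) (y : U -> 'cV[R]_n) (y0 : 'cV[R]_n) :
  ~ Nstar Om y0 -> y x @[x --> F] --> y0 -> T (y x) @[x --> F] --> T y0.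
Proof.
move=> h yc; apply: qf_cvg => //.
apply: cvg_mxD; last exact: cvg_cst.
by apply: cvg_mulmx; [exact: cvg_cst|exact: beta_hat_cvg].
Qed.

Section Crit.
Variable C : R.
Hypothesis C0 : 0 < C.
Let W := Wreg T C.

Lemma T_Nstar y : Nstar Om y -> T y = 0.
Proof. by rewrite /Nstar TE /=; case: (Om y) => [S|//] /= /negbTE ->. Qed.

Lemma open_Tlt : open [set y | ~ Nstar Om y /\ T y < C].
Proof.
rewrite openE => y [h1 h2]; rewrite /interior.
have n1 : \forall z \near y, ~ Nstar Om z by apply: open_nbhs_nbhs; split => //; exact: open_NstarC.
have tc : T z @[z --> y] --> T y by apply: (@T_cvg _ (nbhs y)) => //; exact: cvg_id.
have n2 : \forall z \near y, T z < C by exact: (@near_lt R _ (nbhs y) _ _ _ _ tc h2).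
by apply: filterS2 n1 n2 => z.
Qed.

Lemma open_Tgt : open [set y | ~ Nstar Om y /\ C < T y].
Proof.
rewrite openE => y [h1 h2]; rewrite /interior.
have n1 : \forall z \near y, ~ Nstar Om z by apply: open_nbhs_nbhs; split => //; exact: open_NstarC.
have tc : T z @[z --> y] --> T y by apply: (@T_cvg _ (nbhs y)) => //; exact: cvg_id.
have n2 : \forall z \near y, C < T z by exact: (@near_gt R _ (nbhs y) _ _ _ _ tc h2).
by apply: filterS2 n1 n2 => z.
Qed.

(** T is continuous only off N*. On N* it is 0 < C, so the region is the open complement of N* minus
    the open set where T < C. *)
Lemma measurable_W : measurable (W : set (bvec R n)).
Proof.
rewrite (_ : W = ([set y | ~ Nstar Om y] : set (bvec R n)) `\` [set y | ~ Nstar Om y /\ T y < C]).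
  by apply: measurableD; apply: open_meas; [exact: open_NstarC|exact: open_Tlt].
apply/seteqP; split=> y; rewrite /W /Wreg /=.
  move=> CT; split; first by move=> /T_Nstar T0'; move: CT; rewrite T0' leNgt C0.
  by move=> [_]; rewrite ltNge CT.
by move=> [h1 h2]; rewrite leNgt; apply/negP => h; apply: h2.
Qed.
End Crit.
End Stat.

Lemma sqr_div_gt (R : realType) (C Q : R) : 0 < C -> 0 < Q -> C < (1 + C / Q) ^+ 2 * Q.
Proof.
move=> C0 Q0; have -> : (1 + C / Q) ^+ 2 * Q = Q + C + C + C ^+ 2 / Q.
  by field; rewrite gt_eqF.
have : 0 < C ^+ 2 / Q by rewrite divr_gt0// exprn_gt0.
by move: (C ^+ 2 / Q) => x x0; lra.
Qed.

(** * Concentration along the AR(1) model *)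

Section Main.
Variables (R : realType) (k n q p : nat).
Local Notation N := n.+1.
Variables (X : 'M[R]_(N, k)) (Rm : 'M[R]_(q, k)) (r : 'cV[R]_q).
Variables (kappa : R -> R) (bw : @bandwidth R k) (Cm : set 'M[R]_N) (C : R).
Hypotheses (rX : \rank X = k) (rR : \rank Rm = q) (q0 : (0 < q)%N).
Hypotheses (kok : kernel_ok kappa) (bok : bandwidth_ok bw).
Hypotheses (m0 : (0 < N - p)%N).
Hypotheses (cov : covariance_model Cm) (ar : forall rho : R, -1 < rho < 1 -> Cm (Lambda rho)).
Hypothesis C0 : 0 < C.

Local Notation Om := (Omega_hat kappa bw p X Rm).
Local Notation T := (Tstat Om X Rm r).
Local Notation W := (Wreg T C).
Local Notation M0s := (M0 X Rm r).
Local Notation M1s := (M1 X Rm r).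
Local Notation t0 := (T0 p X Rm kappa bw).
Let n0 : (0 < N)%N := isT.
Let mW : measurable (W : set (bvec R N)).
Proof. exact: measurable_W. Qed.

Let t0E (mu0 : 'cV[R]_N) (a : R) (v : 'cV[R]_N) : M0s mu0 -> a != 0 -> T (mu0 + a *: v) = t0 v.
Proof. exact: T0E. Qed.
Let t01 (mu0 v : 'cV[R]_N) : M0s mu0 -> T (v + mu0) = t0 v.
Proof. exact: T01. Qed.
Let t0Z (a : R) (v : 'cV[R]_N) : a != 0 -> t0 (a *: v) = t0 v.
Proof. exact: (@T0Z R k N q p X Rm r kappa bw). Qed.

Lemma cov_scale (s2 : R) S : 0 < s2 -> Cm S -> (s2 *: S)^T = s2 *: S /\ posdef (s2 *: S).
Proof.
move=> s0 CS; have [_ [h _]] := cov; have [sS pS] := h S CS.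
by split; [rewrite trmxZ sS|exact: posdef_scale].
Qed.

Lemma sup_le1 (mu : 'cV[R]_N) (s2 : R) : 0 < s2 -> (supSigma Cm mu s2 W <= 1)%E.
Proof.
move=> s0; apply: ge_ereal_sup => _ [S CS <-]; have [h1 h2] := cov_scale s0 CS.
exact: gauss_prob_le1.
Qed.

Lemma size_le1 : (test_size M0s Cm W <= 1)%E.
Proof.
apply: ge_ereal_sup => _ [mu [s2 [S [_ [s0 [CS ->]]]]]]; have [h1 h2] := cov_scale s0 CS.
exact: gauss_prob_le1.
Qed.

Lemma size_ge_sup (mu : 'cV[R]_N) (s2 : R) : M0s mu -> 0 < s2 -> (supSigma Cm mu s2 W <= test_size M0s Cm W)%E.
Proof.
move=> hmu s0; apply: ge_ereal_sup => _ [S CS <-]; apply: ereal_sup_ubound.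
by exists mu, s2, S.
Qed.

Lemma inf_ge0 (mu : 'cV[R]_N) (s2 : R) : (0 <= infSigma Cm mu s2 W)%E.
Proof. by apply: le_ereal_inf_tmp => _ [S CS <-]; exact: gauss_prob_ge0. Qed.

Lemma Rm_image_neq0 : exists b : 'cV[R]_k, Rm *m b != 0.
Proof.
have [b hb] := Rm_surj rR (const_mx 1); exists b; rewrite hb.
by apply/eqP => /matrixP/(_ (Ordinal q0) 0)/eqP; rewrite !mxE oner_eq0.
Qed.

Lemma M1_shift (mu0 : 'cV[R]_N) (t : R) (b : 'cV[R]_k) : M0s mu0 -> Rm *m b != 0 -> t != 0 -> M1s (mu0 + t *: (X *m b)).
Proof.
have bX z : beta_hat X (X *m z) = z.
  by rewrite -[X *m z]add0r -(scale0r (0 : 'cV[R]_N)) beta_hat_lin// scale0r add0r.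
move=> [b0 [hr ->]] hb t0; rewrite scalemxAr -mulmxDr; split; first by exists (b0 + t *: b).
move=> [b1 [h1 /(congr1 (beta_hat X))]]; rewrite !bX => E; move: h1.
rewrite -E mulmxDr hr -scalemxAr => /eqP; rewrite addrC -subr_eq0 addrK scaler_eq0.
by rewrite (negbTE hb) (negbTE t0).
Qed.

Section Direction.
Variable s : R.
Hypothesis s1 : s ^+ 2 = 1.

Let L j : 'M[R]_N := ar_chol N (ar_rho s j) (ar_eps R j).
Let Lam j : 'M[R]_N := Lambda (ar_rho s j).

Lemma Cm_Lam j : Cm (Lam j). Proof. by apply: ar; exact: ar_rho_lt1. Qed.

Lemma gauss_L (mu : 'cV[R]_N) (s2 : R) j : 0 < s2 -> gauss_prob mu (s2 *: Lam j) W =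
  Pn R N [set g | W (mu + Num.sqrt s2 *: (L j *m (g : 'cV[R]_N)))].
Proof. by move=> s0; apply: gauss_prob_ar => //; [exact: ar_eps_neq0|exact: ar_eps2]. Qed.

Lemma measurable_pre (mu : 'cV[R]_N) (a : R) j :
  measurable ([set g | W (mu + a *: (L j *m (g : 'cV[R]_N)))] : set (bvec R N)).
Proof.
rewrite -[X in measurable X]setTI.
have -> : [set g | W (mu + a *: (L j *m (g : 'cV[R]_N)))] = (fun g : bvec R N => (mu + (a *: L j) *m (g : 'cV[R]_N) : bvec R N)) @^-1` W.
  by apply/seteqP; split=> g /=; rewrite -scalemxAl.
exact: (continuous_measurable_map (@affine_continuous _ _ _ (a *: L j) mu)).
Qed.

Lemma supSigma_ge_eventually (mu : 'cV[R]_N) (s2 : R) (A : set (bvec R N)) : 0 < s2 -> measurable A ->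
  (forall g, A g -> \forall j \near \oo, W (mu + Num.sqrt s2 *: (L j *m (g : 'cV[R]_N)))) ->
  (Pn R N A <= supSigma Cm mu s2 W)%E.
Proof.
move=> s0 mA AW; apply: (@le_measure_eventually _ _ _ (Pn R N) _ _ _ _ mA AW).
  by move=> j; exact: measurable_pre.
move=> j; have := gauss_L mu j s0 => /= <-; apply: ereal_sup_ubound.
by exists (Lam j) => //; exact: Cm_Lam.
Qed.

(** Fatou on the complements, each of probability at most 1 - c. Stated for a lower bound c, with
    mean and variance free to vary with j, it serves every infimum of part 2. *)
Lemma le0_eventually_not_W (mu : nat -> 'cV[R]_N) (s2 : nat -> R) (A : set (bvec R N)) (c : \bar R) :
  (forall j, 0 < s2 j) -> measurable A -> Pn R N A = 1%E ->
  (forall g, A g -> \forall j \near \oo, ~ W (mu j + Num.sqrt (s2 j) *: (L j *m (g : 'cV[R]_N)))) ->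
  (forall j, (c <= gauss_prob (mu j) (s2 j *: Lam j) W)%E) -> (c <= 0)%E.
Proof.
move=> s0 mA A1 AW cP.
have c1 : (c <= 1)%E.
  apply: le_trans (cP 0%N) _; rewrite gauss_L//; apply: probability_le1; exact: measurable_pre.
have : (Pn R N A <= 1 - c)%E.
  apply: (@le_measure_eventually _ _ _ (Pn R N)
    (fun j => ~` [set g | W (mu j + Num.sqrt (s2 j) *: (L j *m (g : 'cV[R]_N)))])) => //.
    by move=> j; apply: measurableC; exact: measurable_pre.
  move=> j; have P1 := @probability_setC _ _ _ (Pn R N) _ (measurable_pre (mu j) (Num.sqrt (s2 j)) j).
  have P2 : (1 - gauss_prob (mu j) (s2 j *: Lam j) W <= 1 - c)%E by rewrite leeB.
  by move: P2; rewrite gauss_L// -P1.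
rewrite A1; case: c c1 {cP} => [c| |]; [|by rewrite leye_eq|by rewrite leNye].
by rewrite !lee_fin => _; rewrite lerBrDl gerDr.
Qed.

Lemma L_cvg (g : 'cV[R]_N) : (L j *m g) @[j --> \oo] --> g 0 0 *: pow_vec s N.
Proof.
under eq_fun do rewrite /L (ar_chol_rem s).
have h : (g 0 0 *: pow_vec s N + ar_eps R j *: (ar_rem s N j *m g)) @[j --> \oo] -->
    g 0 0 *: pow_vec s N + 0 *: (ar_lim s N *m g).
  apply: cvg_mxD; first exact: cvg_cst.
  apply: cvg_mxZ; first exact: ar_eps_cvg.
  by apply: cvg_mulmx; [exact: ar_rem_cvg|exact: cvg_cst].
by rewrite scale0r addr0 in h.
Qed.

Let G0 : set (bvec R N) := [set g | (g : 'cV[R]_N) 0 0 <> 0].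

Lemma G0_prob : measurable G0 /\ Pn R N G0 = 1%E.
Proof.
have [cf lf] := @polyf_coord R N 0.
have mz := measurable_zeros cf.
have -> : G0 = ~` [set g | (g : 'cV[R]_N) 0 0 = 0] by apply/seteqP; split.
split; first exact: measurableC.
rewrite probability_setC// Pn_null ?sube0//.
by exists (\col_i 1); rewrite mxE oner_neq0.
Qed.

Variables (c : R) (e : 'cV[R]_N).
Hypotheses (c1 : c ^+ 2 = 1) (eE : e = c *: pow_vec s N).

Let c0 : c != 0.
Proof. by apply: contra_eqN c1 => /eqP ->; rewrite expr0n/= eq_sym oner_neq0. Qed.

(** * Concentration at a direction off N* *)

Section Nonsingular.
Hypothesis eN : ~ Nstar Om e.

Let ge_N (a : R) : a != 0 -> ~ Nstar Om (a *: pow_vec s N).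
Proof.
move=> a0; have -> : a *: pow_vec s N = (a / c) *: e by rewrite eE scalerA divfK.
by apply: NstarZ => //; rewrite mulf_neq0// invr_eq0.
Qed.

Let t0_es (a : R) : a != 0 -> t0 (a *: pow_vec s N) = t0 e.
Proof. by move=> a0; rewrite eE !t0Z. Qed.

Lemma t0_L_cvg (g : 'cV[R]_N) (d : nat -> 'cV[R]_N) : g 0 0 <> 0 -> d j @[j --> \oo] --> (0 : 'cV[R]_N) ->
  t0 (d j + L j *m g) @[j --> \oo] --> t0 e.
Proof.
move=> /eqP g0 d0; have ct := T0_cvg kok bok _ (ge_N g0); rewrite (t0_es g0) in ct; apply: ct.
have h : (d j + L j *m g) @[j --> \oo] --> 0 + g 0 0 *: pow_vec s N by apply: cvg_mxD => //; exact: L_cvg.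
by rewrite add0r in h.
Qed.

Lemma supSigma_eq1_of_gt (mu0 : 'cV[R]_N) (s2 : R) : M0s mu0 -> 0 < s2 -> C < t0 e -> supSigma Cm mu0 s2 W = 1%E.
Proof.
move=> hmu s0 Ct; apply/eqP; rewrite eq_le sup_le1//=.
have [mG G1] := G0_prob; rewrite -G1; apply: supSigma_ge_eventually => // g gg.
have d0 : (fun _ : nat => 0 : 'cV[R]_N) j @[j --> \oo] --> (0 : 'cV[R]_N) by exact: cvg_cst.
apply: filterS (near_gt _ (t0_L_cvg gg d0) Ct) => j; rewrite add0r => h.
by rewrite /W /Wreg /= t0E ?ltW// sqrtr_eq0 -ltNge.
Qed.

(** The offset of the mean from M_0 is measured in standard deviations: sigma_j factors out of
    offset and noise, and scale invariance removes it, so only d j -> 0 matters. *)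
Lemma inf_gauss_prob_le0 (mu0 : 'cV[R]_N) (s2 : nat -> R) (d : nat -> 'cV[R]_N) (x : \bar R) : M0s mu0 -> (forall j, 0 < s2 j) ->
  d j @[j --> \oo] --> (0 : 'cV[R]_N) -> t0 e < C ->
  (forall j, (x <= gauss_prob (mu0 + Num.sqrt (s2 j) *: d j) (s2 j *: Lam j) W)%E) -> (x <= 0)%E.
Proof.
move=> hmu s0 d0 tC; have [mG G1] := G0_prob.
apply: (@le0_eventually_not_W (fun j => mu0 + Num.sqrt (s2 j) *: d j) s2 G0) => // g gg.
apply: filterS (near_lt _ (t0_L_cvg gg d0) tC) => j h.
rewrite /W /Wreg /= -addrA -scalerDr t0E//; first by apply/negP; rewrite -ltNge.
by rewrite sqrtr_eq0 -ltNge.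
Qed.

(* The rejection region has nonempty interior: T (e + X b) exceeds C for suitable b. *)
Lemma size_gt0 : (0 < test_size M0s Cm W)%E.
Proof.
have [mu0 hmu] := M0_neq0 X r rR.
apply: lt_le_trans (size_ge_sup hmu ltr01).
apply: (@lt_le_trans _ _ (gauss_prob mu0 (1 *: Lam 0) W)); last first.
  by apply: ereal_sup_ubound; exists (Lam 0%N) => //; exact: Cm_Lam.
rewrite gauss_L// sqrtr1.
pose U : set 'cV[R]_N := [set y | ~ Nstar Om y /\ C < T y].
have oU : open U by exact: open_Tgt.
have [b hb] : exists b, U (e + X *m b).
  have [d1 d1n] : exists d : 'cV[R]_q, d != 0.
    exists (const_mx 1); apply/eqP => /matrixP/(_ (Ordinal q0) 0); rewrite !mxE => /eqP.
    by rewrite oner_eq0.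
  have Q0 : 0 < qf (Om e) d1 by exact: qf_gt0.
  pose Q := qf (Om e) d1; pose t := 1 + C / Q.
  (* This b makes the numerator vector at e + X b equal to t d1, while Omega stays that of e; T is
     then t^2 Q > C. *)
  have [b hb] := Rm_surj rR (t *: d1 - (Rm *m beta_hat X e - r)).
  exists b.
  have Oe : Om (e + X *m b) = Om e.
    have := Om_lin p Rm kappa bw rX e b (oner_neq0 R).
    rewrite scale1r => ->; case: (Om e) => [S|] //=.
    by rewrite expr1n scale1r.
  split.
    rewrite -[e]scale1r; apply/(Nstar_lin p Rm kappa bw rX e b (oner_neq0 R)) => //; exact: eN.
  have -> : T (e + X *m b) = qf (Om e) (Rm *m beta_hat X e + Rm *m b - r).
    have bE : beta_hat X (e + X *m b) = beta_hat X e + b.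
      by have := beta_hat_lin 1 e b rX; rewrite !scale1r.
    by rewrite TE Oe bE mulmxDr.
  rewrite hb.
  have -> : Rm *m beta_hat X e + (t *: d1 - (Rm *m beta_hat X e - r)) - r = t *: d1.
    by rewrite addrCA opprB [Rm *m _ + _]addrC subrK addrK.
  by rewrite qf_scaler; exact: sqr_div_gt.
have LU : L 0 \in unitmx.
  rewrite unitmxE unitfE det_trig; last exact: ar_chol_trig.
  by rewrite prodf_seq_neq0; apply/allP => i _; rewrite ar_chol_diag// ar_eps_neq0.
apply: (@lt_le_trans _ _ (Pn R N [set g | U (mu0 + L 0 *m (g : 'cV[R]_N))])).
  apply: Pn_open_gt0.
    by have := @affine_continuous R _ _ (L 0) mu0; move/continuousP; apply.
  have E z : mu0 + L 0 *m (invmx (L 0) *m (z - mu0)) = z by rewrite mulKVmx// addrC subrK.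
  by exists (invmx (L 0) *m (e + X *m b - mu0)); rewrite /= E; exact: hb.
apply: le_measure; rewrite ?inE.
- apply: open_meas; have := @affine_continuous R _ _ (L 0) mu0; move/continuousP; apply; exact: oU.
- exact: (measurable_pre mu0 1 0).
- by move=> g [_ h]; rewrite /= scale1r /W /Wreg /=; exact: ltW.
Qed.

Lemma size1_of_gt : C < t0 e ->
  (forall mu0 s2, M0s mu0 -> 0 < s2 -> supSigma Cm mu0 s2 W = 1%E) /\ test_size M0s Cm W = 1%E.
Proof.
move=> Ct; split=> [mu0 s2 hmu s0|]; first exact: supSigma_eq1_of_gt.
apply/eqP; rewrite eq_le size_le1/=; have [mu0 hmu] := M0_neq0 X r rR.
by rewrite -(supSigma_eq1_of_gt hmu ltr01 Ct) size_ge_sup.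
Qed.

Lemma biased_of_lt : t0 e < C ->
  (forall mu0 s2, M0s mu0 -> 0 < s2 -> infSigma Cm mu0 s2 W = 0%E) /\
  (forall s2, 0 < s2 -> ereal_inf [set infSigma Cm mu1 s2 W | mu1 in M1s] = 0%E) /\
  biased M0s M1s Cm W /\
  (forall mu1, M1s mu1 -> ereal_inf [set infSigma Cm mu1 s2 W | s2 in [set s : R | 0 < s]] = 0%E) /\
  infimal_power M1s Cm W = 0%E.
Proof.
move=> tC; have [mu0 hmu] := M0_neq0 X r rR; have [b hb] := Rm_image_neq0.
(* With standard deviation j + 1 the fixed offset mu1 - mu0 becomes (mu1 - mu0) / (j + 1) in that
   unit. *)
have p4 (x : \bar R) mu1 : M1s mu1 -> (forall s2 S, 0 < s2 -> Cm S -> (x <= gauss_prob mu1 (s2 *: S) W)%E) -> (x <= 0)%E.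
  move=> h1 xP; apply: (inf_gauss_prob_le0 (s2 := fun j => j.+1%:R ^+ 2) (d := fun j => ar_t R j *: (mu1 - mu0)) hmu) => //.
  - have h : (ar_t R j *: (mu1 - mu0)) @[j --> \oo] --> 0 *: (mu1 - mu0).
      by apply: cvg_mxZ; [exact: ar_t_cvg|exact: cvg_cst].
    by rewrite scale0r in h.
  - move=> j; rewrite sqrtr_sqr ger0_norm ?ler0n// scalerA /ar_t divff ?pnatr_eq0// scale1r addrC subrK.
    by apply: xP; [rewrite exprn_gt0// ltr0n|exact: Cm_Lam].
have ip : infimal_power M1s Cm W = 0%E.
  apply/eqP; rewrite eq_le; apply/andP; split.
    apply: (p4 _ _ (M1_shift hmu hb (oner_neq0 R))) => s2 S s0 CS; apply: ereal_inf_lbound.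
    by exists (mu0 + 1 *: (X *m b)), s2, S; split=> //; apply: M1_shift => //; exact: oner_neq0.
  by apply: le_ereal_inf_tmp => _ [mu [s2 [S [_ [s0 [CS ->]]]]]]; exact: gauss_prob_ge0.
split; first (move=> mu s2 hm s0; apply/eqP; rewrite eq_le inf_ge0 andbT).
  apply: (inf_gauss_prob_le0 (s2 := fun=> s2) (d := fun=> 0) hm) => //; first exact: cvg_cst.
  by move=> j; rewrite scaler0 addr0; apply: ereal_inf_lbound; exists (Lam j) => //; exact: Cm_Lam.
split.
  move=> s2 s0; have s20 : Num.sqrt s2 != 0 by rewrite sqrtr_eq0 -ltNge.
  apply/eqP; rewrite eq_le; apply/andP; split; last first.
    by apply: le_ereal_inf_tmp => _ [mu _ <-]; exact: inf_ge0.
  (* With sigma fixed, the mean slides to mu0 along X b, remaining in M_1 because R b is nonzero. *)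
  apply: (inf_gauss_prob_le0 (s2 := fun=> s2) (d := fun j => ar_t R j *: (X *m b)) hmu) => //.
    have h : (ar_t R j *: (X *m b)) @[j --> \oo] --> 0 *: (X *m b).
      by apply: cvg_mxZ; [exact: ar_t_cvg|exact: cvg_cst].
    by rewrite scale0r in h.
  move=> j; rewrite scalerA; set mu := _ + _.
  apply: (@le_trans _ _ (infSigma Cm mu s2 W)); apply: ereal_inf_lbound.
    exists mu => //; apply: M1_shift => //; rewrite mulf_neq0// gt_eqF//; exact: ar_t_gt0.
  by exists (Lam j) => //; exact: Cm_Lam.
split; first by rewrite /biased ip; exact: size_gt0.
split=> // mu1 h1; apply/eqP; rewrite eq_le; apply/andP; split; last first.
  by apply: le_ereal_inf_tmp => _ [s2 _ <-]; exact: inf_ge0.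
apply: (p4 _ _ h1) => s2 S s0 CS; apply: (@le_trans _ _ (infSigma Cm mu1 s2 W)); apply: ereal_inf_lbound.
  by exists s2.
by exists S.
Qed.
End Nonsingular.

(** * The boundary case: T equal to C at the limit direction *)

Section Boundary.
Variable mus : 'cV[R]_N.
Hypotheses (hs : M0s mus) (Ta : T (e + mus) = C) (dT : differentiable T (e + mus)).

Let l : 'cV[R]_N -> R := 'd T (e + mus).

Let lZ a v : l (a *: v) = a * l v. Proof. by rewrite /l linearZ. Qed.
Let lB u v : l (u - v) = l u - l v. Proof. by rewrite /l linearB. Qed.

Let quot (w : 'cV[R]_N) (eps : nat -> R) (u : nat -> 'cV[R]_N) : eps j @[j --> \oo] --> (0 : R) ->
  (forall j, eps j != 0) -> u j @[j --> \oo] --> w ->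
  ((t0 (e + eps j *: u j) - C) / eps j) @[j --> \oo] --> l w.
Proof.
move=> e0 en uw; have h := differentiable_seq dT e0 en uw.
have E j : T (e + mus + eps j *: u j) - T (e + mus) = t0 (e + eps j *: u j) - C by rewrite Ta addrAC t01.
by move: h; under eq_fun do rewrite E.
Qed.

Let t0e : t0 e = C. Proof. by rewrite -Ta t01. Qed.

Let at_neq0 j : ar_t R j != 0. Proof. by rewrite gt_eqF// ar_t_gt0. Qed.

(** By scale invariance [t0] is constant along the ray of e. *)
Let l_e : l e = 0.
Proof.
have ce : (fun _ : nat => e) j @[j --> \oo] --> e by exact: cvg_cst.
have h := quot (@ar_t_cvg R) at_neq0 ce.
have E j : (t0 (e + ar_t R j *: e) - C) / ar_t R j = 0.
  have -> : e + ar_t R j *: e = (1 + ar_t R j) *: e by rewrite scalerDl scale1r.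
  rewrite t0Z ?t0e ?subrr ?mul0r//.
  by rewrite gt_eqF// addr_gt0// ar_t_gt0.
move: h; under eq_fun do rewrite E.
by move=> h; have <- := cvg_lim (@norm_hausdorff _ _) h; apply: cvg_lim => //; exact: cvg_cst.
Qed.

Let l_X b : Rm *m b = Rm *m beta_hat X e -> l (X *m b) = 2 * C.
Proof.
move=> hb; have cX : (fun _ : nat => X *m b) j @[j --> \oo] --> X *m b by exact: cvg_cst.
have h := quot (@ar_t_cvg R) at_neq0 cX.
(* R beta_hat is multiplied by 1 + t and Omega is unchanged; ((1 + t)^2 C - C) / t = (2 + t) C. *)
have E j : (t0 (e + ar_t R j *: (X *m b)) - C) / ar_t R j = (2 + ar_t R j) * C.
  have -> : t0 (e + ar_t R j *: (X *m b)) = (1 + ar_t R j) ^+ 2 * C.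
    rewrite -t0e /T0 -qf_scaler scalerDl scale1r -hb.
    have /= h1 := Om_lin p Rm kappa bw rX e (ar_t R j *: b) (oner_neq0 R).
    have h2 := beta_hat_lin 1 e (ar_t R j *: b) rX.
    move: h1 h2; rewrite !scale1r -scalemxAr => -> ->.
    by rewrite qf_scale ?oner_neq0// expr1n invr1 mul1r mulmxDr -scalemxAr hb.
  have := at_neq0 j; move: (ar_t R j) => t tn; by field.
move: h; under eq_fun do rewrite E.
move=> h; have <- := cvg_lim (@norm_hausdorff _ _) h; apply: cvg_lim => //.
have h2 : ((2 + ar_t R j) * C) @[j --> \oo] --> (2 + 0) * C.
  by apply: cvgM; [apply: cvgD; [exact: cvg_cst|exact: ar_t_cvg]|exact: cvg_cst].
by rewrite addr0 in h2.
Qed.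

(* f g has the sign of the first-order term of T - C at e + mus along the rescaled sample. *)
Let f (g : 'cV[R]_N) := c * g 0 0 * l (ar_lim s N *m g).

Let polyf_f : polyf f.
Proof.
have E v : l v = \sum_i v i 0 * l (delta_mx i 0).
  rewrite {1}[v]matrix_sum_delta /l linear_sum; apply: eq_bigr => i _.
  by rewrite big_ord1 linearZ.
apply: polyfM; first by apply: polyfM; [exact: polyf_cst|exact: polyf_coord].
under eq_fun do rewrite E.
apply: polyf_sum => i; apply: polyfM; last exact: polyf_cst.
by apply: polymxM; [exact: polymx_cst|exact: polymx_id].
Qed.

Let f_null : Pn R N [set g | f g = 0] = 0%E.
Proof.
have [cf lf] := polyf_f; apply: Pn_null => //.
have [b hb] := Rm_surj rR (Rm *m beta_hat X e).
(* The range of [ar_lim] requires a zero first coordinate. Subtracting a multiple of e achieves this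
   without changing l, since l e = 0. *)
pose y := X *m b - (X *m b) 0 0 *: pow_vec s N.
have [|g g0 hg] := @ar_lim_surj R s n y; first by rewrite !mxE expr0 mulr1 subrr.
exists g; rewrite /f g0 hg /y lB lZ l_X//.
have -> : pow_vec s N = c *: e by rewrite eE scalerA -expr2 c1 scale1r.
by rewrite lZ l_e !mulr0 subr0 mulr1 !mulf_neq0// ?pnatr_eq0// gt_eqF.
Qed.

(** Flipping the sign of g_0 negates the factor g_0 and leaves [ar_lim] applied to g unchanged, its
    first column being 0. *)
Lemma Pn_derivative_half : Pn R N [set g | 0 < f g] = (1 / 2)%:E.
Proof.
pose d : 'rV[R]_N := \row_i (if i == 0 then -1 else 1).
have d2 i : d 0 i * d 0 i = 1 by rewrite mxE; case: ifP; rewrite ?mulrNN mulr1.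
apply: (@Pn_half R N (diag_mx d)).
- exact: diag_mx_is_trig.
- move=> i; rewrite mxE eqxx mulr1n; apply: contra_eqN (d2 i) => /eqP ->.
  by rewrite mulr0 eq_sym oner_neq0.
- rewrite tr_diag_mx mulmx_diag -[RHS]diag_const_mx; congr diag_mx.
  by apply/rowP => i; rewrite mxE d2 mxE.
- by have [] := polyf_f.
- move=> g; rewrite /f mulmxA.
  have -> : ar_lim s N *m diag_mx d = ar_lim s N.
    apply/matrixP => i j; rewrite mul_mx_diag !mxE -(inj_eq val_inj)/=.
    by case: ifP => _; rewrite ?mul0r ?mulr1.
  by rewrite mul_diag_mx mxE [d 0 0]mxE eqxx mulN1r mulrN mulNr.
- exact: f_null.
Qed.

Let ae_gt0 j : 0 < ar_eps R j.
Proof. by rewrite /ar_eps !mulr_gt0 ?invr_gt0 ?ar_t_gt0// ltr_pwDl// sqr_ge0. Qed.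

Lemma supSigma_ge_half (mu0 : 'cV[R]_N) (s2 : R) : M0s mu0 -> 0 < s2 -> ((1 / 2)%:E <= supSigma Cm mu0 s2 W)%E.
Proof.
move=> hmu s0; rewrite -Pn_derivative_half; apply: supSigma_ge_eventually => //.
  have [cf _] := polyf_f; apply: open_meas.
  rewrite (_ : [set g | _] = f @^-1` [set x | 0 < x])//; apply: open_comp; last exact: open_gt.
  by move=> x _; exact: cf.
move=> g fg; have g0 : g 0 0 != 0.
  by apply: contraTneq fg => h; rewrite /= /f h mulr0 mul0r ltxx.
(* Multiplying the sample by c / g_0 makes its leading part exactly e, so T is expanded at the point
   where it is differentiable. *)
have uw : ((c / g 0 0) *: (ar_rem s N j *m g)) @[j --> \oo] --> (c / g 0 0) *: (ar_lim s N *m g).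
  apply: cvg_mxZ; first exact: cvg_cst.
  by apply: cvg_mulmx; [exact: ar_rem_cvg|exact: cvg_cst].
have h := quot (@ar_eps_cvg R) (fun j => lt0r_neq0 (ae_gt0 j)) uw.
have lpos : 0 < l ((c / g 0 0) *: (ar_lim s N *m g)).
  have -> : l ((c / g 0 0) *: (ar_lim s N *m g)) = f g / g 0 0 ^+ 2.
    by rewrite lZ /f; move: (l _) g0 => z; move: (g 0 0) => y y0; field.
  by rewrite divr_gt0// exprn_even_gt0.
apply: filterS (near_gt _ h lpos) => j; rewrite pmulr_lgt0 ?invr_gt0// subr_gt0 => Cj.
rewrite /W /Wreg /= t0E//; last by rewrite sqrtr_eq0 -ltNge.
rewrite /L (ar_chol_rem s) -(@t0Z (c / g 0 0)); last by rewrite mulf_neq0// invr_eq0.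
rewrite scalerDr !scalerA divfK// -eE mulrC -scalerA; exact: ltW.
Qed.
End Boundary.

(** * The case of a limit direction inside span(X) *)

Section Span.
Variables (be : 'cV[R]_k) (y0 : 'cV[R]_N).
Hypotheses (esX : pow_vec s N = X *m be) (Rbe : Rm *m be != 0) (Ny0 : ~ Nstar Om y0).

Lemma supSigma_eq1_of_span (mu0 : 'cV[R]_N) (s2 : R) : M0s mu0 -> 0 < s2 -> supSigma Cm mu0 s2 W = 1%E.
Proof.
move=> hmu s0; apply/eqP; rewrite eq_le sup_le1//=.
pose f (g : 'cV[R]_N) := g 0 0 * nonsing_poly p X Rm bw (ar_lim s N *m g).
have [cf lf] : polyf f.
  apply: polyfM; first exact: polyf_coord.
  by apply: nonsing_poly_polyf; apply: polymxM; [exact: polymx_cst|exact: polymx_id].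
have mf := measurable_zeros cf.
have f0 : Pn R N [set g | f g = 0] = 0%E.
  (* A shift of y0 within span(X) cancels its first coordinate, as [ar_lim_surj] demands, and keeps
     it off N*. *)
  apply: Pn_null => //; pose y := 1 *: y0 + X *m (- y0 0 0 *: be).
  have [|g g0 hg] := @ar_lim_surj R s n y.
    by rewrite /y -scalemxAr -esX !mxE expr0 mulr1 mul1r subrr.
  exists g; rewrite /f g0 hg mul1r; apply/(nonsing_polyE X Rm kok bok n0 m0).
  by rewrite /y Nstar_lin// oner_neq0.
have <- : Pn R N (~` [set g | f g = 0]) = 1%E by rewrite probability_setC// f0 sube0.
apply: supSigma_ge_eventually => //; first exact: measurableC.
move=> g /eqP; rewrite mulf_eq0 negb_or => /andP[g0 /(nonsing_polyE X Rm kok bok n0 m0) gN].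
have dn : Rm *m (g 0 0 *: be) != 0 by rewrite -scalemxAr scaler_eq0 negb_or g0.
have Qp := qf_gt0 kok bok n0 m0 gN dn.
have wc : (ar_rem s N j *m g) @[j --> \oo] --> ar_lim s N *m g.
  by apply: cvg_mulmx; [exact: ar_rem_cvg|exact: cvg_cst].
have dc : (Rm *m (ar_eps R j *: beta_hat X (ar_rem s N j *m g) + g 0 0 *: be)) @[j --> \oo] -->
    Rm *m (g 0 0 *: be).
  apply: cvg_mulmx; first exact: cvg_cst.
  have h : (ar_eps R j *: beta_hat X (ar_rem s N j *m g) + g 0 0 *: be) @[j --> \oo] -->
     0 *: beta_hat X (ar_lim s N *m g) + g 0 0 *: be.
    apply: cvg_mxD; last exact: cvg_cst.
    by apply: cvg_mxZ; [exact: ar_eps_cvg|exact: beta_hat_cvg].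
  by rewrite scale0r add0r in h.
have qc := qf_cvg kok bok eventually_filter gN wc dc.
have ec : (C * ar_eps R j ^+ 2) @[j --> \oo] --> (0 : R).
  have h : (C * (ar_eps R j * ar_eps R j)) @[j --> \oo] --> C * (0 * 0).
    by apply: cvgM; [exact: cvg_cst|apply: cvgM; exact: ar_eps_cvg].
  by rewrite mulr0 mulr0 in h.
have cc : (qf (Om (ar_rem s N j *m g)) (Rm *m (ar_eps R j *: beta_hat X (ar_rem s N j *m g) + g 0 0 *: be)) -
    C * ar_eps R j ^+ 2) @[j --> \oo] --> qf (Om (ar_lim s N *m g)) (Rm *m (g 0 0 *: be)) - 0.
  by apply: cvgB.
rewrite subr0 in cc.
apply: filterS (near_gt _ cc Qp) => j; rewrite subr_gt0 => Cj.
rewrite /W /Wreg /= t0E//; last by rewrite sqrtr_eq0 -ltNge.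
have en := ar_eps_neq0 R j.
have -> : L j *m (g : 'cV[R]_N) = ar_eps R j *: (ar_rem s N j *m (g : 'cV[R]_N)) + X *m (g 0 0 *: be).
  by rewrite /L (ar_chol_rem s) esX addrC -scalemxAr.
(* The span part leaves Omega and eps w scales it by eps^2, so T >= C reads qf >= C eps^2. *)
rewrite /T0 Om_lin// beta_hat_lin// qf_scale//.
rewrite mulrC ler_pdivlMr ?exprn_even_gt0//; exact: ltW.
Qed.
End Span.
End Direction.
End Main.

Theorem theorem4p1 (R : realType) (n k q : nat)
  (X : 'M[R]_(n, k)) (Rm : 'M[R]_(q, k)) (r : 'cV[R]_q)
  (kappa : R -> R) (bw : bandwidth k) (p : nat)
  (Cm : set 'M[R]_n) (C : R) :
  (2 < n)%N -> (1 <= k)%N -> (k < n)%N ->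
  \rank X = k ->
  (1 <= q)%N -> \rank Rm = q ->
  @assumption_A R n k kappa bw p ->
  covariance_model Cm ->
  (forall rho : R, -1 < rho < 1 -> Cm (Lambda rho)) ->
  0 < C ->
  let Om := Omega_hat kappa bw p X Rm in
  let T := Tstat Om X Rm r in
  let W := Wreg T C in
  let M0s := M0 X Rm r in
  let M1s := M1 X Rm r in
  (* part 1 *)
  (forall e : 'cV[R]_n, e = e_plus \/ e = e_minus -> ~ Nstar Om e ->
     (exists mu0s, M0s mu0s /\ C < T (e + mu0s)) ->
     (forall mu0s, M0s mu0s -> C < T (e + mu0s)) /\
     (forall mu0 s2, M0s mu0 -> 0 < s2 -> supSigma Cm mu0 s2 W = 1%E) /\
     test_size M0s Cm W = 1%E) /\
  (* part 2 *)
  (forall e : 'cV[R]_n, e = e_plus \/ e = e_minus -> ~ Nstar Om e ->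
     (exists mu0s, M0s mu0s /\ T (e + mu0s) < C) ->
     (forall mu0s, M0s mu0s -> T (e + mu0s) < C) /\
     (forall mu0 s2, M0s mu0 -> 0 < s2 -> infSigma Cm mu0 s2 W = 0%E) /\
     (forall s2, 0 < s2 ->
        ereal_inf [set infSigma Cm mu1 s2 W | mu1 in M1s] = 0%E) /\
     biased M0s M1s Cm W /\
     (forall mu1, M1s mu1 ->
        ereal_inf [set infSigma Cm mu1 s2 W | s2 in [set s : R | 0 < s]] = 0%E) /\
     infimal_power M1s Cm W = 0%E) /\
  (* part 3 *)
  (forall e : 'cV[R]_n, e = e_plus \/ e = e_minus -> ~ Nstar Om e ->
     (exists mu0s, M0s mu0s /\ T (e + mu0s) = C /\ differentiable T (e + mu0s)) ->
     (forall mu0s, M0s mu0s -> T (e + mu0s) = C /\ differentiable T (e + mu0s)) /\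
     (forall mu0 s2, M0s mu0 -> 0 < s2 -> ((1/2)%:E <= supSigma Cm mu0 s2 W)%E) /\
     ((1/2)%:E <= test_size M0s Cm W)%E) /\
  (* part 4 *)
  (Nstar Om <> [set: 'cV[R]_n] ->
     (Mspan X e_plus /\ Rm *m beta_hat X e_plus != 0) \/
     (Mspan X e_minus /\ Rm *m beta_hat X e_minus != 0) ->
     (forall mu0 s2, M0s mu0 -> 0 < s2 -> supSigma Cm mu0 s2 W = 1%E) /\
     test_size M0s Cm W = 1%E).
Proof.
case: n X Cm => [//|n] X Cm _ k1 kn rX q1 rR [kok [bok [p1 pk]]] cov ar C0 Om T W M0s M1s.
(* From p (k + 1) <= n and k, p >= 1 at least p residual columns remain. *)
have m0 : (0 < n.+1 - p)%N.
  rewrite subn_gt0; have : (p * 2 <= p * (k + 1))%N by rewrite leq_mul2l addn1 ltnS k1 orbT.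
  by lia.
have key (e : 'cV[R]_n.+1) : e = e_plus \/ e = e_minus ->
    exists s c : R, [/\ s ^+ 2 = 1, c ^+ 2 = 1 & e = c *: pow_vec s n.+1].
  case=> ->.
    exists 1, 1; split; rewrite ?expr1n//; apply/matrixP => i j.
    by rewrite !mxE expr1n mulr1.
  exists (-1), (-1); split; rewrite ?sqrrN ?expr1n//; apply/matrixP => i j.
  by rewrite !mxE exprS.
have T0e e mu : M0s mu -> T (e + mu) = T0 p X Rm kappa bw e by exact: T01.
split.
  move=> e he eN [mu [hmu hT]]; have [s [c [s1 c1 eE]]] := key e he.
  rewrite T0e// in hT; have [h1 h2] := size1_of_gt r rX rR kok bok m0 cov ar C0 s1 c1 eE eN hT.
  by split=> [mu' hmu'|]; [rewrite T0e|split].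
split.
  move=> e he eN [mu [hmu hT]]; have [s [c [s1 c1 eE]]] := key e he.
  rewrite T0e// in hT; have h := biased_of_lt r rX rR q1 kok bok m0 ar C0 s1 c1 eE eN hT.
  by split=> [mu' hmu'|//]; rewrite T0e.
split.
  move=> e he eN [mu [hmu [hT dT]]]; have [s [c [s1 c1 eE]]] := key e he.
  have h := supSigma_ge_half rX rR kok bok m0 ar C0 s1 c1 eE hmu hT dT.
  split; last first.
    split; first exact: h.
    by apply: le_trans (h _ _ hmu ltr01) _; exact: size_ge_sup.
  move=> mu' hmu'; split; first by rewrite T0e// -(T0e _ _ hmu).
  (* T is its own composition with the translation that takes e + mu' to e + mu, which carries
     differentiability over. *)
  have TE y : T y = T (y - mu' + mu) by rewrite T0e// -(T0e _ _ hmu') subrK.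
  rewrite (_ : T = T \o (fun y => y - mu' + mu)); last by apply/funext => y; exact: TE.
  apply: differentiable_comp; last by rewrite addrK.
  by apply: differentiableD.
move=> NT hE.
have [y0 Ny0] : exists y0, ~ Nstar Om y0.
  apply: contrapT => h; apply: NT; apply/seteqP; split=> // y _.
  by apply: contrapT => hy; apply: h; exists y.
have [e [he [b eb] Re]] : exists e : 'cV[R]_n.+1,
    [/\ e = e_plus \/ e = e_minus, Mspan X e & Rm *m beta_hat X e != 0].
  by case: hE => -[h1 h2]; [exists e_plus|exists e_minus]; split=> //; [left|right].
have [s [c [s1 c1 eE]]] := key e he.
have c0 : c != 0 by apply: contra_eqN c1 => /eqP ->; rewrite expr0n/= eq_sym oner_neq0.
have esX : pow_vec s n.+1 = X *m (c *: b).
  by rewrite -scalemxAr -eb eE scalerA -expr2 c1 scale1r.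
have Rb : Rm *m (c *: b) != 0.
  have bE : beta_hat X e = b.
    by have := beta_hat_lin 0 0 b rX; rewrite !scale0r !add0r -eb.
  by rewrite -scalemxAr scaler_eq0 negb_or c0 -bE.
have h := supSigma_eq1_of_span rX kok bok m0 cov ar C0 s1 esX Rb Ny0.
split; first exact: h.
apply/eqP; rewrite eq_le size_le1//=; have [mu hmu] := M0_neq0 X r rR.
by rewrite -(h _ _ _ hmu ltr01); exact: size_ge_sup.
Qed.
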